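(* Let $\varepsilon>0$. For even $n\geq 2$, let $S_{\varepsilon,n}$ be the set of balanced partitions $\lambda$ of $n$ whose 2-quotient $(\alpha,\beta)$ satisfies $\|L_\alpha-L_\beta\|>\varepsilon$. Then there is a constant $K>0$, depending on $\varepsilon$, such that the $\mathsf w$-probability of $S_{\varepsilon,n}$ satisfies $$\frac{\sum_{\lambda\in S_{\varepsilon,n}}\mathsf w(\lambda)}{\sum_{|\lambda|=n}\mathsf w(\lambda)}=O\!\left(e^{-K\sqrt n}\right)\qquad\text{as } n\to\infty.$$
   Context: Pillowcase weights. For a partition $\lambda$ of an even number, $\mathsf w(\lambda)=\left(\frac{\dim\lambda}{|\lambda|!}\right)^2\mathbf f_{(2,2,\dots,2)}(\lambda)^4$, where $\mathbf f_\eta(\lambda)=|C_\eta|\chi^\lambda(\eta)/\dim\lambda$, $\chi^\lambda$ is the irreducible character of $S(|\lambda|)$ indexed by $\lambda$, $\dim\lambda$ its dimension, $C_\eta$ the conjugacy class of cycle type $\eta$, and $(2,\dots,2)$ is the partition of $|\lambda|$ with all parts equal to 2. Balanced partitions and 2-quotients. A partition is balanced if its Young diagram can be obtained from the empty one by successively adding dominoes (pairs of adjacent cells), each intermediate shape being a Young diagram. For a partition $\lambda=(\lambda_1\ge\lambda_2\ge\dots)$ (extended by zeros) let $M(\lambda)=\{\lambda_i-i+\tfrac12: i\ge1\}$. For $\lambda$ balanced, its 2-quotient is the pair of partitions $(\alpha,\beta)$ determined by $M(\alpha)=\{(x+\tfrac12)/2: x\in M(\lambda)\cap(2\mathbb Z+\tfrac12)\}$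 and $M(\beta)=\{(x-\tfrac12)/2: x\in M(\lambda)\cap(2\mathbb Z-\tfrac12)\}$. Rescaled rims. Let $n=|\lambda|$. $L_\alpha:\mathbb R\to\mathbb R_{\ge0}$ describes the rim of the Young diagram of $\alpha$, drawn with square cells of side $1/\sqrt n$ and rotated so that its corner is at the origin and its axes are the diagonals $y=|x|$: explicitly $L_\alpha(s)=\frac1{\sqrt{2n}}G_\alpha(\sqrt{2n}\,s)$, where $G_\alpha$ is the continuous piecewise linear function with $G_\alpha(u)=|u|$ for $|u|$ large whose slope on the open unit interval centred at $x\in\mathbb Z+\frac12$ is $-1$ if $x\in M(\alpha)$ and $+1$ otherwise. $L_\beta$ is defined in the same way from $\beta$, with the same $n=|\lambda|$. The Sobolev norm is $$\|\Delta\|^2=\int_{\mathbb R^2}\left(\frac{\Delta(s)-\Delta(t)}{s-t}\right)^2ds\,dt .$$ *)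

(* Defs.v *)
From HB Require Import structures.
From mathcomp Require Import all_boot all_order all_algebra all_fingroup.
From mathcomp Require Import all_character.
From mathcomp Require Import all_classical all_reals all_analysis.

Set Implicit Arguments.
Unset Strict Implicit.
Unset Printing Implicit Defensive.

Import Order.TTheory GRing.Theory Num.Theory numFieldNormedType.Exports.

Local Open Scope ring_scope.

(* A partition is the weakly decreasing sequence of its nonzero parts; [part la i]
   is the part of index i (counted from 0), extended by zeros. *)
Definition is_part (la : seq nat) : bool := sorted geq la && (0%N \notin la).

Definition part (la : seq nat) (i : nat) : nat := nth 0%N la i.

Section SpechtModule.
Variables (F : fieldType) (la : seq nat).
Let n := sumn la.
Let G : {group 'S_n} := [set: 'S_n]%G.

(* The cells of the diagram are numbered from 0 to n - 1 row by row:
   [reshape_index la k] and [reshape_offset la k] are the row and the column of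
   the cell numbered k. *)
Definition row_stab : {set 'S_n} :=
  [set s : 'S_n | [forall k : 'I_n, reshape_index la (s k) == reshape_index la k]].

Definition col_stab : {set 'S_n} :=
  [set s : 'S_n | [forall k : 'I_n, reshape_offset la (s k) == reshape_offset la k]].

Definition young_symmetrizer : 'rV[F]_#|G| :=
  \sum_(s in row_stab) \sum_(t in col_stab)
    (-1) ^+ odd_perm t *: delta_mx 0 (gring_index G (s * t)%g).

(* The Specht module is the right ideal of the group algebra F[S_n] generated by
   the Young symmetrizer; in characteristic 0 it is the (absolutely) irreducible
   representation of S_n indexed by la. *)
Definition specht_mx : 'M[F]_#|G| :=
  cyclic_mx (regular_repr F G) young_symmetrizer.

Definition specht_dim : nat := \rank specht_mx.

Definition specht_repr : mx_representation F G specht_dim :=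
  submod_repr (cyclic_mx_module (regular_repr F G) young_symmetrizer).

Definition specht_char (s : 'S_n) : F := \tr (specht_repr s).

End SpechtModule.

(* Fixed points count as parts equal to 1. *)
Definition cycle_class (n : nat) (eta : seq nat) : {set 'S_n} :=
  [set s : 'S_n | perm_eq [seq #|X| | X : {set 'I_n} <- enum (porbits s)] eta].

(* [repr C] is an element of C when C is nonempty; otherwise the factor #|C|
   vanishes. *)
Definition central_char (F : fieldType) (eta la : seq nat) : F :=
  let C := cycle_class (sumn la) eta in
  #|C|%:R * specht_char F (repr C) / (specht_dim F la)%:R.

(* Specht modules are defined over the rationals, so that computing characters
   over R or over the complex numbers gives the same values. *)
Definition pillow_weight (R : realType) (la : seq nat) : R :=
  ((specht_dim R la)%:R / (sumn la)`!%:R) ^+ 2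
  * central_char R (nseq (sumn la)./2 2%N) la ^+ 4.

Definition in_diagram (la : seq nat) (c : nat * nat) : bool :=
  (c.2 < part la c.1)%N.

Definition adjacent (c d : nat * nat) : bool :=
  (d == (c.1, c.2.+1)) || (d == (c.1.+1, c.2)).

Definition add_domino (la mu : seq nat) : Prop :=
  exists c d : nat * nat,
    [/\ adjacent c d, ~~ in_diagram la c, ~~ in_diagram la d
      & forall e, in_diagram mu e = [|| in_diagram la e, e == c | e == d]].

Inductive balanced : seq nat -> Prop :=
| balanced_nil : balanced [::]
| balanced_add la mu :
    balanced la -> is_part mu -> add_domino la mu -> balanced mu.

Local Open Scope classical_set_scope.

Definition partitions (n : nat) : set (seq nat) :=
  [set la | is_part la /\ sumn la = n].

Section Rims.
Variable R : realType.

Definition maya (la : seq nat) : set R :=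
  [set (part la i)%:R - i.+1%:R + 2^-1 | i in [set: nat]].

Definition two_quotient (la al be : seq nat) : Prop :=
  [/\ is_part al, is_part be,
      maya al = [set (x + 2^-1) / 2 | x in maya la `&`
                   [set x | exists m : int, x = 2 * m%:~R + 2^-1]]
    & maya be = [set (x - 2^-1) / 2 | x in maya la `&`
                   [set x | exists m : int, x = 2 * m%:~R - 2^-1]]].

Definition is_rim (al : seq nat) (G : R -> R) : Prop :=
  [/\ continuous G,
      exists A : R, forall u, A <= `|u| -> G u = `|u|
    & forall (m : int) (u v : R), let x := m%:~R + 2^-1 in
        x - 2^-1 < u < x + 2^-1 -> x - 2^-1 < v < x + 2^-1 ->
        G v - G u = (if x \in maya al then -1 else 1) * (v - u)].

(* The function satisfying [is_rim al] is unique, and exists for every partition. *)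
Definition rim (al : seq nat) : R -> R := get (is_rim al).

Definition rescaled_rim (n : nat) (al : seq nat) (s : R) : R :=
  rim al (Num.sqrt (2 * n%:R) * s) / Num.sqrt (2 * n%:R).

(* Division by 0 is 0, which only affects the null set s = t. *)
Definition sobolev_norm (D : R -> R) : \bar R :=
  sqrte (\int[(@lebesgue_measure R \x @lebesgue_measure R)%E]_z
           ((((D z.1 - D z.2) / (z.1 - z.2)) ^+ 2)%:E))%E.

Definition distant_quotient_set (eps : R) (n : nat) : set (seq nat) :=
  [set la | [/\ partitions n la, balanced la
    & exists al be, two_quotient la al be /\
        (eps%:E < sobolev_norm (rescaled_rim n al \- rescaled_rim n be)%R)%E]].

Definition pillow_prob (n : nat) (S : set (seq nat)) : R :=
  (\sum_(la \in S) pillow_weight R la)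
  / (\sum_(la \in partitions n) pillow_weight R la).

End Rims.

(* Main.v *)
Require Import Defs.
From mathcomp Require Import all_boot all_order all_algebra all_fingroup.
From mathcomp Require Import all_character.
From mathcomp Require Import ring lra zify.

(* The class size cancels in the ratio of [w(lambda)] to the weight of the
   one-row partition, which equals [(chi^lambda(2,...,2)^2 / dim lambda)^2].
   The Specht character is, up to sign, the Jacobi-Trudi class function obtained
   by alternating permutation characters: both have norm 1 and their inner
   product is a sign.  Hence the dimension is a Vandermonde quotient in the beads
   [lambda_i + N - i], and the value on (2,...,2) is a product of two such
   quotients, over the even and over the odd beads.  Consequently
   [ln (chi^2 / dim)] is, up to [O(sqrt n * ln n)], half the sum of
   [f x * f y * ln |x - y|], where [f] is the difference of the indicators of the
   beads of alpha and beta.  Summation by parts turns this into minus a sum of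
   squares [((F x - F y) / (x - y))^2] in the partial sums [F] of [f], which
   interpolate the difference of the two rims, so this sum dominates the Sobolev
   norm.  A partition in the exceptional set therefore has relative weight
   [exp (- n * eps^2 / 48 + O(sqrt n * ln n))], while there are only
   [exp (O(sqrt n * ln n))] partitions of n. *)

Import Order.TTheory GRing.Theory Num.Theory.

Set Implicit Arguments.
Unset Strict Implicit.
Unset Printing Implicit Defensive.

Local Open Scope ring_scope.

(** * Characters of Specht modules *)

(** The denominator of the probability is at least the weight of the one-row partition, so a uniform
    upper bound on relative weights and a crude count of partitions suffice. The Specht modules are
    given only as ideals generated by Young symmetrizers. Instead of appealing to Schur
    orthogonality or the Frobenius formula, the norm of the character is computed from the identity
    [R h C = c(h) e] for the row sum [R] and the alternating column sum [C]. The sign left open by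
    the comparison with Jacobi-Trudi is harmless: weights contain the fourth power of the character,
    and dimensions are nonnegative. The second difference of [ln |t|] is not controlled next to the
    diagonal; a finite value of the kernel at 0 repairs this at the cost of the sum of [f ^+ 2]. The
    remaining errors are governed by the sum of [|f|], at most twice the side of the Durfee square,
    hence at most [2 * sqrt n]. That even and odd beads are equally many comes from the rims of
    alpha and beta agreeing far out on both sides. Since the gain is of order [n], the rate [K = 1]
    works for every [eps]; only the threshold on [n] depends on it. *)

Lemma card_le_injective_bound (T : finType) (A : {pred T}) (k : nat) (f : T -> nat) :
  {in A &, injective f} -> {in A, forall x, f x < k}%N -> (#|A| <= k)%N.
Proof.
move=> f_inj fk; rewrite cardE -(size_map f) -(size_iota 0 k) uniq_leq_size //.
  by rewrite map_inj_in_uniq ?enum_uniq // => x y; rewrite !mem_enum; apply: f_inj.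
by move=> _ /mapP[x + ->]; rewrite mem_enum mem_iota => /fk.
Qed.

Lemma same_fibers_perm (n : nat) (T : eqType) (u v : 'I_n -> T) :
  (forall t, #|[pred x | u x == t]| = #|[pred x | v x == t]|) ->
  exists g : 'S_n, forall x, u x = v (g x).
Proof.
move=> uv.
have /tuple_permP [g ug] : perm_eq [tuple u i | i < n] [tuple v i | i < n].
  apply/allP => t _ /=.
  rewrite !count_map.
  have cE (w : 'I_n -> T) : count (preim w (pred1 t)) (enum 'I_n) = #|[pred x | w x == t]|.
    by rewrite cardE size_filter enumT.
  by rewrite -!enumT [X in X == _]cE [X in _ == X]cE uv.
exists g => x; have := congr1 (fun s => nth (u x) s x) ug.
rewrite (nth_map x) ?size_enum_ord // nth_ord_enum => ->.
by rewrite (nth_map x) ?size_enum_ord // nth_ord_enum !tnth_mktuple.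
Qed.

(** * Column-injective colourings of a Young diagram *)

Section YoungDiagramColoring.
Variables (n : nat) (row col : 'I_n -> nat).
Hypothesis cell_inj : forall x y, row x = row y -> col x = col y -> x = y.
Hypothesis young : forall x i, (i <= row x)%N -> exists2 y, row y = i & col y = col x.

(* A column meets the first k colours at most as often as it meets the first k
   rows, so dominance forces equality in each column. *)
Lemma column_injective_coloring (d : 'I_n -> nat) :
  (forall x y, col x = col y -> d x = d y -> x = y) ->
  (forall k, #|[pred x | (row x < k)%N]| <= #|[pred x | (d x < k)%N]|)%N ->
  exists t : 'S_n, forall x, col (t x) = col x /\ row (t x) = d x.
Proof.
move=> d_inj dom.
pose C e k j := #|[pred x | (col x == j) && (e x < k)%N]|.
(* If column [j] reaches row [k], it has exactly [k] cells in the first [k] rows, and [d], injective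
   on the column, takes at most [k] values below [k]. Otherwise the whole column lies in the first
   [k] rows. *)
have le_kC k j : (C d k j <= C row k j)%N.
  case: (pickP [pred x | (col x == j) && (k <= row x)%N]) => [x /andP[/eqP xj kx]|rowk].
    have -> : C row k j = k.
      apply/eqP; rewrite eqn_leq; apply/andP; split.
        apply: (card_le_injective_bound (f := row)) => [y z|y].
          by move=> /andP[/eqP yj _] /andP[/eqP zj _] e; apply: cell_inj; rewrite ?yj.
        by case/andP.
      have cell (i : 'I_k) : exists y, (row y == i) && (col y == j).
        have [|y yi yj] := @young x i; first exact: leq_trans (ltnW (ltn_ord i)) kx.
        by exists y; rewrite yi yj xj !eqxx.
      pose f i := xchoose (cell i).
      have fP i : row (f i) = i /\ col (f i) = j.
        by have /andP[/eqP ? /eqP ?] := xchooseP (cell i).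
      have f_inj : injective f.
        by move=> a b ab; apply/val_inj; have := (fP a).1; rewrite ab (fP b).1.
      rewrite -[X in (X <= _)%N](card_ord k) -(card_image f_inj).
      apply/subset_leq_card/subsetP => _ /imageP[i _ ->].
      by rewrite inE (fP i).1 (fP i).2 eqxx ltn_ord.
    apply: (card_le_injective_bound (f := d)) => [y z|y].
      by move=> /andP[/eqP yj _] /andP[/eqP zj _]; apply: d_inj; rewrite yj.
    by case/andP.
  apply/subset_leq_card/subsetP => y; rewrite !inE => /andP[yj _]; rewrite yj /=.
  by have := rowk y; rewrite /= yj /=; case: leqP.
pose m := (\max_x col x).+1.
have colm x : (col x < m)%N by rewrite ltnS; apply: leq_bigmax.
have sumC e k : #|[pred x | (e x < k)%N]| = (\sum_(j < m) C e k j)%N.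
  rewrite -sum1_card (partition_big (fun x => Ordinal (colm x)) predT) //=.
  by apply: eq_bigr => j _; rewrite /C -[RHS]sum1_card; apply: eq_bigl => x; rewrite !inE andbC.
have eqC k j : C d k j = C row k j.
  case: (ltnP j m) => jm; last first.
    by rewrite /C !eq_card0 // => x; rewrite !inE; apply/negbTE;
      rewrite negb_and neq_ltn (leq_trans (colm x) jm).
  apply/eqP; rewrite eqn_leq le_kC /=; have := dom k.
  rewrite !sumC (bigD1 (Ordinal jm)) //= [X in (_ <= X)%N](bigD1 (Ordinal jm)) //= => le.
  rewrite -(leq_add2r (\sum_(i < m | i != Ordinal jm) C row k i)) (leq_trans le) //.
  by rewrite leq_add2l; apply: leq_sum.
have [|t tE] := @same_fibers_perm n _ (fun x => (col x, d x)) (fun x => (col x, row x)).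
  case=> j k; have splitC e :
      C e k.+1 j = (C e k j + #|[pred x | (col x, e x) == (j, k)]|)%N.
    rewrite /C -(cardID [pred x | (e x < k)%N]); congr (_ + _)%N; apply: eq_card => x;
    rewrite !inE ?xpair_eqE; case: (col x == j); rewrite /= ?andbF //; lia.
  by have := splitC d; rewrite !eqC splitC => /addnI ->.
by exists t => x; case: (tE x).
Qed.

End YoungDiagramColoring.

(** * The regular representation and its normalized trace *)

Section RegularMatrix.
Variables (F : numFieldType) (n : nat).
Let G : {group 'S_n} := [set: 'S_n]%G.

Definition reg (g : 'S_n) : 'M[F]_#|G| := regular_repr F G g.

Lemma regM g h : reg (g * h)%g = reg g *m reg h.
Proof. by rewrite /reg repr_mxM ?inE. Qed.

Lemma reg1 : reg 1%g = 1%:M.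
Proof. exact: repr_mx1. Qed.

Lemma regE g i j : reg g i j = (enum_val j == enum_val i * g)%g%:R.
Proof.
rewrite mxE mxE eqxx /= -(inj_eq (can_inj (@gring_valK _ G))) gring_indexK ?inE //.
Qed.

Lemma reg_tr g : (reg g)^T = reg g^-1%g.
Proof.
apply/matrixP => i j; rewrite mxE !regE; congr (nat_of_bool _)%:R.
by apply/eqP/eqP => ->; rewrite ?mulgK ?mulgKV.
Qed.

(** On the span of the [reg g] this is the coefficient of the identity; being a trace, it is
    invariant under cyclic rotation and transposition. *)
Definition tau (A : 'M[F]_#|G|) : F := \tr A / #|G|%:R.

Lemma cardG_neq0 : #|G|%:R != 0 :> F.
Proof. by rewrite pnatr_eq0 -lt0n cardG_gt0. Qed.

Lemma tau_reg g : tau (reg g) = (g == 1%g)%:R.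
Proof.
rewrite /tau /mxtrace; case: eqP => [->|/eqP g1].
  rewrite (eq_bigr (fun=> 1)) => [|i _]; last by rewrite regE mulg1 eqxx.
  by rewrite sumr_const card_ord divff ?cardG_neq0.
rewrite big1 ?mul0r // => i _; rewrite regE -{1}[enum_val i]mulg1.
by rewrite (inj_eq (mulgI _)) eq_sym (negbTE g1).
Qed.

Lemma tau0 : tau 0 = 0.
Proof. by rewrite /tau mxtrace0 mul0r. Qed.

Lemma tauD A B : tau (A + B) = tau A + tau B.
Proof. by rewrite /tau mxtraceD mulrDl. Qed.

Lemma tauZ a A : tau (a *: A) = a * tau A.
Proof. by rewrite /tau mxtraceZ mulrA. Qed.

Lemma tau_sum (I : Type) (r : seq I) (P : pred I) (E : I -> 'M[F]_#|G|) :
  tau (\sum_(i <- r | P i) E i) = \sum_(i <- r | P i) tau (E i).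
Proof.
exact: (big_morph tau tauD tau0).
Qed.

Lemma tau_mulC A B : tau (A *m B) = tau (B *m A).
Proof. by rewrite /tau mxtrace_mulC. Qed.

Lemma tau_tr A : tau A^T = tau A.
Proof. by rewrite /tau mxtrace_tr. Qed.

End RegularMatrix.

(** A rank factorization [L = C R] turns the hypothesis into [R C = kappa]. The lemma serves to
    exclude [kappa = 0] for a matrix of nonzero trace. *)
Lemma sub_scaled_idempotent_trace (F : fieldType) (k : nat) (L : 'M[F]_k) (kappa : F) :
  L *m L = kappa *: L -> \tr L = kappa * (\rank L)%:R.
Proof.
move=> LL; rewrite -{1}(mulmx_base L) mxtrace_mulC.
suff -> : row_base L *m col_base L = kappa%:M by rewrite mxtrace_scalar mulr_natr.
apply: (row_free_inj (row_base_free L)); apply/(row_full_inj (col_base_full L)).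
rewrite mul_scalar_mx -scalemxAr mulmx_base -LL.
transitivity ((col_base L *m row_base L) *m (col_base L *m row_base L)).
  by rewrite !mulmxA.
by rewrite mulmx_base.
Qed.

(* With [L] proportional to a projection onto the module, the trace on the
   module is a trace on the whole space. *)
Lemma submod_trace (F : fieldType) (gT : finGroupType) (G : {group gT}) (k : nat)
    (rG : mx_representation F G k) (U : 'M[F]_k) (modU : mxmodule rG U)
    (L : 'M[F]_k) (kappa : F) x :
  x \in G -> L *m L = kappa *: L -> (L :=: U)%MS ->
  \tr (L *m rG x) = kappa * \tr (submod_repr modU x).
Proof.
move=> Gx LL LU.
have sLU : (L <= U)%MS by rewrite LU.
set X := in_submod U L; set B := val_submod (1%:M : 'M_(\rank U)).
have LXB : L = X *m B by rewrite -[LHS](in_submodK sLU) val_submodE.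
have BL : B *m L = kappa *: B.
  have : (B <= L)%MS by rewrite LU val_submodP.
  by case/submxP => Y ->; rewrite -mulmxA LL scalemxAr.
have BX : B *m X = kappa%:M.
  apply: (val_submod_inj (U := U)); rewrite [LHS]val_submodE [RHS]val_submodE.
  by rewrite -/B mul_scalar_mx -BL LXB -!mulmxA.
have := @val_submodJ _ _ _ _ rG U modU _ 1%:M x Gx; rewrite mul1mx => SB.
rewrite LXB -mulmxA -/B -SB val_submodE -/B mulmxA mxtrace_mulC mulmxA BX.
by rewrite mul_scalar_mx mxtraceZ.
Qed.

(** * Young symmetrizers and the norm of their characters *)

Section YoungSymmetrizer.
Variables (F : numFieldType) (n : nat) (row col : 'I_n -> nat).
Hypothesis cell_inj : forall x y, row x = row y -> col x = col y -> x = y.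
Hypothesis young : forall x i, (i <= row x)%N -> exists2 y, row y = i & col y = col x.
Let G : {group 'S_n} := [set: 'S_n]%G.
Local Notation reg := (@reg F n).
Local Notation tau := (@tau F n).

Definition level_stab (lev : 'I_n -> nat) : {set 'S_n} :=
  [set s : 'S_n | [forall k : 'I_n, lev (s k) == lev k]].

Lemma level_stabP lev (s : 'S_n) : reflect (forall k, lev (s k) = lev k) (s \in level_stab lev).
Proof. by rewrite inE; apply: (iffP forallP) => H k; apply/eqP. Qed.

Lemma level_stab_group_set lev : group_set (level_stab lev).
Proof.
apply/group_setP; split=> [|s t /level_stabP Hs /level_stabP Ht].
  by apply/level_stabP => k; rewrite perm1.
by apply/level_stabP => k; rewrite permM Ht Hs.
Qed.

Canonical level_stab_group lev := Group (level_stab_group_set lev).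

Local Notation rowS := (level_stab_group row).
Local Notation colS := (level_stab_group col).

Lemma rowS_colS_trivial (s : 'S_n) : s \in rowS -> s \in colS -> s = 1%g.
Proof.
by move=> /level_stabP sr /level_stabP sc; apply/permP => x; rewrite perm1; apply: cell_inj.
Qed.

Definition row_sum : 'M[F]_#|G| := \sum_(p in rowS) reg p.
Definition col_alt : 'M[F]_#|G| := \sum_(q in colS) (-1) ^+ odd_perm q *: reg q.
Definition symmetrizer : 'M[F]_#|G| := row_sum *m col_alt.
Local Notation e := symmetrizer.

(** The coefficient of [g] in the symmetrizer. Row and column groups meet trivially, so at most one
    pair [p, q] contributes and the value is 0 or a sign. *)
Definition sym_coef (g : 'S_n) : F :=
  \sum_(p in rowS) \sum_(q in colS) (-1) ^+ odd_perm q * (g == p * q)%g%:R.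

Lemma row_sumMl p : p \in rowS -> reg p *m row_sum = row_sum.
Proof.
move=> pR; rewrite mulmx_sumr [RHS](reindex_inj (mulgI p)) /=.
by apply: eq_big => [q|q _]; rewrite ?groupMl ?regM //.
Qed.

Lemma row_sum_tr : row_sum^T = row_sum.
Proof.
rewrite linear_sum [RHS](reindex_inj invg_inj) /=.
by apply: eq_big => [q|q _]; rewrite ?groupV ?reg_tr.
Qed.

Lemma row_sumMr p : p \in rowS -> row_sum *m reg p = row_sum.
Proof.
move=> pR; apply: trmx_inj; rewrite trmx_mul row_sum_tr reg_tr row_sumMl //.
by rewrite groupV.
Qed.

Lemma col_altMl q : q \in colS -> reg q *m col_alt = (-1) ^+ odd_perm q *: col_alt.
Proof.
move=> qC; rewrite mulmx_sumr [X in _ = _ *: X](reindex_inj (mulgI q)) scaler_sumr.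
apply: eq_big => [r|r _]; rewrite ?groupMl // -scalemxAr scalerA regM; congr (_ *: _).
by rewrite odd_permM signr_addb mulrA -expr2 sqrr_sign mul1r.
Qed.

Lemma col_alt_tr : col_alt^T = col_alt.
Proof.
rewrite linear_sum [RHS](reindex_inj invg_inj) /=.
by apply: eq_big => [q|q _]; rewrite ?groupV // linearZ /= reg_tr odd_permV.
Qed.

Lemma col_altMr q : q \in colS -> col_alt *m reg q = (-1) ^+ odd_perm q *: col_alt.
Proof.
move=> qC; apply: trmx_inj; rewrite trmx_mul linearZ /= col_alt_tr reg_tr col_altMl //.
  by rewrite odd_permV.
by rewrite groupV.
Qed.

Lemma symmetrizerE : e = \sum_g sym_coef g *: reg g.
Proof.
rewrite /e mulmx_suml.
under [RHS]eq_bigr do rewrite scaler_suml.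
rewrite [RHS]exchange_big; apply: eq_bigr => p pR /=.
under [RHS]eq_bigr do rewrite scaler_suml.
rewrite [RHS]exchange_big mulmx_sumr; apply: eq_bigr => q qC /=.
rewrite -scalemxAr -regM (bigD1 (p * q)%g) //= eqxx mulr1 big1 ?addr0 // => g /negbTE ->.
by rewrite mulr0 scale0r.
Qed.

Lemma sym_coef_mul p q : p \in rowS -> q \in colS -> sym_coef (p * q)%g = (-1) ^+ odd_perm q.
Proof.
move=> pR qC; have uniq p' q' : p' \in rowS -> q' \in colS ->
    (p * q)%g = (p' * q')%g -> p = p' /\ q = q'.
  move=> p'R q'C E; have qq : (q' * q^-1 = p'^-1 * p)%g.
    by apply: (mulgI p'); rewrite !mulgA -E mulgK mulgV mul1g.
  have /rowS_colS_trivial E1 : (q' * q^-1)%g \in rowS by rewrite qq groupM ?groupV.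
  have {}E1 : (q' * q^-1 = 1)%g by rewrite E1 // groupM ?groupV.
  have qE : q' = q by apply/eqP; rewrite eq_mulgV1 E1.
  by split=> //; apply: (mulIg q); rewrite E qE.
rewrite /sym_coef (bigD1 p) //= (bigD1 q) //= eqxx mulr1.
rewrite big1 ?addr0 => [|q' /andP[q'C /eqP qq']]; last first.
  by case: eqP => [/uniq[]//|_]; [move=> _ E; case: qq' | rewrite mulr0].
rewrite big1 ?addr0 // => p' /andP[p'R /eqP pp'].
rewrite big1 // => q' q'C; case: eqP => [/uniq[]//|_]; last by rewrite mulr0.
by move=> E; case: pp'.
Qed.

Lemma tperm_colS a b : col a = col b -> tperm a b \in colS.
Proof. by move=> E; apply/level_stabP => k; case: tpermP => [->|->|]. Qed.

Lemma tperm_rowS a b : row a = row b -> tperm a b \in rowS.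
Proof. by move=> E; apply/level_stabP => k; case: tpermP => [->|->|]. Qed.

Lemma eq_opp0 (A : 'M[F]_#|G|) : A = - A -> A = 0.
Proof.
move=> /eqP; rewrite -subr_eq0 opprK -mulr2n -scaler_nat scaler_eq0 pnatr_eq0 /=.
by move/eqP.
Qed.

(* Unless [h] is a row permutation times a column permutation, a transposition
   fixes [row_sum *m reg h] and negates [col_alt], and both sides vanish. *)
Lemma row_sum_reg_col_alt h : row_sum *m reg h *m col_alt = sym_coef h *: e.
Proof.
case: (pickP [pred ab : 'I_n * 'I_n | [&& ab.1 != ab.2, col ab.1 == col ab.2
    & row ((h^-1)%g ab.1) == row ((h^-1)%g ab.2)]]) => [[a b] /and3P[/= ab /eqP cab /eqP rab]|inj].
  have E : row_sum *m reg h = row_sum *m reg h *m reg (tperm a b).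
    rewrite -mulmxA -regM -[(h * tperm a b)%g](mulgKV h) regM mulmxA; congr (_ *m _); rewrite row_sumMr //.
    have -> : (h * tperm a b * h^-1 = tperm (h^-1 a) (h^-1 b))%g by rewrite -tpermJ conjgE invgK mulgA.
    by apply: tperm_rowS.
  have z0 : row_sum *m reg h *m col_alt = 0.
    apply: eq_opp0; rewrite {1}E -mulmxA col_altMl ?tperm_colS //.
    by rewrite odd_tperm ab expr1 scaleN1r mulmxN.
  rewrite z0; suff -> : sym_coef h = 0 by rewrite scale0r.
  rewrite /sym_coef big1 // => p pR; rewrite big1 // => q qC.
  case: eqP => [hpq|_]; last by rewrite mulr0.
  have qV : (q^-1)%g \in colS by rewrite groupV.
  have pV : (p^-1)%g \in rowS by rewrite groupV.
  have rE x : row ((h^-1)%g x) = row ((q^-1)%g x).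
    by rewrite hpq invMg permM (level_stabP _ _ pV).
  move: rab; rewrite !rE => rab; case/eqP: ab; apply: (perm_inj (s := (q^-1)%g)).
  by apply: cell_inj => //; rewrite !(level_stabP _ _ qV).
(* No column contains two cells that [h^-1] sends to the same row, so [row] after [h^-1] is a
   column-injective colouring. The column permutation [t] realizing it puts [h * t] in the row
   group. *)
have [|k|t tP] := @column_injective_coloring n row col cell_inj young (fun x => row ((h^-1)%g x)).
- move=> x y cxy rxy; apply/eqP; apply/negPn/negP => xy; have := inj (x, y).
  by rewrite /= xy cxy rxy !eqxx.
- rewrite -(card_imset _ (perm_inj (s := h))); apply/subset_leq_card/subsetP => _ /imsetP[x xk ->].
  by rewrite !inE permK.
have tC : t \in colS by apply/level_stabP => x; case: (tP x).
have sR : (h * t)%g \in rowS.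
  by apply/level_stabP => x; rewrite permM (tP _).2 permK.
have -> : h = (h * t * t^-1)%g by rewrite mulgK.
rewrite sym_coef_mul ?groupV // regM mulmxA row_sumMr // -mulmxA col_altMl ?groupV //.
by rewrite -scalemxAr.
Qed.

Lemma row_sum_mul_col_alt (A : 'S_n -> F) :
  row_sum *m (\sum_g A g *: reg g) *m col_alt = (\sum_g A g * sym_coef g) *: e.
Proof.
rewrite [row_sum *m _]mulmx_sumr [_ *m col_alt]mulmx_suml scaler_suml; apply: eq_bigr => g _.
by rewrite -scalemxAr -scalemxAl row_sum_reg_col_alt scalerA.
Qed.

Lemma sym_coef1 : sym_coef 1%g = 1.
Proof. by rewrite -{1}[1%g]mulg1 sym_coef_mul ?group1 // odd_perm1. Qed.

Lemma tau_symmetrizer_reg g : tau (e *m reg g) = sym_coef g^-1%g.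
Proof.
rewrite symmetrizerE mulmx_suml tau_sum (bigD1 g^-1%g) //= -scalemxAl -regM mulVg tauZ.
rewrite tau_reg eqxx mulr1 big1 ?addr0 // => h hg; rewrite -scalemxAl -regM tauZ tau_reg.
by rewrite -eq_invg_mul -(inj_eq invg_inj) invgK (negbTE hg) mulr0.
Qed.

Lemma tau_symmetrizer : tau e = 1.
Proof. by rewrite -[e]mulmx1 -reg1 tau_symmetrizer_reg invg1 sym_coef1. Qed.

(** As [tau e = 1], this is the only possible factor in [e *m e = kappa *: e]. *)
Definition kappa : F := tau (e *m e).

(** With [R] the row sum and [C] the alternating column sum, [e e = R (C R) C], and [C R] is a
    combination of group elements, to which [row_sum_mul_col_alt] applies. *)
Lemma symmetrizer_idem : e *m e = kappa *: e.
Proof.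
have [A AE] : exists A, col_alt *m row_sum = \sum_g A g *: reg g.
  exists (fun g => \sum_(p in rowS) \sum_(q in colS) (-1) ^+ odd_perm q * (g == q * p)%g%:R).
  under [RHS]eq_bigr do rewrite scaler_suml.
  rewrite [RHS]exchange_big mulmx_sumr; apply: eq_bigr => p pR /=.
  under [RHS]eq_bigr do rewrite scaler_suml.
  rewrite [RHS]exchange_big mulmx_suml; apply: eq_bigr => q qC /=.
  rewrite -scalemxAl -regM (bigD1 (q * p)%g) //= eqxx mulr1 big1 ?addr0 // => g /negbTE ->.
  by rewrite mulr0 scale0r.
suff : exists k, e *m e = k *: e.
  by case=> k ek; rewrite /kappa {2}ek tauZ tau_symmetrizer mulr1.
exists (\sum_g A g * sym_coef g); rewrite -row_sum_mul_col_alt -AE.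
by rewrite /symmetrizer !mulmxA.
Qed.

Lemma kappa_neq0 : kappa != 0.
Proof.
have := sub_scaled_idempotent_trace symmetrizer_idem; apply: contra_eq_neq => ->.
rewrite mul0r -(mulfVK (cardG_neq0 F n) (\tr e)) mulf_neq0 ?cardG_neq0 //.
by rewrite -[_ / _]/(tau e) tau_symmetrizer oner_neq0.
Qed.

Definition class_sum (g : 'S_n) : 'M[F]_#|G| := \sum_h reg (h * g * h^-1)%g.

Lemma class_sum_comm g k : reg k *m class_sum g = class_sum g *m reg k.
Proof.
rewrite mulmx_sumr mulmx_suml [RHS](reindex_inj (mulgI k)) /=; apply: eq_bigr => h _.
by rewrite -!regM invMg !mulgA mulgKV.
Qed.

Lemma class_sumJ g k : class_sum (k * g * k^-1)%g = class_sum g.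
Proof.
rewrite /class_sum [RHS](reindex_inj (mulIg k)) /=; apply: eq_bigr => h _.
by rewrite invMg !mulgA.
Qed.

Lemma class_sum_tr g : (class_sum g)^T = class_sum g^-1%g.
Proof.
rewrite /class_sum linear_sum; apply: eq_bigr => h _ /=.
by rewrite reg_tr !invMg invgK mulgA.
Qed.

(** The trace of [x -> e x g / kappa] on the group algebra, collected coefficient by coefficient,
    that is, the character of the ideal generated by [e]. [class_sum] runs over all conjugators, so
    each conjugate is repeated. *)
Definition young_char (g : 'S_n) : F := kappa^-1 * tau (e *m class_sum g).

Lemma young_charJ g k : young_char (k * g * k^-1)%g = young_char g.
Proof. by rewrite /young_char class_sumJ. Qed.

(** Transposition inverts group elements and turns [e = R C] into [C R]; since [R] commutes with
    class sums, cyclicity of [tau] restores the order. *)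
Lemma young_charV g : young_char g^-1%g = young_char g.
Proof.
have RZ : row_sum *m class_sum g = class_sum g *m row_sum.
  rewrite [_ *m row_sum]mulmx_sumr [row_sum *m _]mulmx_suml.
  by apply: eq_bigr => p _; rewrite class_sum_comm.
rewrite /young_char; congr (_ * _); rewrite -class_sum_tr -[LHS]tau_tr trmx_mul trmxK.
rewrite /symmetrizer trmx_mul row_sum_tr col_alt_tr mulmxA tau_mulC mulmxA RZ.
by rewrite -[in LHS]mulmxA tau_mulC.
Qed.

(* Averaging over the conjugates turns the symmetrizer into its character. *)
Lemma sum_class_fun_young_char (f : 'S_n -> F) :
  (forall g k, f (k * g * k^-1)%g = f g) ->
  \sum_g f g * young_char g = kappa^-1 * #|G|%:R * \sum_g f g * sym_coef g^-1%g.
Proof.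
move=> fJ; rewrite -mulrA mulr_natl -sumr_const.
under eq_bigr do rewrite mulrCA.
rewrite -mulr_sumr; congr (_ * _).
transitivity (\sum_(h in G) \sum_g f g * tau (e *m reg (h * g * h^-1)%g)).
  rewrite exchange_big /=; apply: eq_bigr => g _; rewrite /class_sum mulmx_sumr tau_sum.
  by rewrite mulr_sumr; apply: eq_bigl => h; rewrite inE.
apply: eq_bigr => h _; rewrite (reindex_inj (mulgI h^-1%g)) (reindex_inj (mulIg h)) /=.
apply: eq_bigr => g _; rewrite -tau_symmetrizer_reg; congr (_ * tau (_ *m reg _)).
  by rewrite -[in RHS](fJ g h^-1%g) invgK !mulgA.
by rewrite !mulgA mulgV mul1g mulgK.
Qed.

(** Averaging reduces the claim to the sum over [h] of [tau (e h e h^-1)]. By cyclicity each term is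
    [tau] of [(R h C)^T (C h R)], and [R h C = sym_coef h *: e] makes it
    [sym_coef h * kappa * tau (e h)]. These add up to [kappa * tau (e e)], that is [kappa ^+ 2]. *)
Lemma sum_young_char_sqr : \sum_g young_char g ^+ 2 = #|G|%:R.
Proof.
under eq_bigr do rewrite expr2 -{1}young_charV.
have VJ g k : young_char (k * g * k^-1)^-1%g = young_char g^-1%g.
  by rewrite !invMg invgK mulgA young_charJ.
rewrite (sum_class_fun_young_char VJ) -mulrA; apply: (mulfI kappa_neq0).
rewrite mulVKf ?kappa_neq0 // mulrC; congr (_ * _); apply: (mulfI kappa_neq0).
transitivity (\sum_h tau (e *m reg h *m e *m reg h^-1%g)).
  rewrite mulr_sumr.
  transitivity (\sum_g sym_coef g * tau (e *m class_sum g)).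
    rewrite [RHS](reindex_inj invg_inj); apply: eq_bigr => g _ /=.
    rewrite /young_char -[kappa^-1 * _ * _]mulrA. by rewrite mulVKf ?kappa_neq0 // mulrC.
  under eq_bigr do rewrite /class_sum mulmx_sumr tau_sum mulr_sumr.
  rewrite exchange_big; apply: eq_bigr => h _ /=.
  rewrite [X in _ *m X *m _]symmetrizerE mulmx_sumr mulmx_suml tau_sum.
  by apply: eq_bigr => g _; rewrite -scalemxAr -scalemxAl tauZ !regM !mulmxA.
transitivity (\sum_h sym_coef h * (kappa * tau (e *m reg h))).
  apply: eq_bigr => h _.
  have -> : e *m reg h *m e *m reg h^-1%g = e *m reg h *m row_sum *m (col_alt *m reg h^-1%g).
    by rewrite /symmetrizer !mulmxA.
  rewrite tau_mulC.
  have -> : col_alt *m reg h^-1%g *m (e *m reg h *m row_sum)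
      = (row_sum *m reg h *m col_alt)^T *m (col_alt *m reg h *m row_sum).
    rewrite !trmx_mul row_sum_tr col_alt_tr reg_tr /symmetrizer !mulmxA.
    by [].
  rewrite row_sum_reg_col_alt linearZ /= -scalemxAl tauZ; congr (_ * _).
  rewrite /symmetrizer trmx_mul row_sum_tr col_alt_tr !mulmxA.
  rewrite tau_mulC !mulmxA.
  have -> : row_sum *m col_alt *m row_sum *m col_alt *m reg h = (e *m e) *m reg h.
    by rewrite /symmetrizer !mulmxA.
  by rewrite symmetrizer_idem -scalemxAl tauZ.
under eq_bigr do rewrite mulrCA.
rewrite -mulr_sumr; congr (_ * _).
rewrite /kappa {3}symmetrizerE mulmx_sumr tau_sum; apply: eq_bigr => g _.
by rewrite -scalemxAr tauZ.
Qed.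
End YoungSymmetrizer.

(** * The Jacobi-Trudi class function and its pairing with the Young character *)

Lemma sum_perm_prefix_le (N k : nat) (s : 'S_N) :
  (\sum_(i < N | i < k) s i <= \sum_(i < N | i < k) (N - i.+1))%N.
Proof.
have cnt m : (m <= N)%N -> (m = \sum_(j < N) (j < m))%N.
  move=> mN; rewrite -[LHS]card_ord -[LHS]sum1_card (big_ord_widen N (fun=> 1%N) mN).
  by rewrite big_mkcond; apply: eq_bigr => j _; case: (j < m)%N.
(* Both sides are counted level by level: of the first [k] values of [s], at most
   [minn k (N - j.+1)] exceed [j]. *)
rewrite (eq_bigr (fun i : 'I_N => \sum_(j < N) (j < s i)))%N; last first.
  by move=> i _; apply: cnt; apply: ltnW.
rewrite [X in (_ <= X)%N](eq_bigr (fun i : 'I_N => \sum_(j < N) (j < N - i.+1)))%N; last first.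
  by move=> i _; apply: cnt; apply: leq_subr.
rewrite exchange_big [X in (_ <= X)%N]exchange_big; apply: leq_sum => j _ /=.
have [le|lt] := leqP k (N - j.+1).
  by apply: leq_sum => i ik; case: (j < s i)%N => //; rewrite lt0b; lia.
apply: (@leq_trans (\sum_(i < N) (j < s i))).
  by rewrite big_mkcond; apply: leq_sum => i _; case: (i < k)%N.
rewrite -(reindex_inj (P := predT) (F := fun i : 'I_N => (j < i)%N : nat) (@perm_inj _ s)) /=.
rewrite (reindex_inj rev_ord_inj) /= [X in (_ <= X)%N]big_mkcond; apply: leq_sum => i _.
by rewrite /=; case: (ltnP i k) => ik; lia.
Qed.

(** The signed number of permutations [s] with [l = v + s]: the coefficient of the permutation
    character of content [v] in the Jacobi-Trudi determinant with entries [h_(l i - j)]. *)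
Definition alt_content (F : comNzRingType) (N : nat) (l v : 'I_N -> nat) : F :=
  \det (\matrix_(i < N, j < N) (l i == (v i + j)%N)%:R).

Lemma eq_alt_content (F : comNzRingType) N (l v w : 'I_N -> nat) :
  v =1 w -> alt_content F l v = alt_content F l w.
Proof. by move=> vw; congr (\det _); apply/matrixP => i j; rewrite !mxE vw. Qed.

Lemma alt_contentE (F : comNzRingType) N (l v : 'I_N -> nat) :
  alt_content F l v =
  \sum_(s : 'S_N) (-1) ^+ odd_perm s * [forall i, l i == (v i + s i)%N]%:R.
Proof.
apply: eq_bigr => s _; congr (_ * _); under eq_bigr do rewrite mxE.
case: forallP => [H|H]; first by rewrite big1 // => i _; rewrite H.
have /existsP[i iP] : [exists i, l i != (v i + s i)%N].
  by rewrite -negb_forall; apply/negP => /forallP.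
by rewrite (bigD1 i) //= (negbTE iP) mul0r.
Qed.

Definition content (T : finType) (n : nat) (c : {ffun 'I_n -> T}) (t : T) : nat :=
  #|[pred x | c x == t]|.

(** The colourings of content [v] fixed by [g] are counted by the permutation character of the Young
    subgroup of type [v]; weighting them by [alt_content] forms the Jacobi-Trudi determinant of
    characters. *)
Definition theta (F : comNzRingType) (n N : nat) (l : 'I_N -> nat) (g : 'S_n) : F :=
  \sum_(c : {ffun 'I_n -> 'I_N} | [forall x, c (g x) == c x]) alt_content F l (content c).

Section ThetaYoung.
Variables (F : numFieldType) (n : nat) (row col : 'I_n -> nat).
Hypothesis cell_inj : forall x y, row x = row y -> col x = col y -> x = y.
Hypothesis young : forall x i, (i <= row x)%N -> exists2 y, row y = i & col y = col x.
Variables (N : nat) (l : 'I_N -> nat).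
Hypothesis row_lt : forall x, (row x < N)%N.
Hypothesis l_def : forall i : 'I_N, l i = (#|[pred x | row x == i]| + (N - i.+1))%N.
Let G : {group 'S_n} := [set: 'S_n]%G.
Local Notation reg := (@reg F n).
Local Notation tau := (@tau F n).
Local Notation rowS := (level_stab_group row).
Local Notation colS := (level_stab_group col).
Local Notation colalt := (col_alt F col).

Lemma thetaJ (g k : 'S_n) : theta F l (k * g * k^-1)%g = theta F l g.
Proof.
have kK : cancel (fun c : {ffun 'I_n -> 'I_N} => [ffun x => c (k x)])
                 (fun c => [ffun x => c ((k^-1)%g x)]).
  by move=> c; apply/ffunP => x; rewrite !ffunE permKV.
rewrite /theta [LHS](reindex_inj (can_inj kK)); apply: eq_big => [c|c _].
  apply/forallP/forallP => H x; apply/eqP.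
    by have /eqP := H ((k^-1)%g x); rewrite !ffunE !permM !permKV.
  by have /eqP := H (k x); rewrite !ffunE !permM permKV.
apply: eq_alt_content => i; rewrite /content.
rewrite -(card_imset _ (@perm_inj _ k)) -[RHS](card_imset _ (@perm_inj _ 1%g)).
apply: eq_card => y; apply/imsetP/imsetP => [[x + ->]|[x + ->]]; rewrite !inE.
  by rewrite ffunE => cx; exists (k x); rewrite ?inE ?perm1.
by move=> cx; exists ((k^-1)%g x); rewrite ?permKV ?perm1 // inE ffunE permKV.
Qed.

(** The row lengths differ from the beads by [N - i.+1], so only the reversal contributes and the
    value is its sign. *)
Definition alt_sign : F := alt_content F l (fun i : 'I_N => #|[pred x | row x == i]|).

Lemma alt_sign_sqr : alt_sign ^+ 2 = 1.
Proof.
have -> : alt_sign = (-1) ^+ odd_perm (perm (@rev_ord_inj N)).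
  rewrite -det_perm /alt_sign /alt_content; congr (\det _); apply/matrixP => i j.
  by rewrite !mxE l_def eqn_add2l permE -val_eqE.
by rewrite sqrr_sign.
Qed.

(** A nonzero coefficient gives [content c = l - s] for a permutation [s], and the prefix sums of
    [s] are at most those of the reversal, which corresponds to the row lengths themselves. *)
Lemma alt_content_dominates (c : {ffun 'I_n -> 'I_N}) k :
  alt_content F l (content c) != 0 ->
  (#|[pred x | (row x < k)%N]| <= #|[pred x | (c x < k)%N]|)%N.
Proof.
rewrite alt_contentE => nz.
have [s /forallP sP] : exists s : 'S_N, [forall i, l i == (content c i + s i)%N].
  apply/existsP; apply: contraNT nz => /existsPn H.
  by rewrite big1 // => s _; rewrite (negbTE (H s)) mulr0.
have cnt (d : 'I_n -> 'I_N) :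
    #|[pred x | (d x < k)%N]| = (\sum_(i < N | i < k) #|[pred x | d x == i]|)%N.
  rewrite -sum1_card (partition_big d (fun i => i < k)%N) //=.
  apply: eq_bigr => i ik; rewrite -[RHS]sum1_card; apply: eq_bigl => x; rewrite !inE.
  by case: eqP => [->|_]; rewrite ?ik ?andbF.
rewrite -(leq_add2r (\sum_(i < N | i < k) (N - i.+1))%N) cnt.
rewrite [X in (X + _ <= _)%N](cnt (fun x => Ordinal (row_lt x))).
apply: leq_trans (leq_add (leqnn _) (sum_perm_prefix_le k s)).
rewrite -!big_split; apply: eq_leq; apply: eq_bigr => i _ /=.
have /eqP <- := sP i; rewrite l_def; congr (_ + _)%N; apply: eq_card => x.
Qed.

Definition transported_row (t : 'S_n) : {ffun 'I_n -> 'I_N} :=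
  [ffun x => Ordinal (row_lt (t x))].

Lemma tau_sum_transported_row t : t \in colS ->
  tau (symmetrizer F row col *m row_sum F (fun x => transported_row t x))
  = tau (row_sum F row *m colalt *m row_sum F row *m ((-1) ^+ odd_perm t *: reg t^-1%g)).
Proof.
move=> tC.
have -> : row_sum F (fun x => transported_row t x) = reg t *m row_sum F row *m reg t^-1%g.
  rewrite mulmx_sumr mulmx_suml.
  have conj_inj : injective (fun p : 'S_n => t * p * t^-1)%g by move=> p q /mulIg/mulgI.
  rewrite /row_sum (reindex_inj conj_inj); apply: eq_big => [p|p _]; last by rewrite !regM.
  apply/level_stabP/level_stabP => H x.
    by have := H ((t^-1)%g x); rewrite !ffunE /= !permM !permKV.
  by rewrite !ffunE /= !permM permKV H.
by rewrite /symmetrizer -scalemxAr !mulmxA -[_ *m colalt *m reg t]mulmxA col_altMr //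
  -!scalemxAr -!scalemxAl.
Qed.

Lemma tau_clash (c : {ffun 'I_n -> 'I_N}) x y :
  x != y -> col x = col y -> c x = c y ->
  tau (symmetrizer F row col *m row_sum F (fun x => c x)) = 0.
Proof.
move=> xy cxy rxy.
suff z0 : colalt *m row_sum F (fun x => c x) = 0.
  by rewrite -mulmxA z0 mulmx0 tau0.
apply: eq_opp0; rewrite -[X in X = _](_ : colalt *m (reg (tperm x y) *m row_sum F (fun x => c x)) = _).
  by rewrite mulmxA col_altMr ?tperm_colS // odd_tperm xy expr1 scaleN1r mulNmx.
by rewrite row_sumMl // tperm_rowS // rxy.
Qed.

(** Each colouring pairs the symmetrizer with the sum over its stabilizer. A colour repeated in a
    column gives 0. The remaining colourings with nonzero coefficient dominate the diagram, hence
    are the row colouring moved by a column permutation [t], and their signed contributions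
    reassemble [tau (e e) = kappa]. *)
Lemma sum_theta_young_char :
  \sum_g theta F l g * young_char F row col g = alt_sign * #|G|%:R.
Proof.
rewrite (sum_class_fun_young_char _ _ thetaJ).
suff -> : \sum_g theta F l g * sym_coef F row col g^-1%g = alt_sign * kappa F row col.
  by rewrite mulrCA [_ * kappa _ _ _]mulrAC mulVf ?mul1r // kappa_neq0.
transitivity (\sum_(c : {ffun 'I_n -> 'I_N}) alt_content F l (content c)
   * tau (symmetrizer F row col *m row_sum F (fun x => c x))).
  under eq_bigr do rewrite /theta mulr_suml.
  rewrite (exchange_big_dep predT) //=; apply: eq_bigr => c _.
  rewrite mulmx_sumr tau_sum mulr_sumr; apply: eq_big => [g|g _].
    by rewrite inE.
  by rewrite tau_symmetrizer_reg.
have tinj : {in colS &, injective transported_row}.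
  move=> s t sC tC /ffunP E; apply/permP => x; apply: cell_inj.
    by have := E x; rewrite !ffunE => /(congr1 val).
  by rewrite (level_stabP _ _ sC) (level_stabP _ _ tC).
rewrite (bigID (mem [set transported_row t | t in colS])) /= [X in _ + X]big1 ?addr0; last first.
  move=> c cN; have [->|nz] := eqVneq (alt_content F l (content c)) 0; first by rewrite mul0r.
  case: (pickP [pred ab : 'I_n * 'I_n | [&& ab.1 != ab.2, col ab.1 == col ab.2
      & c ab.1 == c ab.2]]) => [[a b] /and3P[/= ab /eqP cab /eqP rab]|inj].
    by rewrite (tau_clash ab) ?mulr0.
  have [|k|t tP] := @column_injective_coloring n row col cell_inj young (fun x => c x).
  - move=> x y cxy rxy; apply/eqP; apply/negPn/negP => xy; have := inj (x, y).
    by rewrite /= xy cxy (val_inj rxy) !eqxx.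
  - exact: alt_content_dominates.
  case/negP: cN; apply/imsetP; exists t; first by apply/level_stabP => x; case: (tP x).
  by apply/ffunP => x; rewrite ffunE; apply/val_inj; rewrite /= (tP x).2.
rewrite big_imset //= /kappa {2}/symmetrizer.
transitivity (\sum_(t in colS) alt_sign * tau (row_sum F row *m colalt *m row_sum F row
    *m ((-1) ^+ odd_perm t *: reg t^-1%g))).
  apply: eq_bigr => t tC; rewrite tau_sum_transported_row //; congr (_ * _).
  apply: eq_alt_content => i; rewrite /content.
  rewrite -(card_imset _ (@perm_inj _ t)) ; apply: eq_card => y.
  rewrite inE; apply/imsetP/eqP => [[x + ->]|yi]; first by rewrite !inE ffunE => /eqP <-.
  exists ((t^-1)%g y); rewrite ?permKV // inE ffunE; apply/eqP/val_inj.
  by rewrite /= permKV.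
rewrite -mulr_sumr -tau_sum -mulmx_sumr; congr (_ * tau _).
rewrite mulmxA -/(symmetrizer F row col); congr (_ *m _).
rewrite -col_alt_tr /col_alt linear_sum; apply: eq_bigr => t _ /=.
by rewrite linearZ /= reg_tr.
Qed.

End ThetaYoung.

(** * The Jacobi-Trudi identity and the norm of [theta] *)

Lemma digits_inj (N K : nat) (a b : 'I_N -> nat) :
  (forall i, a i < K)%N -> (forall i, b i < K)%N ->
  (\sum_i a i * K ^ i = \sum_i b i * K ^ i)%N -> a =1 b.
Proof.
elim: N a b => [|N IH] a b aK bK; first by move=> _ [].
have shift (c : 'I_N.+1 -> nat) :
    (\sum_i c i * K ^ i = (\sum_(i < N) c (lift ord0 i) * K ^ i) * K + c ord0)%N.
  rewrite big_ord_recl expn0 muln1 addnC big_distrl /=; congr (_ + _)%N.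
  by apply: eq_bigr => i _; rewrite /bump /= add1n expnSr mulnA.
rewrite !shift => E.
have E0 : a ord0 = b ord0.
  by have := congr1 (modn^~ K) E; rewrite /= !modnMDl !modn_small.
have EN : (fun i => a (lift ord0 i)) =1 (fun i => b (lift ord0 i)).
  apply: IH => // [].
  have K0 : (0 < K)%N by apply: leq_ltn_trans (aK ord0).
  by move/eqP: E; rewrite E0 eqn_add2r eqn_pmul2r // => /eqP.
by move=> i; case: (unliftP ord0 i) => [j ->|->].
Qed.

Section JacobiTrudi.
Variables (A : comNzRingType) (N B : nat) (x : 'I_N -> A).

(** A geometric series truncated to stay polynomial; the complete symmetric functions of degree
    below [B] are not affected. *)
Definition geo (i : 'I_N) : {poly A} := \sum_(r < B) (x i *: 'X) ^+ r.
Definition complete_gf : {poly A} := \prod_i geo i.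
Definition elementary_gf (k : 'I_N) : {poly A} := \prod_(i | i != k) (1 - x i *: 'X).

Lemma geo_mul i : (1 - x i *: 'X) * geo i = 1 - 'X^B * (x i ^+ B)%:P.
Proof.
apply: oppr_inj; rewrite -mulNr !opprB -subrX1 exprZn.
by rewrite -mul_polyC mulrC.
Qed.

Lemma coef_geo i l : (l < B)%N -> (geo i)`_l = x i ^+ l.
Proof.
move=> lB; rewrite coef_sum (bigD1 (Ordinal lB)) //= exprZn coefZ coefXn eqxx mulr1.
rewrite big1 ?addr0 // => j /eqP jl; rewrite exprZn coefZ coefXn.
by case: eqP => [E|_]; [case: jl; apply/val_inj | rewrite mulr0].
Qed.

(** Modulo ['X^B] the factors cancel in pairs and leave the series of [1 / (1 - x k X)]. *)
Lemma coef_elementary_complete k l :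
  (l < B)%N -> (elementary_gf k * complete_gf)`_l = x k ^+ l.
Proof.
move=> lB; rewrite /complete_gf (bigD1 k) //= mulrCA -big_split /=.
have [Q ->] : exists Q, \prod_(i < N | i != k) ((1 - x i *: 'X) * geo i) = 1 + 'X^B * Q.
  apply: (big_ind (fun p => exists Q, p = 1 + 'X^B * Q)) => [|p q [P ->] [Q ->]|i _].
  - by exists 0; rewrite mulr0 addr0.
  - exists (P + Q + 'X^B * P * Q); ring.
  - by exists (- (x i ^+ B)%:P); rewrite geo_mul mulrN.
rewrite mulrDr mulr1 coefD coef_geo // mulrCA coefXnM lB addr0 //.
Qed.

Lemma size_elementary_gf k : (size (elementary_gf k) <= N)%N.
Proof.
apply: leq_trans (size_poly_prod_leq _ _) _.
have cE : #|[pred i | i != k]| = N.-1 by rewrite (cardC1 k) card_ord.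
have N0 : (0 < N)%N by apply: leq_ltn_trans (ltn_ord k).
have : (\sum_(i | i != k) size (1 - x i *: 'X : {poly A})%R <= \sum_(i | i != k) 2)%N.
  apply: leq_sum => i _; rewrite (leq_trans (size_polyD _ _)) // geq_max size_poly1 size_polyN.
  by rewrite (leq_trans (size_scale_leq _ _)) // size_polyX.
by rewrite sum_nat_const cE; lia.
Qed.

Definition complete_mx (l : 'I_N -> nat) : 'M[A]_N :=
  \matrix_(i, j) (if (j <= l i)%N then complete_gf`_(l i - j) else 0).

(** The alternant is [complete_mx l] times a matrix [Em] of elementary coefficients that does not
    depend on [l]. For [l i = i] the first factor is unitriangular, so [Em] has the Vandermonde
    determinant. *)
Lemma det_complete_mx (l : 'I_N -> nat) : (N <= B)%N -> (forall i, l i < B)%N ->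
  \det (\matrix_(i < N, k < N) x k ^+ l i) =
  \det (complete_mx l) * \det (\matrix_(i < N, k < N) x k ^+ i).
Proof.
move=> NB lB; pose Em := \matrix_(j < N, k < N) (elementary_gf k)`_j.
have fact (m : 'I_N -> nat) : (forall i, m i < B)%N ->
    \matrix_(i < N, k < N) x k ^+ m i = complete_mx m *m Em.
  move=> mB; apply/matrixP => i k; rewrite !mxE -coef_elementary_complete // coefM.
  pose t j := if (j <= m i)%N then complete_gf`_(m i - j) * (elementary_gf k)`_j else 0.
  transitivity (\sum_(j < N + (m i).+1) t j).
    rewrite (big_ord_widen (N + (m i).+1) (fun j => (elementary_gf k)`_j * complete_gf`_(m i - j)));
      last exact: leq_addl.
    rewrite big_mkcond; apply: eq_bigr => j _; rewrite /t ltnS mulrC.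
    by case: leqP.
  transitivity (\sum_(j < N) t j).
    rewrite [RHS](big_ord_widen (N + (m i).+1) t (leq_addr _ _)) [RHS]big_mkcond.
    apply: eq_bigr => j _; case: ltnP => // Nj; rewrite /t; case: leqP => // _.
    by rewrite [X in _ * X]nth_default ?mulr0 // (leq_trans (size_elementary_gf k)).
  by apply: eq_bigr => j _; rewrite !mxE /t; case: leqP; rewrite ?mul0r.
rewrite fact // det_mulmx; congr (_ * _).
rewrite (fact (fun i => i)) => [|i]; last exact: leq_trans NB.
rewrite det_mulmx -[LHS]mul1r; congr (_ * _).
rewrite det_trig; last first.
  by apply/is_trig_mxP => i j ij; rewrite mxE leqNgt ij.
rewrite big1 // => i _; rewrite mxE leqnn subnn.
rewrite /complete_gf -horner_coef0 horner_prod big1 // => j _.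
rewrite horner_coef0 coef_geo ?expr0 //; apply: leq_trans NB; exact: leq_ltn_trans (ltn_ord i).
Qed.

Lemma coef_complete_gf r :
  complete_gf`_r =
  \sum_(v : {ffun 'I_N -> 'I_B}) \prod_i x i ^+ v i * (r == \sum_i v i)%N%:R.
Proof.
rewrite /complete_gf /geo bigA_distr_bigA /= coef_sum; apply: eq_bigr => v _.
under eq_bigr do rewrite exprZn.
rewrite scaler_prod /= coefZ; congr (_ * _).
have -> : \prod_(i < N) 'X ^+ v i = 'X^(\sum_i v i) :> {poly A} by rewrite prodrXr.
by rewrite coefXn.
Qed.

Lemma det_complete_mxE (l : 'I_N -> nat) :
  \det (complete_mx l) = \sum_(M : {ffun 'I_N -> {ffun 'I_N -> 'I_B}})
     alt_content A l (fun j => \sum_i M j i)%N * \prod_i x i ^+ (\sum_j M j i)%N.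
Proof.
under [RHS]eq_bigr do rewrite alt_contentE mulr_suml.
rewrite exchange_big; apply: eq_bigr => s _ /=.
under [RHS]eq_bigr do rewrite -mulrA.
rewrite -mulr_sumr; congr (_ * _).
transitivity (\prod_j \sum_(v : {ffun 'I_N -> 'I_B})
    (l j == (\sum_i v i + s j)%N)%:R * \prod_i x i ^+ v i).
  apply: eq_bigr => j _; rewrite mxE; case: leqP => sj.
    rewrite coef_complete_gf; apply: eq_bigr => v _; rewrite mulrC; congr (_%:R * _).
    by congr nat_of_bool; apply/eqP/eqP => [<-|->]; rewrite ?subnK ?addnK.
  rewrite big1 // => v _; case: eqP => [E|_]; last by rewrite mul0r.
  by move: sj; rewrite E ltnNge leq_addl.
rewrite bigA_distr_bigA /=; apply: eq_bigr => M _; rewrite big_split /=; congr (_ * _).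
  case: forallP => [H|H]; first by rewrite big1 // => i _; rewrite H.
  have /existsP[i iP] : [exists i, l i != (\sum_(i0 < N) M i i0 + s i)%N].
    by rewrite -negb_forall; apply/negP => /forallP.
  by rewrite (bigD1 i) //= (negbTE iP) mul0r.
rewrite exchange_big; apply: eq_bigr => i _ /=.
by rewrite prodrXr.
Qed.
End JacobiTrudi.

(* Kronecker substitution ['X^(K ^ k)] for the k-th variable turns coefficient
   extraction in N variables into coefficient extraction in one. *)
Lemma sum_alt_content_mx (F : comNzRingType) (N B : nat) (l : 'I_N -> nat) :
  injective l -> (N <= B)%N -> (forall i, l i < B)%N ->
  \sum_(M : {ffun 'I_N -> {ffun 'I_N -> 'I_B}})
    alt_content F l (fun j => \sum_i M j i)%N * alt_content F l (fun i => \sum_j M j i)%N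
  = 1.
Proof.
(* [K] exceeds every exponent compared below: [l i < B], and [v i + s i] is at most [N * B + N]. *)
move=> l_inj NB lB; pose K := (N * B + N + B).+1.
pose x (k : 'I_N) : {poly F} := 'X^(K ^ k).
have lK i : (l i < K)%N by rewrite ltnS (leq_trans (ltnW (lB i))) // leq_addl.
have xE (v : 'I_N -> nat) : \prod_i x i ^+ v i = 'X^(\sum_i v i * K ^ i).
  by rewrite -prodrXr; apply: eq_bigr => i _; rewrite /x -exprM mulnC.
have := det_complete_mx x NB lB; rewrite det_complete_mxE => /(congr1 (fun p : {poly F} => p`_(\sum_i l i * K ^ i))).
(* As the [l i] are distinct, only the identity permutation produces the monomial of exponents [l].
   On the other side the Vandermonde factor supplies the second [alt_content]. *)
have -> : (\det (\matrix_(i < N, k < N) x k ^+ l i))`_(\sum_i l i * K ^ i) = 1.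
  have term (s : 'S_N) : \prod_i (\matrix_(i < N, k < N) x k ^+ l i) i (s i)
      = 'X^(\sum_i l ((s^-1)%g i) * K ^ i).
    rewrite -xE (reindex_inj (@perm_inj _ s^-1%g)) /=.
    by apply: eq_bigr => i _; rewrite mxE permKV.
  rewrite coef_sum (bigD1 1%g) //= -[RHS]addr0; congr (_ + _).
    rewrite term odd_perm1 mul1r coefXn; case: eqP => // E; case: E.
    by apply: eq_bigr => i _; rewrite invg1 perm1.
  rewrite big1 // => s s1.
  rewrite term -(rmorph_sign polyC) coefCM coefXn; case: eqP => [E|_]; last by rewrite mulr0.
  case/eqP: s1; apply/permP => i; rewrite perm1.
  have /(_ (s i)) := digits_inj (fun i => lK i) (fun i => lK ((s^-1)%g i)) E.
  by rewrite permK => /l_inj.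
move=> E; rewrite [RHS]E mulr_suml coef_sum {E}; apply: eq_bigr => M _.
set v := fun i => (\sum_j M j i)%N.
have vK (s : 'S_N) i : (v i + s i < K)%N.
  rewrite ltnS; apply: leq_trans (leq_addr _ _); apply: leq_add; last exact: ltnW.
  apply: (@leq_trans (\sum_(j < N) B)); last by rewrite sum_nat_const card_ord.
  by apply: leq_sum => j _; apply: ltnW.
have -> : alt_content {poly F} l (fun j => (\sum_i M j i)%N)
    = (alt_content F l (fun j => (\sum_i M j i)%N))%:P.
  rewrite /alt_content -det_map_mx; congr (\det _); apply/matrixP => i j.
  by rewrite !mxE rmorph_nat.
rewrite -mulrA coefCM; congr (_ * _).
rewrite alt_contentE -det_tr mulr_sumr coef_sum; apply: eq_bigr => s _.
have -> : \prod_i x i ^+ v i * ((-1) ^+ odd_perm s * \prod_i (\matrix_(i < N, k < N) x k ^+ i)^T i (s i))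
    = (-1) ^+ odd_perm s * \prod_i x i ^+ (v i + s i).
  by rewrite mulrCA -big_split; congr (_ * _); apply: eq_bigr => i _ /=; rewrite !mxE exprD.
rewrite (xE (fun i => v i + s i)%N) -(rmorph_sign polyC) coefCM coefXn; congr (_ * _%:R).
congr nat_of_bool; apply/forallP/eqP => [H|E i].
  by apply: eq_bigr => i _; rewrite (eqP (H i)).
by apply/eqP; apply: (digits_inj lK (vK s) E).
Qed.

Lemma content_surj (T : finType) (n : nat) (w : T -> nat) :
  (\sum_t w t = n)%N -> exists c : {ffun 'I_n -> T}, content c =1 w.
Proof.
move=> wn; pose s := flatten [seq nseq (w t) t | t <- enum T].
have cs t : count_mem t s = w t.
  rewrite count_flatten -map_comp sumnE big_map big_enum /= (bigD1 t) //=.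
  rewrite count_nseq /= eqxx mul1n big1 ?addn0 // => u ut.
  by rewrite count_nseq /= (negbTE ut).
have ss : size s == n.
  rewrite size_flatten sumnE /shape -map_comp big_map big_enum /=.
  by rewrite -wn; apply/eqP; apply: eq_bigr => t _; rewrite size_nseq.
exists [ffun i => tnth (Tuple ss) i] => t; rewrite -cs /content.
have /(congr1 (count_mem t)) := map_tnth_enum (Tuple ss); rewrite /= => <-.
rewrite count_map cardE size_filter.
by rewrite -enumT; apply: eq_count => i; rewrite !inE ffunE.
Qed.

(* Functions ['I_n -> T] up to ['S_n] are multiplicity functions on [T]. *)
Lemma sum_stab_content (F : comNzRingType) (T : finType) (n B : nat)
    (Psi : {ffun T -> 'I_B.+1} -> F) :
  (n <= B)%N ->
  \sum_(g : 'S_n) \sum_(c : {ffun 'I_n -> T} | [forall x, c (g x) == c x])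
     Psi [ffun t => inord (content c t)]
  = n`!%:R * \sum_(w : {ffun T -> 'I_B.+1} | (\sum_t w t)%N == n) Psi w.
Proof.
move=> nB; pose ct (c : {ffun 'I_n -> T}) : {ffun T -> 'I_B.+1} := [ffun t => inord (content c t)].
have ctE c t : ct c t = content c t :> nat.
  rewrite ffunE inordK // ltnS (leq_trans _ nB) // -[X in (_ <= X)%N]card_ord.
  exact: max_card.
have ct_sum c : (\sum_t ct c t)%N = n.
  under eq_bigr do rewrite ctE.
  rewrite -[RHS]card_ord -[RHS]sum1_card (partition_big c predT) //=.
  by apply: eq_bigr => t _; rewrite -[LHS]sum1_card; apply: eq_bigl => x; rewrite !inE.
rewrite (exchange_big_dep predT) //= mulr_sumr.
rewrite (partition_big ct (fun w => (\sum_t w t)%N == n)) /=; last by move=> c _; rewrite ct_sum.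
apply: eq_bigr => w /eqP wn; have [c0 c0w] := content_surj wn.
have c0E : ct c0 = w by apply/ffunP => t; apply/val_inj; rewrite /= ctE c0w.
have trans c : ct c = w -> exists g : 'S_n, forall x, c x = c0 (g x).
  move=> cw; apply: same_fibers_perm => t.
  by rewrite -[LHS]/(content c t) -[RHS]/(content c0 t) -!ctE cw c0E.
(* The stabilizer of [c] is a translate of the set of [g] carrying [c0] to [c]; with the sums
   exchanged, each [g] belongs to exactly one [c]. *)
transitivity (\sum_(c | ct c == w) \sum_(g : 'S_n | [forall x, c0 (g x) == c x]) Psi w).
  apply: eq_bigr => c /eqP cw; have [g gE] := trans c cw.
  rewrite [RHS](reindex_inj (mulIg g)) /= -/(ct c) cw; apply: eq_bigl => h.
  by apply: eq_forallb => x; rewrite permM -gE.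
rewrite (exchange_big_dep predT) //=.
rewrite (eq_bigr (fun=> Psi w)) => [|g _].
  by rewrite sumr_const mulr_natl -card_Sn.
rewrite (bigD1 [ffun x => c0 (g x)]) /=; last first.
  apply/andP; split; last by apply/forallP => x; rewrite ffunE.
  apply/eqP; rewrite -c0E; apply/ffunP => t; apply/val_inj; rewrite /= !ctE /content.
  rewrite -(card_imset _ (@perm_inj _ g)); apply: eq_card => y; rewrite inE.
  apply/imsetP/eqP => [[z + ->]|yt]; first by rewrite inE ffunE => /eqP.
  by exists ((g^-1)%g y); rewrite ?permKV // inE ffunE permKV yt.
rewrite big1 ?addr0 // => c /andP[/andP[_ /forallP H] /eqP ne].
by case: ne; apply/ffunP => x; rewrite ffunE (eqP (H x)).
Qed.

Lemma alt_content_neq0 (F : comNzRingType) N (l v : 'I_N -> nat) :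
  alt_content F l v != 0 -> exists s : 'S_N, forall i, l i = (v i + s i)%N.
Proof.
rewrite alt_contentE => nz.
have [s /forallP sP] : exists s : 'S_N, [forall i, l i == (v i + s i)%N].
  apply/existsP; apply: contraNT nz => /existsPn H.
  by rewrite big1 // => s _; rewrite (negbTE (H s)) mulr0.
by exists s => i; apply/eqP.
Qed.

Lemma alt_content_sum (F : comNzRingType) N (l v : 'I_N -> nat) :
  alt_content F l v != 0 -> (\sum_i l i = \sum_i v i + \sum_(i < N) i)%N.
Proof.
move=> /alt_content_neq0[s sP]; rewrite [X in (_ + X)%N](reindex_inj (@perm_inj _ s)).
by rewrite -big_split; apply: eq_bigr.
Qed.

Lemma content_le (T : finType) n (c : {ffun 'I_n -> T}) t : (content c t <= n)%N.
Proof. by rewrite -[X in (_ <= X)%N]card_ord; apply: max_card. Qed.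

(** Two colourings fixed by [g] are one fixed colouring by pairs. Up to ['S_n] such colourings are
    matrices of multiplicities whose margins are the two contents, and the sum over matrices is
    [sum_alt_content_mx]. *)
Lemma sum_theta_sqr (F : comNzRingType) (n N : nat) (l : 'I_N -> nat) :
  injective l -> (\sum_i l i = n + \sum_(i < N) i)%N ->
  \sum_(g : 'S_n) theta F l g ^+ 2 = n`!%:R.
Proof.
move=> l_inj ln; pose B := (n + N + \max_i l i)%N.
pose Psi (w : {ffun 'I_N * 'I_N -> 'I_B.+1}) :=
  alt_content F l (fun j => \sum_i w (i, j))%N * alt_content F l (fun i => \sum_j w (i, j))%N.
transitivity (\sum_(g : 'S_n) \sum_(c : {ffun 'I_n -> 'I_N * 'I_N} | [forall x, c (g x) == c x])
     Psi [ffun t => inord (content c t)]).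
  apply: eq_bigr => g _; rewrite expr2 mulr_suml.
  under eq_bigr do rewrite mulr_sumr.
  rewrite pair_big /=.
  pose split (z : {ffun 'I_n -> 'I_N * 'I_N}) : {ffun 'I_n -> 'I_N} * {ffun 'I_n -> 'I_N} :=
    ([ffun x => (z x).2], [ffun x => (z x).1]).
  pose join (cd : {ffun 'I_n -> 'I_N} * {ffun 'I_n -> 'I_N}) : {ffun 'I_n -> 'I_N * 'I_N} :=
    [ffun x => (cd.2 x, cd.1 x)].
  rewrite (reindex split) /=; last first.
    exists join => [z _|[c d] _].
      by apply/ffunP => x; rewrite !ffunE /=; case: (z x).
    by congr (_, _); apply/ffunP => x; rewrite !ffunE.
  apply: eq_big => [z|z _].
    apply/andP/forallP => [[/forallP H1 /forallP H2] x|H].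
      by move: (H1 x) (H2 x); rewrite !ffunE -pair_eqE /= /pair_eq => -> ->.
    by split; apply/forallP => x; rewrite !ffunE (eqP (H x)).
  have cE t : ([ffun t => inord (content z t)] : {ffun _ -> 'I_B.+1}) t = content z t :> nat.
    rewrite ffunE inordK // ltnS; apply: leq_trans (content_le _ _) _.
    by rewrite /B -addnA leq_addr.
  congr (_ * _); apply: eq_alt_content => i; under [RHS]eq_bigr do rewrite cE.
    rewrite /content -sum1_card (partition_big (fun x => (z x).1) predT) //=.
    apply: eq_bigr => j _; rewrite -[RHS]sum1_card; apply: eq_bigl => x.
    by rewrite !inE ffunE -pair_eqE /= /pair_eq andbC.
  rewrite /content -sum1_card (partition_big (fun x => (z x).2) predT) //=.
  apply: eq_bigr => j _; rewrite -[RHS]sum1_card; apply: eq_bigl => x.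
  by rewrite !inE ffunE -pair_eqE /= /pair_eq.
rewrite sum_stab_content; last by rewrite /B -addnA leq_addr.
rewrite -[RHS]mulr1; congr (_ * _).
have NB : (N <= B.+1)%N by rewrite /B; lia.
have lB i : (l i < B.+1)%N by rewrite ltnS (leq_trans (leq_bigmax i)) // leq_addl.
rewrite -(sum_alt_content_mx F l_inj NB lB).
rewrite big_mkcond /=.
pose curry (w : {ffun 'I_N * 'I_N -> 'I_B.+1}) : {ffun 'I_N -> {ffun 'I_N -> 'I_B.+1}} :=
  [ffun j => [ffun i => w (i, j)]].
pose uncurry (M : {ffun 'I_N -> {ffun 'I_N -> 'I_B.+1}}) : {ffun 'I_N * 'I_N -> 'I_B.+1} :=
  [ffun ij => M ij.2 ij.1].
rewrite [RHS](reindex curry) /=; last first.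
  exists uncurry => [w _|M _].
    by apply/ffunP => -[i j]; rewrite !ffunE.
  by apply/ffunP => j; apply/ffunP => i; rewrite !ffunE.
apply: eq_bigr => w _.
have -> : alt_content F l (fun j => \sum_i curry w j i)%N
    * alt_content F l (fun i => \sum_j curry w j i)%N = Psi w.
  by congr (_ * _); apply: eq_alt_content => i; apply: eq_bigr => j _; rewrite !ffunE.
(* [sum_alt_content_mx] puts no condition on the total of the matrix, but a nonzero [alt_content]
   forces it to be [n]. *)
case: eqP => // wn; rewrite /Psi.
have [->|/alt_content_sum] := eqVneq (alt_content F l (fun i => \sum_j w (i, j))%N) 0.
  by rewrite mulr0.
rewrite ln => /eqP; rewrite eqn_add2r => /eqP E; case: wn; rewrite E pair_big /=.
by apply: eq_bigr => -[i j].
Qed.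

(** * Identification of Specht characters with [theta] *)

Section YoungCharTheta.
Variables (F : realFieldType) (n : nat) (row col : 'I_n -> nat).
Hypothesis cell_inj : forall x y, row x = row y -> col x = col y -> x = y.
Hypothesis young : forall x i, (i <= row x)%N -> exists2 y, row y = i & col y = col x.
Variables (N : nat) (l : 'I_N -> nat).
Hypothesis row_lt : forall x, (row x < N)%N.
Hypothesis l_def : forall i : 'I_N, l i = (#|[pred x | row x == i]| + (N - i.+1))%N.

Lemma row_card_decr i j : (i <= j)%N -> (#|[pred x | row x == j]| <= #|[pred x | row x == i]|)%N.
Proof.
move=> ij; have H x : exists y, (row x == j) ==> ((row y == i) && (col y == col x)).
  case: eqP => [xj|_]; last by exists x.
  have [|y yi yx] := @young x i; first by rewrite xj.
  by exists y; rewrite yi yx !eqxx.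
pose f x := xchoose (H x).
have fP x : row x = j -> row (f x) = i /\ col (f x) = col x.
  by move=> xj; have /implyP := xchooseP (H x); case/(_ (introT eqP xj))/andP => /eqP ? /eqP.
rewrite -(card_in_image (f := f)) => [|x y /eqP xj /eqP yj fxy].
  by apply/subset_leq_card/subsetP => _ /imageP[x /eqP xj ->]; rewrite inE (fP x xj).1.
by apply: cell_inj; rewrite ?xj // -(fP x xj).2 fxy (fP y yj).2.
Qed.

Lemma beads_inj : injective l.
Proof.
have H (i j : 'I_N) : (i < j)%N -> (l j < l i)%N.
  move=> ij; rewrite !l_def; have := row_card_decr (ltnW ij); have := ltn_ord j; lia.
by move=> i j E; apply/val_inj; case: (ltngtP i j) => // /H; rewrite E ltnn.
Qed.

Lemma sum_beads : (\sum_i l i = n + \sum_(i < N) i)%N.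
Proof.
under eq_bigr do rewrite l_def.
rewrite big_split /=; congr (_ + _)%N; last by rewrite [RHS](reindex_inj rev_ord_inj).
rewrite -[RHS]card_ord -[RHS]sum1_card (partition_big (fun x => Ordinal (row_lt x)) predT) //=.
by apply: eq_bigr => i _; rewrite -[LHS]sum1_card; apply: eq_bigl => x; rewrite !inE -val_eqE.
Qed.

(** The squares of [young_char - s * theta] sum to [n! + n! - 2 * n! * s ^+ 2 = 0], so each of them
    vanishes over an ordered field. *)
Lemma young_char_theta : exists2 s : F, s ^+ 2 = 1 &
  forall g, young_char F row col g = s * theta F l g.
Proof.
exists (alt_sign F row l); first exact: alt_sign_sqr.
set s := alt_sign F row l; have ss : s ^+ 2 = 1 by apply: alt_sign_sqr.
have nG : #|[set: 'S_n]%G|%:R = n`!%:R :> F by rewrite -card_Sn cardsT.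
have := @sum_theta_young_char F n row col cell_inj young N l row_lt l_def.
have := sum_young_char_sqr F cell_inj young; rewrite nG -/s => cc tc.
have tt := sum_theta_sqr F beads_inj sum_beads.
have : \sum_(g : 'S_n) (young_char F row col g - s * theta F l g) ^+ 2 = 0.
  transitivity (\sum_(g : 'S_n) young_char F row col g ^+ 2 + \sum_(g : 'S_n) theta F l g ^+ 2
      - 2 * s * \sum_(g : 'S_n) theta F l g * young_char F row col g).
    rewrite mulr_sumr -sumrN -!big_split; apply: eq_bigr => g _ /=.
    have sq (a b : F) : (a - s * b) ^+ 2 = a ^+ 2 + s ^+ 2 * b ^+ 2 - 2 * s * (b * a) by ring.
    by rewrite sq ss mul1r.
  rewrite cc tt tc; transitivity (n`!%:R + n`!%:R - 2 * n`!%:R * s ^+ 2); first by ring.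
  by rewrite ss; ring.
move=> /psumr_eq0P H g; apply/eqP; rewrite -subr_eq0 -sqrf_eq0; apply/eqP.
by apply: H => // h _; apply: sqr_ge0.
Qed.
End YoungCharTheta.

Section SpechtYoung.
Variables (F : numFieldType) (la : seq nat).
Hypothesis la_part : is_part la.
Let n := sumn la.
Let G : {group 'S_n} := [set: 'S_n]%G.
Let row (k : 'I_n) : nat := reshape_index la k.
Let col (k : 'I_n) : nat := reshape_offset la k.

Lemma part_decr i j : (i <= j)%N -> (part la j <= part la i)%N.
Proof.
move=> ij; rewrite /part; have [jl|] := ltnP j (size la); last by move/(nth_default 0%N) => ->.
have /andP[la_sorted _] := la_part.
have geq_tr : transitive geq by move=> a b c; rewrite /geq /= => H1 H2; apply: leq_trans H2 H1.
have := sorted_leq_nth geq_tr (@leqnn) 0%N la_sorted; apply => //.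
by rewrite inE (leq_ltn_trans ij).
Qed.

Lemma diagram_cell_inj (x y : 'I_n) : row x = row y -> col x = col y -> x = y.
Proof.
rewrite /row /col => r c; apply/val_inj.
by rewrite /= -(reshape_indexK la x) -(reshape_indexK la y) r c.
Qed.

Lemma diagram_young (x : 'I_n) i : (i <= row x)%N -> exists2 y, row y = i & col y = col x.
Proof.
move=> ix; have lt : (col x < nth 0 la i)%N.
  exact: leq_trans (reshape_offsetP (ltn_ord x)) (part_decr ix).
by exists (Ordinal (flatten_indexP lt)); rewrite /row /col /= ?flatten_indexKl ?flatten_indexKr.
Qed.

Lemma diagram_row_lt (x : 'I_n) : (row x < size la)%N.
Proof. exact: reshape_indexP. Qed.

Lemma diagram_row_card i : #|[pred x | row x == i]| = part la i.
Proof.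
pose f (c : 'I_(part la i)) : 'I_n := Ordinal (flatten_indexP (ltn_ord c)).
have f_inj : injective f.
  by move=> a b /(congr1 val) /= /addnI E; apply/val_inj.
rewrite -[RHS]card_ord -(card_image f_inj); apply: eq_card => x; rewrite inE.
apply/eqP/imageP => [xi|[c _ ->]]; last by rewrite /row /= flatten_indexKl.
have xc : (col x < part la i)%N by rewrite -xi; apply: reshape_offsetP.
by exists (Ordinal xc) => //; apply/val_inj; rewrite /= -xi reshape_indexK.
Qed.

Local Notation c := (sym_coef F row col).
Local Notation u := (young_symmetrizer F la).

Lemma young_symmetrizerE j : u 0 j = c (enum_val j).
Proof.
rewrite summxE; apply: eq_bigr => p _; rewrite summxE; apply: eq_bigr => q _.
rewrite !mxE eqxx /=; congr (_ * _%:R).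
by rewrite -(inj_eq enum_val_inj) gring_indexK ?inE.
Qed.

(** Left multiplication by the symmetrizer. It commutes with the right translations [reg g], its row
    space is the Specht module, and it is proportional to a projection, as [submod_trace]
    requires. *)
Definition left_mul_mx : 'M[F]_#|G| := \matrix_i (u *m reg F (enum_val i)).
Local Notation L := left_mul_mx.

Lemma sum_group_index (f : 'S_n -> F) : \sum_(i < #|G|) f (enum_val i) = \sum_g f g.
Proof. by rewrite -(big_enum_val (A := mem (G : {set _})) f); apply: eq_bigl => g; rewrite inE. Qed.

Lemma mul_reg_entry (A : 'M[F]_#|G|) g i j :
  (A *m reg F g) i j = A i (gring_index G (enum_val j * g^-1)%g).
Proof.
rewrite mxE (bigD1 (gring_index G (enum_val j * g^-1)%g)) //= regE gring_indexK ?inE //.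
rewrite mulgKV eqxx mulr1 big1 ?addr0 // => k; rewrite regE => kj.
case: eqP => [E|_]; last by rewrite mulr0.
by rewrite E mulgK gring_valK eqxx in kj.
Qed.

Lemma left_mul_mxE i j : L i j = c (enum_val j * (enum_val i)^-1)%g.
Proof.
rewrite mxE mxE; under eq_bigr do rewrite young_symmetrizerE regE.
rewrite (sum_group_index (fun g => c g * (enum_val j == g * enum_val i)%g%:R)).
rewrite (bigD1 (enum_val j * (enum_val i)^-1)%g) //= mulgKV eqxx mulr1 big1 ?addr0 // => g gj.
case: eqP => [E|_]; last by rewrite mulr0.
by rewrite E mulgK eqxx in gj.
Qed.

Lemma left_mul_mx_comm g : L *m reg F g = reg F g *m L.
Proof.
apply/row_matrixP => i; rewrite !row_mul rowK -mulmxA -regM.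
have -> : matrix.row i (reg F g) = delta_mx 0 (gring_index G (enum_val i * g)%g).
  by rewrite /reg rowK.
by rewrite -rowE rowK gring_indexK ?inE.
Qed.

Lemma left_mul_mx_cyclic : (L :=: cyclic_mx (regular_repr F G) u)%MS.
Proof.
apply/eqmxP/andP; split.
  apply/row_subP => i; rewrite rowK; apply/cyclic_mxP; exists (reg F (enum_val i)) => //.
  by apply: envelop_mx_id; rewrite inE.
apply: cyclic_mx_sub.
  apply/mxmoduleP => g _; rewrite -[regular_repr F G g]/(reg F g) left_mul_mx_comm.
  exact: submxMl.
have -> : u = matrix.row (gring_index G 1%g) L.
  by rewrite rowK gring_indexK ?inE // reg1 mulmx1.
exact: row_sub.
Qed.

Lemma symmetrizer_entry i j : symmetrizer F row col i j = c ((enum_val i)^-1 * enum_val j)%g.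
Proof.
rewrite symmetrizerE // summxE; under eq_bigr do rewrite mxE regE.
rewrite (bigD1 ((enum_val i)^-1 * enum_val j)%g) //= mulKVg eqxx mulr1 big1 ?addr0 // => g gj.
case: eqP => [E|_]; last by rewrite mulr0.
by rewrite E mulKg eqxx in gj.
Qed.

(** Entry [(i, j)] is the coefficient of [e e = kappa e] at [g_j g_i^-1]: the convolution identity
    of [symmetrizer_idem], which concerns right multiplication, is read off for left
    multiplication. *)
Lemma left_mul_mx_idem : L *m L = kappa F row col *: L.
Proof.
apply/matrixP => i j; rewrite [RHS]mxE mxE.
set g := (enum_val j * (enum_val i)^-1)%g.
have := congr1 (fun A : 'M_#|G| => A (gring_index G 1%g) (gring_index G g))
  (symmetrizer_idem F diagram_cell_inj diagram_young).
rewrite /= [RHS]mxE mxE symmetrizer_entry !gring_indexK ?inE // invg1 mul1g left_mul_mxE => <-.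
under eq_bigr do rewrite !left_mul_mxE.
under [RHS]eq_bigr do rewrite !symmetrizer_entry !gring_indexK ?inE // invg1 mul1g.
rewrite (sum_group_index (fun h => c (h * (enum_val i)^-1)%g * c (enum_val j * h^-1)%g)).
rewrite (sum_group_index (fun h => c h * c (h^-1 * g)%g)).
rewrite (reindex_inj (mulIg (enum_val j))) (reindex_inj invg_inj) /=.
by apply: eq_bigr => h _; rewrite invMg invgK mulKVg mulrC /g mulgA.
Qed.

Lemma specht_charE g : specht_char F g = young_char F row col g.
Proof.
have k0 := kappa_neq0 F diagram_cell_inj diagram_young.
apply: (mulfI k0); rewrite -(submod_trace _ _ left_mul_mx_idem left_mul_mx_cyclic) ?inE //.
rewrite /young_char mulVKf // /class_sum mulmx_sumr tau_sum /mxtrace.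
under eq_bigr do rewrite mul_reg_entry left_mul_mxE gring_indexK ?inE //.
rewrite (sum_group_index (fun h => c (h * g^-1 * h^-1)%g)); apply: eq_bigr => h _.
by rewrite tau_symmetrizer_reg // !invMg invgK mulgA.
Qed.

End SpechtYoung.

Lemma specht_char1 (F : fieldType) (la : seq nat) :
  specht_char F (1%g : 'S_(sumn la)) = (specht_dim F la)%:R.
Proof. by rewrite /specht_char repr_mx1 mxtrace1. Qed.

(** The beta-numbers of the partition. [N] may exceed the number of parts, the surplus rows being
    empty. *)
Definition beads (la : seq nat) (N : nat) (i : nat) : nat := (part la i + (N - i.+1))%N.

Lemma specht_char_theta (F : realFieldType) (la : seq nat) (N : nat) :
  is_part la -> (size la <= N)%N ->
  exists2 s : F, s ^+ 2 = 1 & forall g : 'S_(sumn la),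
    specht_char F g = s * theta F (fun i : 'I_N => beads la N i) g.
Proof.
move=> la_part laN; have row_lt x := leq_trans (@diagram_row_lt la x) laN.
have [|s ss E] := @young_char_theta F _ _ _ (@diagram_cell_inj la) (@diagram_young la la_part)
  N (fun i : 'I_N => beads la N i) row_lt.
  by move=> i; rewrite diagram_row_card.
by exists s => // g; rewrite -E specht_charE.
Qed.

(** * Character values on the identity and on fixed-point-free involutions *)

Lemma contentE (T : finType) n (c : {ffun 'I_n -> T}) t : content c t = (\sum_i (c i == t))%N.
Proof.
rewrite /content -sum1_card big_mkcond; apply: eq_bigr => i _; rewrite inE.
by case: eqP.
Qed.

Lemma sum_content (T : finType) n (c : {ffun 'I_n -> T}) : (\sum_t content c t = n)%N.
Proof.
rewrite -[RHS]card_ord -[RHS]sum1_card (partition_big c predT) //=.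
by apply: eq_bigr => t _; rewrite -[LHS]sum1_card; apply: eq_bigl => x; rewrite !inE.
Qed.

Lemma card_content (T : finType) n (w : T -> nat) : (\sum_t w t = n)%N ->
  (#|[pred c : {ffun 'I_n -> T} | [forall t, content c t == w t]]| * \prod_t (w t)`! = n`!)%N.
Proof.
elim: n w => [|n IH] w wn.
  have w0 t : w t = 0%N by apply/eqP; move/eqP: wn; rewrite sum_nat_eq0 => /forallP/(_ t).
  rewrite big1 => [|t _]; last by rewrite w0.
  rewrite muln1 (eq_card (B := predT)) ?card_ffun ?card_ord ?expn0 // => c.
  by rewrite !inE; apply/forallP => t; rewrite contentE big_ord0 w0.
pose rest (c : {ffun 'I_n.+1 -> T}) : {ffun 'I_n -> T} := [ffun i => c (lift ord0 i)].
have contentS c u : content c u = ((c ord0 == u) + content (rest c) u)%N.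
  by rewrite !contentE big_ord_recl; congr (_ + _)%N; apply: eq_bigr => i _; rewrite ffunE.
pose w' t u := (w u - (t == u))%N.
rewrite -sum1_card (partition_big (fun c : {ffun 'I_n.+1 -> T} => c ord0) predT) //= big_distrl /=.
rewrite factS -[X in _ = (X * _)%N]wn big_distrl /=; apply: eq_bigr => t _.
have [wt0|wt0] := posnP (w t).
  rewrite wt0 mul0n; apply/eqP; rewrite muln_eq0; apply/orP; left.
  rewrite big1 // => c /andP[/forallP/(_ t) + /eqP c0].
  by rewrite contentS c0 eqxx wt0.
have w'n : (\sum_u w' t u = n)%N.
  apply/eqP; rewrite -eqSS -wn [in X in _ == X](bigD1 t) //= (bigD1 t) //= /w' eqxx -addSn.
  rewrite -subSn // subn1 /= eqn_add2l; apply/eqP; apply: eq_bigr => u ut.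
  by rewrite eq_sym (negbTE ut) subn0.
have -> : (\prod_u (w u)`! = w t * \prod_u (w' t u)`!)%N.
  rewrite (bigD1 t) //= [in RHS](bigD1 t) //= /w' eqxx mulnA; congr (_ * _)%N.
    by case: (w t) wt0 => // k _; rewrite factS subn1.
  by apply: eq_bigr => u ut; rewrite eq_sym (negbTE ut) subn0.
rewrite mulnCA -(IH _ w'n); congr (_ * (_ * _))%N.
pose cons (c : {ffun 'I_n -> T}) : {ffun 'I_n.+1 -> T} :=
  [ffun i => if unlift ord0 i is Some j then c j else t].
have consK : cancel cons rest by move=> c; apply/ffunP => i; rewrite !ffunE liftK.
have cons0 c : cons c ord0 = t by rewrite ffunE unlift_none.
rewrite -(card_image (can_inj consK)) -sum1_card; apply: eq_bigl => c.
have cE u : (content c u == w u) = ((c ord0 == u) + content (rest c) u == w u)%N by rewrite contentS.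
apply/andP/imageP => [[/forallP H /eqP c0]|[d + ->]].
  exists (rest c); last first.
    apply/ffunP => i; rewrite ffunE; case: unliftP => [j ->|->]; first by rewrite ffunE.
    by rewrite c0.
  rewrite inE; apply/forallP => u; rewrite /w'; have := H u; rewrite cE c0 => /eqP E.
  by rewrite -E addKn.
move=> /forallP H; rewrite cons0; split=> //; apply/forallP => u.
rewrite contentS cons0 consK (eqP (H u)) /w'; have [<-|_] := eqVneq t u; last by rewrite subn0.
by rewrite subn1 add1n prednK.
Qed.

(** The coefficient of [X^(a - j)] in [exp (X^k)]: the generating series of complete symmetric
    functions when only cycles of length [k] are present. *)
Definition inv_fact_entry (F : fieldType) (k a j : nat) : F :=
  if (j <= a)%N && (k %| a - j)%N then (((a - j) %/ k)`!%:R)^-1 else 0.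

(** Fixed colourings are colourings of the [m] blocks, with contents multiplied by [k], and each
    block content [w] occurs [m! / prod (w t)!] times. Contents of the wrong total have zero
    [alt_content], so the sum over contents is free and factors over the rows of the determinant. *)
Lemma theta_uniform_fibers (F : numFieldType) n m k N (l : 'I_N -> nat) (g : 'S_n)
    (pi : 'I_n -> 'I_m) :
  (0 < k)%N -> (\sum_i l i = k * m + \sum_(i < N) i)%N ->
  (forall y, #|[pred x | pi x == y]| = k) ->
  (forall c : {ffun 'I_n -> 'I_N}, (forall x, c (g x) = c x) <->
     (forall x y, pi x = pi y -> c x = c y)) ->
  theta F l g = m`!%:R * \det (\matrix_(i < N, j < N) inv_fact_entry F k (l i) j).
Proof.
move=> k0 lsum fib inv.
have [sec secK] : exists sec : 'I_m -> 'I_n, cancel sec pi.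
  have H y : exists x, pi x == y.
    by apply/existsP; apply: contraT => /existsPn H; move: k0; rewrite -(fib y) eq_card0 // => x;
      rewrite inE; apply/negbTE; apply: H.
  by exists (fun y => xchoose (H y)) => y; apply/eqP; apply: (xchooseP (H y)).
pose lift_col (d : {ffun 'I_m -> 'I_N}) : {ffun 'I_n -> 'I_N} := [ffun x => d (pi x)].
pose B := (m + \max_i l i)%N.
have mB : (m <= B)%N by apply: leq_addr.
have lB i : (l i <= B)%N by rewrite (leq_trans (leq_bigmax i)) // leq_addl.
pose ct (d : {ffun 'I_m -> 'I_N}) : {ffun 'I_N -> 'I_B.+1} := [ffun t => inord (content d t)].
have ctE d t : ct d t = content d t :> nat.
  by rewrite ffunE inordK // ltnS (leq_trans (content_le _ _)).
transitivity (\sum_(d : {ffun 'I_m -> 'I_N}) alt_content F l (fun i => k * ct d i)%N).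
  rewrite /theta (reindex_onto lift_col (fun c => [ffun y => c (sec y)])) /=; last first.
    move=> c /forallP H; have /inv cE : forall x, c (g x) = c x by move=> x; apply/eqP.
    by apply/ffunP => x; rewrite !ffunE; apply: cE; rewrite secK.
  apply: eq_big => [d|d _].
    apply/andP; split; last by apply/eqP/ffunP => y; rewrite !ffunE secK.
    apply/forallP => x; apply/eqP; move: x; apply/inv => x y E.
    by rewrite !ffunE E.
  apply: eq_alt_content => i; rewrite ctE /content -sum1_card.
  rewrite (partition_big pi (fun y => d y == i)) /=; last by move=> x; rewrite inE ffunE.
  rewrite -sum1_card big_distrr /=; apply: eq_bigr => y yi; rewrite muln1 -[RHS](fib y) -sum1_card.
  by apply: eq_bigl => x; rewrite !inE ffunE andb_idl // => /eqP ->.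
rewrite (partition_big ct (fun w => (\sum_t w t)%N == m)) /=; last first.
  by move=> d _; under eq_bigr do rewrite ctE; rewrite sum_content.
transitivity (\sum_(w : {ffun 'I_N -> 'I_B.+1})
    (m`!%:R / \prod_t (w t)`!%:R) * alt_content F l (fun i => k * w i)%N).
  rewrite [RHS](bigID (fun w : {ffun 'I_N -> 'I_B.+1} => (\sum_t w t)%N == m)) /=.
  rewrite [X in _ + X]big1 ?addr0 => [|w /eqP wm]; last first.
    have [->|/alt_content_sum] := eqVneq (alt_content F l (fun i => k * w i)%N) 0; first by rewrite mulr0.
    rewrite lsum -big_distrr => /eqP; rewrite eqn_add2r eqn_pmul2l // => /eqP E.
    by case: wm.
  apply: eq_bigr => w /eqP wm.
  rewrite (eq_bigr (fun=> alt_content F l (fun i => k * w i)%N)); last by move=> d /eqP ->.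
  rewrite sumr_const -[LHS]mulr_natl; congr (_ * _); rewrite -(card_content wm) natrM natr_prod mulfK.
    congr (_%:R); apply: eq_card => d; apply/idP/forallP => [dw t|H].
      have /eqP <- : ct d == w by exact: dw.
      by rewrite ctE.
    suff -> : w = ct d by apply: eqxx.
    by apply/ffunP => t; apply/val_inj; rewrite /= ctE; apply/esym/eqP.
  by apply/prodf_neq0 => t _; rewrite pnatr_eq0 -lt0n fact_gt0.
under eq_bigr do rewrite -mulrA.
rewrite -mulr_sumr; congr (_ * _).
under eq_bigr do rewrite alt_contentE mulr_sumr.
rewrite exchange_big; apply: eq_bigr => s _ /=.
under eq_bigr do rewrite mulrCA.
rewrite -mulr_sumr; congr (_ * _).
transitivity (\prod_(i < N) \sum_(v < B.+1) ((v`!%:R)^-1 * (l i == k * v + s i)%N%:R : F)).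
  rewrite bigA_distr_bigA /=; apply: eq_bigr => w _; rewrite big_split /= prodfV; congr (_ * _).
  case: forallP => [H|H]; first by rewrite big1 // => i _; rewrite H.
  have /existsP[i iP] : [exists i, l i != (k * w i + s i)%N].
    by rewrite -negb_forall; apply/negP => /forallP.
  by rewrite (bigD1 i) //= (negbTE iP) mul0r.
apply: eq_bigr => i _; rewrite mxE /inv_fact_entry.
case: ifP => [/andP[sl kl]|H].
  have vB : ((l i - s i) %/ k < B.+1)%N.
    by rewrite ltnS (leq_trans (leq_div _ _)) // (leq_trans (leq_subr _ _)).
  rewrite (bigD1 (Ordinal vB)) //= mulnC divnK // subnK // eqxx mulr1 big1 ?addr0 // => v vne.
  case: eqP => [E|_]; last by rewrite mulr0.
  by case/eqP: vne; apply/val_inj; rewrite /= E addnK mulKn.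
rewrite big1 // => v _; case: eqP => [E|_]; last by rewrite mulr0.
by move: H; rewrite E leq_addl addnK dvdn_mulr.
Qed.

Lemma theta1 (F : numFieldType) n N (l : 'I_N -> nat) :
  (\sum_i l i = n + \sum_(i < N) i)%N ->
  theta F l (1%g : 'S_n) = n`!%:R * \det (\matrix_(i < N, j < N) inv_fact_entry F 1 (l i) j).
Proof.
move=> lsum; apply: (@theta_uniform_fibers F n n 1 N l 1%g id) => //.
- by rewrite mul1n.
- by move=> y; rewrite -[RHS](card1 y); apply: eq_card => x; rewrite !inE.
by move=> c; split=> [_ x y ->|_ x]; rewrite ?perm1.
Qed.

Lemma theta_cycle_class (F : numFieldType) n m k N (l : 'I_N -> nat) (g : 'S_n) :
  (0 < k)%N -> (\sum_i l i = k * m + \sum_(i < N) i)%N -> g \in cycle_class n (nseq m k) ->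
  theta F l g = m`!%:R * \det (\matrix_(i < N, j < N) inv_fact_entry F k (l i) j).
Proof.
move=> k0 lsum; rewrite inE => cyc.
have mE : #|porbits g| = m.
  by have := perm_size cyc; rewrite size_map size_nseq -cardE.
have inP x : porbit g x \in porbits g by apply: imset_f.
pose pi x : 'I_m := cast_ord mE (enum_rank_in (inP x) (porbit g x)).
have piE x y : (pi x == pi y) = (porbit g x == porbit g y).
  rewrite (inj_eq (@cast_ord_inj _ _ _)) -(inj_eq enum_val_inj) !enum_rankK_in //.
have pi_val x (y : 'I_m) : (pi x == y) = (porbit g x == enum_val (cast_ord (esym mE) y)).
  rewrite -(inj_eq (@cast_ord_inj _ _ (esym mE))) cast_ordK -(inj_eq enum_val_inj).
  by rewrite enum_rankK_in.
apply: (@theta_uniform_fibers F n m k N l g pi) => //.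
  move=> y; set X := enum_val (cast_ord (esym mE) y).
  have XP : X \in porbits g by apply: enum_valP.
  have XE : #|X| = k.
    have : #|X| \in nseq m k.
      rewrite -(perm_mem cyc); apply/mapP; exists X => //; by rewrite mem_enum.
    by rewrite mem_nseq => /andP[_ /eqP].
  rewrite -XE; apply: eq_card => x; rewrite inE pi_val -/X.
  case/imsetP: XP => z _ ->.
  by rewrite eq_porbit_mem porbit_sym.
move=> c; split=> [H x y|H x]; last first.
  apply: H; apply/eqP; rewrite piE eq_porbit_mem.
  by have := mem_porbit g 1 x; rewrite expg1.
move/eqP; rewrite piE eq_porbit_mem => /porbitP[i ->].
by elim: i => [|i IH]; rewrite ?expg0 ?perm1 // expgSr permM H.
Qed.

(** * Determinants of inverse factorials *)

Lemma det_monic_basis (F : comNzRingType) N (x : 'I_N -> F) (p : nat -> {poly F}) :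
  (forall j, p j \is monic) -> (forall j, size (p j) = j.+1) ->
  \det (\matrix_(i < N, j < N) (p j).[x i]) = \det (\matrix_(i < N, j < N) x i ^+ j).
Proof.
move=> mon sz.
have -> : \matrix_(i < N, j < N) (p j).[x i]
    = \matrix_(i < N, j < N) x i ^+ j *m \matrix_(k < N, j < N) (p j)`_k.
  apply/matrixP => i j; rewrite !mxE (horner_coef_wide (n := N)) ?sz ?ltn_ord //.
  by apply: eq_bigr => k _; rewrite !mxE mulrC.
rewrite det_mulmx -[RHS]mulr1; congr (_ * _); rewrite -det_tr det_trig.
  rewrite big1 // => i _; rewrite !mxE.
  by have := mon i; rewrite monicE lead_coefE sz => /eqP.
by apply/is_trig_mxP => i j ij; rewrite !mxE nth_default // sz.
Qed.

Definition vandermonde (F : numDomainType) N (x : 'I_N -> nat) : F :=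
  \prod_(i < N) \prod_(j < N | (i < j)%N) `|(x j)%:R - (x i)%:R|.

Lemma norm_det_powers (F : numFieldType) N (x : 'I_N -> nat) :
  `|\det (\matrix_(i < N, j < N) ((x i)%:R : F) ^+ j)| = vandermonde F x.
Proof.
have -> : \matrix_(i < N, j < N) ((x i)%:R : F) ^+ j = (Vandermonde N (\row_i (x i)%:R))^T.
  by apply/matrixP => i j; rewrite !mxE.
rewrite det_tr det_Vandermonde normr_prod; apply: eq_bigr => i _.
by rewrite normr_prod; apply: eq_bigr => j _; rewrite !mxE.
Qed.

Definition ffact_poly (F : comNzRingType) (j : nat) : {poly F} := \prod_(i < j) ('X - (i%:R)%:P).

Lemma ffact_polyE (F : comNzRingType) (j a : nat) :
  (ffact_poly F j).[a%:R] = (a ^_ j)%:R.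
Proof.
elim: j a => [|j IH] a; first by rewrite /ffact_poly big_ord0 hornerE ffactn0.
rewrite /ffact_poly big_ord_recr hornerM /= -/(ffact_poly F j) IH !hornerE ffactnSr natrM.
case: (leqP j a) => [ja|aj]; first by rewrite natrB.
by rewrite ffact_small // !mul0r.
Qed.

(** [1 / (x - j)!] is [1 / x!] times the falling factorial of [x] of order [j], a monic polynomial
    of degree [j] that also vanishes when [x < j]. *)
Lemma norm_det_inv_fact1 (F : numFieldType) N (x : 'I_N -> nat) :
  `|\det (\matrix_(i < N, j < N) inv_fact_entry F 1 (x i) j)|
  = vandermonde F x / \prod_i (x i)`!%:R.
Proof.
have f0 a : a`!%:R != 0 :> F by rewrite pnatr_eq0 -lt0n fact_gt0.
have -> : \matrix_(i < N, j < N) inv_fact_entry F 1 (x i) j =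
    diag_mx (\row_i ((x i)`!%:R)^-1) *m \matrix_(i < N, j < N) (ffact_poly F j).[(x i)%:R].
  apply/matrixP => i j; rewrite mul_diag_mx !mxE ffact_polyE /inv_fact_entry dvd1n divn1 andbT.
  case: leqP => ji; last by rewrite ffact_small // mulr0.
  apply: (mulfI (f0 (x i))); rewrite mulVKf // -(ffact_fact ji) natrM mulfK //.
rewrite det_mulmx det_diag det_monic_basis; last 2 first.
- by move=> j; apply: monic_prod_XsubC.
- by move=> j; rewrite size_prod_XsubC [index_enum _]unlock -enumT size_enum_ord.
rewrite normrM norm_det_powers mulrC; congr (_ * _).
rewrite normr_prod -prodfV; apply: eq_bigr => i _; rewrite mxE ger0_norm //.
by rewrite invr_ge0 ler0n.
Qed.

Lemma norm_det_perm_mx (F : numFieldType) N (A : 'M[F]_N) (s t : 'S_N) :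
  `|\det (\matrix_(i, j) A (s i) (t j))| = `|\det A|.
Proof.
have -> : \matrix_(i, j) A (s i) (t j) = row_perm s (col_perm t A).
  by apply/matrixP => i j; rewrite !mxE.
by rewrite row_permE col_permE !det_mulmx !det_perm !normrM !normr_sign mul1r mulr1.
Qed.

(** An entry vanishes unless [l i] and [j] have the same parity. With rows and columns sorted by
    parity the matrix is block diagonal, and halving turns each block into one for [k = 1]. *)
Lemma norm_det_inv_fact2 (F : numFieldType) M (l : 'I_(M + M) -> nat) (s : 'S_(M + M))
    (a b : 'I_M -> nat) :
  (forall i, l (s (lshift M i)) = (a i).*2) ->
  (forall i, l (s (rshift M i)) = (b i).*2.+1) ->
  `|\det (\matrix_(i < M + M, j < M + M) inv_fact_entry F 2 (l i) j)|
  = (vandermonde F a / \prod_i (a i)`!%:R) * (vandermonde F b / \prod_i (b i)`!%:R).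
Proof.
move=> la lb.
have even_lt (i : 'I_M) : (i.*2 < M + M)%N by have := ltn_ord i; lia.
have odd_lt (i : 'I_M) : (i.*2.+1 < M + M)%N by have := ltn_ord i; lia.
pose t0 (j : 'I_(M + M)) : 'I_(M + M) :=
  match split j with inl i => Ordinal (even_lt i) | inr i => Ordinal (odd_lt i) end.
have t0l i : t0 (lshift M i) = Ordinal (even_lt i) by rewrite /t0 (unsplitK (inl i)).
have t0r i : t0 (rshift M i) = Ordinal (odd_lt i) by rewrite /t0 (unsplitK (inr i)).
have t0_inj : injective t0.
  move=> i j; case: (split_ordP i) => i' ->; case: (split_ordP j) => j' ->;
    rewrite ?t0l ?t0r => /(congr1 val) /= E.
  - by congr lshift; apply/val_inj => /=; lia.
  - by lia.
  - by lia.
  - by congr rshift; apply/val_inj => /=; lia.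
rewrite -(norm_det_perm_mx _ s (perm t0_inj)).
have -> : \matrix_(i, j) (\matrix_(i < M + M, j < M + M) inv_fact_entry F 2 (l i) j) (s i) (perm t0_inj j)
   = block_mx (\matrix_(i < M, j < M) inv_fact_entry F 1 (a i) j) 0
              0 (\matrix_(i < M, j < M) inv_fact_entry F 1 (b i) j).
  apply/matrixP => i j; rewrite [LHS]mxE [LHS]mxE permE.
  case: (split_ordP i) => i' ->; case: (split_ordP j) => j' ->; rewrite ?t0l ?t0r ?la ?lb
    ?block_mxEul ?block_mxEur ?block_mxEdl ?block_mxEdr !mxE /inv_fact_entry /= ?dvd1n ?divn1 ?andbT.
  - by rewrite leq_double -doubleB -muln2 dvdn_mull // mulnK //= andbT.
  - by case: ifP => // /andP[le]; rewrite dvdn2 oddB ?oddS ?odd_double.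
  - by case: ifP => // /andP[le]; rewrite dvdn2 oddB ?oddS ?odd_double.
  - by rewrite ltnS leq_double subSS -doubleB -muln2 dvdn_mull // mulnK //= andbT.
by rewrite det_ublock normrM !norm_det_inv_fact1.
Qed.

Lemma sum_beads_part (la : seq nat) (N : nat) : is_part la -> (size la <= N)%N ->
  (\sum_(i < N) beads la N i = sumn la + \sum_(i < N) i)%N.
Proof.
move=> la_part laN; have row_lt x := leq_trans (@diagram_row_lt la x) laN.
apply: (@sum_beads _ (fun k : 'I_(sumn la) => reshape_index la k) N _ row_lt) => i.
by rewrite diagram_row_card.
Qed.

Lemma beads_decr (la : seq nat) (N i j : nat) : is_part la ->
  (i < j)%N -> (j < N)%N -> (beads la N j < beads la N i)%N.
Proof. by move=> la_part ij jN; have := part_decr la_part (ltnW ij); rewrite /beads; lia. Qed.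

Lemma norm_sign (F : realFieldType) (s x : F) : s ^+ 2 = 1 -> `|s * x| = `|x|.
Proof.
move=> s1; rewrite normrM; have /eqP : `|s| ^+ 2 = 1 by rewrite -normrX s1 normr1.
by rewrite -[X in _ == X](expr1n _ 2) eqrXn2 // => /eqP ->; rewrite mul1r.
Qed.

Lemma specht_dim_vandermonde (F : realFieldType) (la : seq nat) (N : nat) :
  is_part la -> (size la <= N)%N ->
  (specht_dim F la)%:R = (sumn la)`!%:R *
    (vandermonde F (fun i : 'I_N => beads la N i) / \prod_(i < N) (beads la N i)`!%:R).
Proof.
move=> la_part laN; have [s ss E] := specht_char_theta F la_part laN.
rewrite -specht_char1 -[LHS]ger0_norm; last by rewrite specht_char1 ler0n.
rewrite E norm_sign // theta1; last exact: sum_beads_part.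
by rewrite normrM norm_det_inv_fact1 ger0_norm.
Qed.

Lemma norm_specht_char_involution (F : realFieldType) (la : seq nat) (m M : nat)
    (s : 'S_(M + M)) (a b : 'I_M -> nat) (g : 'S_(sumn la)) :
  is_part la -> (size la <= M + M)%N -> sumn la = (2 * m)%N ->
  g \in cycle_class (sumn la) (nseq m 2) ->
  (forall i, beads la (M + M) (s (lshift M i)) = (a i).*2) ->
  (forall i, beads la (M + M) (s (rshift M i)) = (b i).*2.+1) ->
  `|specht_char F g| = m`!%:R *
    ((vandermonde F a / \prod_i (a i)`!%:R) * (vandermonde F b / \prod_i (b i)`!%:R)).
Proof.
move=> la_part laN lam gC ea eb; have [e ee E] := specht_char_theta F la_part laN.
rewrite E norm_sign // (@theta_cycle_class F _ m 2) //; last first.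
  by rewrite -lam sum_beads_part.
by rewrite normrM ger0_norm // (norm_det_inv_fact2 _ ea eb).
Qed.

Lemma specht_dim_gt0 (F : realFieldType) (la : seq nat) : is_part la -> (0 < specht_dim F la)%N.
Proof.
move=> la_part; rewrite -(ltr0n F) (specht_dim_vandermonde F la_part (leqnn _)).
rewrite mulr_gt0 ?divr_gt0 ?ltr0n ?fact_gt0 //.
  apply: prodr_gt0 => i _; apply: prodr_gt0 => j ij; rewrite normr_gt0 subr_eq0 eqr_nat.
  by rewrite ltn_eqF // beads_decr.
by apply: prodr_gt0 => i _; rewrite ltr0n fact_gt0.
Qed.

(** With a single colour every colouring is fixed by every permutation, so [theta] is constant. *)
Lemma specht_char_row (F : realFieldType) n (g : 'S_(sumn [:: n.+1])) :
  specht_char F g = (specht_dim F [:: n.+1])%:R.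
Proof.
have la_part : is_part [:: n.+1] by [].
have [s _ E] := specht_char_theta F la_part (N := 1) (leqnn _).
rewrite -specht_char1 !E; congr (_ * _); apply: eq_bigl => c.
by rewrite !(introT forallP) // => x; rewrite [X in X == _]ord1 [X in _ == X]ord1.
Qed.

(* Imported only here because [all_classical] shadows finset and fintype lemmas
   used above. *)
From mathcomp Require Import all_classical all_reals all_analysis measurable_realfun.
Import numFieldNormedType.Exports.

(** * The discrete logarithmic energy *)

Section DiscreteLogEnergy.
Variable R : realType.

(* The value at 0 makes the second difference below positive at distance 1. *)
Definition logker (t : R) : R := if t == 0 then - 2 else ln `|t|.

Definition logker_diff2 (t : R) : R := 2 * logker t - logker (t + 1) - logker (t - 1).

Lemma logkerN t : logker (- t) = logker t.
Proof. by rewrite /logker oppr_eq0 normrN. Qed.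

Lemma logker_diff2N t : logker_diff2 (- t) = logker_diff2 t.
Proof.
rewrite /logker_diff2 logkerN -(logkerN (- t + 1)) -(logkerN (- t - 1)) !opprD !opprK.
ring.
Qed.

Lemma ln2_le1 : ln 2 <= 1 :> R.
Proof. by have := @le_ln1Dx R 1; rewrite -natr1 addrC => ->//; rewrite ltrN10. Qed.

(** For [k >= 2] the second difference is [- ln (1 - k ^- 2)]; for [k = 1] it is [2 - ln 2], where
    the value at 0 enters. *)
Lemma logker_diff2_ge_nat (k : nat) : (0 < k)%N -> (k%:R ^- 2 : R) <= logker_diff2 k%:R.
Proof.
case: k => // -[_|k _].
  rewrite /logker_diff2 /logker subrr eqxx oner_eq0 normr1 ln1 -[1 + 1]/(2 : R).
  rewrite pnatr_eq0 /= normr_nat expr1n invr1 mulr0; have := ln2_le1; lra.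
set t : R := k.+2%:R.
have t2 : 2 <= t by rewrite /t ler_nat.
rewrite /logker_diff2 /logker !gt_eqF; try lra.
rewrite !ger0_norm; try lra.
have -> : 2 * ln t - ln (t + 1) - ln (t - 1) = - ln (1 - t ^- 2).
  have -> : 1 - t ^- 2 = (t + 1) * (t - 1) * (t * t)^-1 by field; apply: lt0r_neq0; lra.
  rewrite lnM ?lnM ?lnV ?lnM ?posrE ?invr_gt0 ?mulr_gt0 //; try lra.
have := @le_ln1Dx R (- t ^- 2); have : t ^- 2 < 1.
  have t0 : 0 < t by lra.
  by rewrite invf_lt1 ?exprn_gt0 //; apply: exprn_egt1 => //; lra.
move=> H le1; have {}le1 := le1 ltac:(by rewrite ltrN2). by rewrite lerNr.
Qed.

Lemma logker_diff2_ge (x y : nat) : x <> y ->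
  ((x%:R - y%:R) ^- 2 : R) <= logker_diff2 (x%:R - y%:R).
Proof.
move=> xy; have [lt|lt|//] := ltngtP x y.
  rewrite -[x%:R - _]opprB logker_diff2N sqrrN -natrB ?(ltnW lt) //.
  by apply: logker_diff2_ge_nat; rewrite subn_gt0.
by rewrite -natrB ?(ltnW lt) //; apply: logker_diff2_ge_nat; rewrite subn_gt0.
Qed.

Lemma logker_nat_le (k l : nat) : (k <= l)%N -> logker k%:R <= logker l%:R.
Proof.
move=> kl; rewrite /logker !pnatr_eq0; case: eqP => [_|/eqP k0].
  case: eqP => // /eqP l0; apply: (@le_trans _ _ 0); first by lra.
  by rewrite ln_ge0 // normr_nat ler1n lt0n.
have l0 : (0 < l)%N by apply: leq_trans kl; rewrite lt0n.
rewrite eqn0Ngt l0 /= !normr_nat ler_ln ?posrE ?ltr0n //; first by rewrite ler_nat.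
by rewrite lt0n.
Qed.

(** The row sum telescopes to increments of [logker] at the two ends, and [logker] is increasing on
    the naturals. *)
Lemma sum_logker_diff2_le0 (B x : nat) : (x <= B)%N ->
  \sum_(y < B.+1) logker_diff2 (x%:R - y%:R) <= 0.
Proof.
move=> xB; pose g (y : nat) := logker (x%:R - y%:R + 1) - logker (x%:R - y%:R).
rewrite -(big_mkord predT (fun y => logker_diff2 (x%:R - y%:R))) /=.
rewrite (eq_big_nat _ _ (F2 := fun y => g y.+1 - g y)); last first.
  move=> y _; rewrite /g /logker_diff2 -[y.+1%:R]natr1.
  have -> : x%:R - (y%:R + 1) + 1 = x%:R - y%:R :> R by ring.
  have -> : x%:R - (y%:R + 1) = x%:R - y%:R - 1 :> R by ring.
  ring.
rewrite telescope_sumr // /g.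
have -> : x%:R - B.+1%:R + 1 = - (B - x)%:R :> R by rewrite natrB // -[B.+1%:R]natr1; ring.
have -> : x%:R - B.+1%:R = - (B - x).+1%:R :> R by rewrite -[B.+1%:R]natr1 -[(B - x).+1%:R]natr1 natrB //; ring.
rewrite !logkerN subr0 -[x%:R + 1]/(x%:R + 1%:R) -natrD addn1.
have := logker_nat_le (leqnSn (B - x)); have := logker_nat_le (leqnSn x); lra.
Qed.

Definition partial_sum (f : nat -> R) (x : nat) : R := \sum_(y < x) f y.

(** Abel summation in both variables; the boundary terms vanish because the partial sums are 0 at 0
    and at [B]. For the same reason the truncation of [x.-1] at 0 does no harm. *)
Lemma sum_logker_by_parts (f : nat -> R) (B : nat) : partial_sum f B = 0 ->
  \sum_(x < B) \sum_(y < B) f x * f y * logker (x%:R - y%:R)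
  = \sum_(x < B.+1) \sum_(y < B.+1)
      partial_sum f x * partial_sum f y * logker_diff2 (x%:R - y%:R).
Proof.
set F := partial_sum f => FB.
have F0 : F 0%N = 0 by rewrite /F /partial_sum big_ord0.
have FS x : f x = F x.+1 - F x by rewrite /F /partial_sum big_ord_recr /= addrAC subrr add0r.
have parts (g : nat -> R) : \sum_(x < B) f x * g x
    = \sum_(x < B.+1) F x * (g x.-1 - g x).
  rewrite big_ord_recl /= F0 mul0r add0r.
  have -> : \sum_(x < B) f x * g x = \sum_(x < B) F x.+1 * g x - \sum_(x < B) F x * g x.
    by rewrite -sumrB; apply: eq_bigr => x _; rewrite FS mulrBl.
  have -> : \sum_(x < B) F x * g x = \sum_(x < B) F x.+1 * g x.+1.
    transitivity (\sum_(x < B.+1) F x * g x).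
      by rewrite big_ord_recr /= FB mul0r addr0.
    by rewrite big_ord_recl F0 mul0r add0r.
  by rewrite -sumrB; apply: eq_bigr => x _; rewrite /bump /= add1n mulrBr.
under eq_bigr => x _.
  under eq_bigr => y _ do rewrite -mulrA mulrCA.
  rewrite (parts (fun y => f x * logker (x%:R - y%:R))).
  over.
rewrite exchange_big [RHS]exchange_big; apply: eq_bigr => y _ /=.
under eq_bigr => x _ do rewrite mulrBr ![F y * (f x * _)]mulrCA -mulrBr -mulrBr.
rewrite (parts (fun x => F y * (logker (x%:R - y.-1%:R) - logker (x%:R - y%:R)))).
apply: eq_bigr => x _; case: (posnP x) => [->|x0]; first by rewrite F0 !mul0r.
case: (posnP y) => [->|y0]; first by rewrite F0 !(mul0r, mulr0) subrr mulr0.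
rewrite -mulrBr mulrA; congr (_ * _); rewrite /logker_diff2 -subn1 -[y.-1]subn1 !natrB //.
have -> : x%:R - 1 - (y%:R - 1) = x%:R - y%:R :> R by ring.
have -> : x%:R - 1 - y%:R = x%:R - y%:R - 1 :> R by ring.
have -> : x%:R - (y%:R - 1) = x%:R - y%:R + 1 :> R by ring.
ring.
Qed.

(** The sum of [f x ^+ 2] is the diagonal contribution of [logker], [- 2^-1 * - 2]. Writing
    [F x * F y] through [(F x - F y) ^+ 2] leaves diagonal terms weighted by the nonpositive row
    sums, and off the diagonal the kernel dominates the inverse square distance. *)
Lemma discrete_energy_le (f : nat -> R) (B : nat) : partial_sum f B = 0 ->
  4^-1 * \sum_(x < B.+1) \sum_(y < B.+1)
      ((partial_sum f x - partial_sum f y) / (x%:R - y%:R)) ^+ 2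
  <= - 2^-1 * (\sum_(x < B) \sum_(y < B) f x * f y * ln `|x%:R - y%:R|)
     + \sum_(x < B) f x ^+ 2.
Proof.
move=> FB; set F := partial_sum f; pose K x y := logker_diff2 (x%:R - y%:R).
have -> : - 2^-1 * (\sum_(x < B) \sum_(y < B) f x * f y * ln `|x%:R - y%:R|)
     + \sum_(x < B) f x ^+ 2
  = - 2^-1 * \sum_(x < B) \sum_(y < B) f x * f y * logker (x%:R - y%:R).
  have -> : \sum_(x < B) \sum_(y < B) f x * f y * logker (x%:R - y%:R)
     = \sum_(x < B) \sum_(y < B) f x * f y * ln `|x%:R - y%:R| - 2 * \sum_(x < B) f x ^+ 2.
    rewrite mulr_sumr -sumrB; apply: eq_bigr => x _.
    rewrite (bigD1 x) //= [in RHS](bigD1 x) //= /logker subrr eqxx normr0 ln0 //.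
    rewrite (eq_bigr (fun y : 'I_B => f x * f y * ln `|x%:R - y%:R|)); first by ring.
    move=> y yx; rewrite subr_eq0 eqr_nat; case: eqP => // E.
    by case/eqP: yx; apply/val_inj.
  by field.
rewrite sum_logker_by_parts // -/F.
have sq : \sum_(x < B.+1) \sum_(y < B.+1) K x y * (F x - F y) ^+ 2
    = 2 * \sum_(x < B.+1) F x ^+ 2 * \sum_(y < B.+1) K x y
      - 2 * \sum_(x < B.+1) \sum_(y < B.+1) F x * F y * K x y.
  have E : \sum_(x < B.+1) \sum_(y < B.+1) F y ^+ 2 * K x y
      = \sum_(x < B.+1) \sum_(y < B.+1) F x ^+ 2 * K x y.
    rewrite exchange_big; apply: eq_bigr => x _; apply: eq_bigr => y _ /=.
    by rewrite /K -[x%:R - y%:R]opprB logker_diff2N.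
  rewrite [2 * \sum_(x < B.+1) F x ^+ 2 * _]mulr_natl mulr2n.
  under [X in _ = X + _ - _]eq_bigr do rewrite mulr_sumr.
  under [X in _ = _ + X - _]eq_bigr do rewrite mulr_sumr.
  rewrite -[X in _ = _ + X - _]E mulr_sumr -big_split -sumrB; apply: eq_bigr => x _ /=.
  rewrite mulr_sumr -big_split -sumrB; apply: eq_bigr => y _ /=.
  ring.
have neg : \sum_(x < B.+1) F x ^+ 2 * \sum_(y < B.+1) K x y <= 0.
  apply: sumr_le0 => x _; apply: mulr_ge0_le0; first exact: sqr_ge0.
  by apply: sum_logker_diff2_le0; rewrite -ltnS.
have le : \sum_(x < B.+1) \sum_(y < B.+1) ((F x - F y) / (x%:R - y%:R)) ^+ 2
   <= \sum_(x < B.+1) \sum_(y < B.+1) K x y * (F x - F y) ^+ 2.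
  apply: ler_sum => x _; apply: ler_sum => y _.
  have [->|xy] := eqVneq x y; first by rewrite !subrr mul0r expr0n mulr0.
  rewrite exprMn mulrC exprVn ler_wpM2r ?sqr_ge0 //; apply: logker_diff2_ge.
  by move=> E; case/eqP: xy; apply/val_inj.
move: le; rewrite sq.
rewrite -[X in _ <= _ * X]/(\sum_(x < B.+1) \sum_(y < B.+1) F x * F y * K x y).
move: neg; set P := \sum_(x < B.+1) F x ^+ 2 * _; set Q := \sum_(x < _) _.
set S := \sum_(x < _) _; lra.
Qed.
End DiscreteLogEnergy.

(** * Logarithms of the character ratio *)

Section LogRatio.
Variable R : realType.

Lemma ln_prod (I : Type) (r : seq I) (P : pred I) (E : I -> R) :
  (forall i, P i -> 0 < E i) ->
  ln (\prod_(i <- r | P i) E i) = \sum_(i <- r | P i) ln (E i).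
Proof.
move=> E0; elim: r => [|i r IH]; first by rewrite !big_nil ln1.
rewrite !big_cons; case: ifP => // Pi; rewrite lnM ?posrE ?IH ?E0 //.
exact: prodr_gt0.
Qed.

Lemma sum_symmetric_pairs N (g : 'I_N -> 'I_N -> R) :
  (forall i j, g i j = g j i) -> (forall i, g i i = 0) ->
  \sum_i \sum_j g i j = 2 * \sum_(i < N) \sum_(j < N | (i < j)%N) g i j.
Proof.
move=> sym diag; rewrite mulr_natl mulr2n.
have -> : \sum_i \sum_j g i j
    = \sum_(i < N) \sum_(j < N | (i < j)%N) g i j + \sum_(i < N) \sum_(j < N | (j < i)%N) g i j.
  rewrite -big_split; apply: eq_bigr => i _ /=.
  rewrite (bigID (fun j : 'I_N => (i < j)%N)) /=; congr (_ + _).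
  rewrite (bigD1 i) ?ltnn //= diag add0r; apply: eq_bigl => j.
  by rewrite -leqNgt ltn_neqAle andbC; congr (_ && _).
congr (_ + _); rewrite (exchange_big_dep predT) //=; apply: eq_bigr => i _.
by apply: eq_bigr => j _; rewrite sym.
Qed.

(** At [x = y] the convention [ln 0 = 0] makes the diagonal of every double sum vanish. *)
Definition lndist (x y : nat) : R := ln `|x%:R - y%:R|.

Lemma lndist_sym x y : lndist x y = lndist y x.
Proof. by rewrite /lndist distrC. Qed.

Lemma lndist_diag x : lndist x x = 0.
Proof. by rewrite /lndist subrr normr0 ln0. Qed.

Lemma vandermonde_gt0 N (x : 'I_N -> nat) : injective x -> 0 < vandermonde R x.
Proof.
move=> x_inj; apply: prodr_gt0 => i _; apply: prodr_gt0 => j ij.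
rewrite normr_gt0 subr_eq0 eqr_nat; apply/eqP => /x_inj E.
by rewrite E ltnn in ij.
Qed.

Lemma ln_vandermonde N (x : 'I_N -> nat) : injective x ->
  ln (vandermonde R x) = 2^-1 * \sum_i \sum_j lndist (x i) (x j).
Proof.
move=> x_inj; rewrite sum_symmetric_pairs => [|i j|i]; [|exact: lndist_sym|exact: lndist_diag].
have pos (i j : 'I_N) : (i < j)%N -> 0 < `|(x j)%:R - (x i)%:R| :> R.
  move=> ij; rewrite normr_gt0 subr_eq0 eqr_nat; apply/eqP => /x_inj E.
  by rewrite E ltnn in ij.
rewrite mulrA mulVf ?pnatr_eq0 // mul1r ln_prod => [|i _]; last first.
  by apply: prodr_gt0 => j; apply: pos.
apply: eq_bigr => i _; rewrite ln_prod => [|j]; last exact: pos.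
by apply: eq_bigr => j _; rewrite lndist_sym.
Qed.

Definition ind M (a : 'I_M -> nat) (x : nat) : R := [exists i, a i == x]%:R.

Lemma sum_ind M (a : 'I_M -> nat) (B : nat) (g : nat -> R) :
  injective a -> (forall i, a i < B)%N -> \sum_i g (a i) = \sum_(x < B) ind a x * g x.
Proof.
move=> a_inj aB; rewrite (partition_big (fun i => Ordinal (aB i)) predT) //=.
apply: eq_bigr => x _; rewrite /ind; case: existsP => [[i /eqP ix]|H].
  rewrite mul1r (bigD1 i) /=; last by apply/eqP/val_inj.
  rewrite ix big1 ?addr0 // => j /andP[/eqP /(congr1 val) /= jx ji].
  by case/eqP: ji; apply: a_inj; rewrite jx.
rewrite mul0r big1 // => i /eqP /(congr1 val) /= ix.
by case: H; exists i; rewrite ix.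
Qed.

Lemma ind_range M (a : 'I_M -> nat) x : ind a x = 0 \/ ind a x = 1.
Proof. by rewrite /ind; case: existsP; [right|left]. Qed.

(** [lnP k] and [lnQ k] are the excess of [ln (2k - 1)] and [ln (2k + 1)] over [ln (2k)]: the
    corrections for an even position against an odd one. *)
Definition lnP (k : nat) : R := ln (1 - (2 * k%:R)^-1).
Definition lnQ (k : nat) : R := ln (1 + (2 * k%:R)^-1).

Lemma lnP_le k : (0 < k)%N -> lnP k <= - (2 * k%:R)^-1.
Proof.
move=> k0; apply: le_ln1Dx; rewrite ltrN2 invf_lt1; last by rewrite mulr_gt0 ?ltr0n.
by rewrite -natrM ltr1n; lia.
Qed.

Lemma lnQ_le k : (0 < k)%N -> lnQ k <= (2 * k%:R)^-1.
Proof.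
move=> k0; apply: le_ln1Dx; apply: (@lt_le_trans _ _ 0); first by rewrite ltrN10.
by rewrite invr_ge0 mulr_ge0 ?ler0n.
Qed.

(** [(2a)! / a!^2] is the product of [4 (1 - 1/(2k))] over [1 <= k <= a]; for [(2a + 1)! / a!^2] the
    sign inside is plus. The factorials thus carry the same corrections as the distances, against
    which they partly cancel. *)
Lemma ln_fact_even a :
  ln (a.*2)`!%:R - 2 * ln a`!%:R = 2 * a%:R * ln 2 + \sum_(y < a) lnP (a - y) :> R.
Proof.
elim: a => [|a IH]; first by rewrite !fact0 ln1 big_ord0; ring.
have f0 k : 0 < k`!%:R :> R by rewrite ltr0n fact_gt0.
have p k : 0 < k.+1%:R :> R by rewrite ltr0n.
rewrite big_ord_recl /= subn0.
under eq_bigr do rewrite /bump /= add1n subSS.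
have -> : \sum_(y < a) lnP (a - y) = ln (a.*2)`!%:R - 2 * ln a`!%:R - 2 * a%:R * ln 2 :> R.
  by rewrite IH; ring.
have -> : lnP a.+1 = ln a.*2.+1%:R - ln 2 - ln a.+1%:R.
  rewrite /lnP -[a.*2.+1%:R]natr1.
  have -> : 1 - (2 * a.+1%:R)^-1 = a.*2.+1%:R / (2 * a.+1%:R) :> R.
    have := p a; rewrite -!natr1 -addnn natrD => pa; field; lra.
  rewrite lnM ?posrE ?invr_gt0 ?mulr_gt0 ?p // lnV ?posrE ?mulr_gt0 ?p //.
  rewrite lnM ?posrE ?p // natr1; ring.
rewrite doubleS !factS !natrM !lnM ?posrE ?mulr_gt0 ?p ?f0 //.
have -> : a.*2.+2%:R = 2 * a.+1%:R :> R by rewrite -doubleS -mul2n natrM.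
rewrite lnM ?posrE ?p // -[X in 2 * X * ln 2]natr1; ring.
Qed.

Lemma ln_fact_odd a :
  ln (a.*2.+1)`!%:R - 2 * ln a`!%:R = 2 * a%:R * ln 2 + \sum_(y < a) lnQ (a - y) :> R.
Proof.
elim: a => [|a IH]; first by rewrite !fact0 ln1 big_ord0; ring.
have f0 k : 0 < k`!%:R :> R by rewrite ltr0n fact_gt0.
have p k : 0 < k.+1%:R :> R by rewrite ltr0n.
rewrite big_ord_recl /= subn0.
under eq_bigr do rewrite /bump /= add1n subSS.
have -> : \sum_(y < a) lnQ (a - y) = ln (a.*2.+1)`!%:R - 2 * ln a`!%:R - 2 * a%:R * ln 2 :> R.
  by rewrite IH; ring.
have -> : lnQ a.+1 = ln a.*2.+3%:R - ln 2 - ln a.+1%:R.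
  rewrite /lnQ.
  have -> : 1 + (2 * a.+1%:R)^-1 = a.*2.+3%:R / (2 * a.+1%:R) :> R.
    have := p a; rewrite -!natr1 -addnn natrD => pa; field; lra.
  rewrite lnM ?posrE ?invr_gt0 ?mulr_gt0 ?p // lnV ?posrE ?mulr_gt0 ?p //.
  rewrite lnM ?posrE ?p //; ring.
rewrite doubleS !factS !natrM !lnM ?posrE ?mulr_gt0 ?p ?f0 //.
have -> : a.*2.+2%:R = 2 * a.+1%:R :> R by rewrite -doubleS -mul2n natrM.
rewrite lnM ?posrE ?p // -[X in 2 * X * ln 2]natr1; ring.
Qed.

Lemma central_binomial_fact m : (4 ^ m * m`! ^ 2 <= (2 * m).+1`!)%N.
Proof.
elim: m => // m IH.
have -> : (4 ^ m.+1 * m.+1`! ^ 2 = (2 * m.+1) ^ 2 * (4 ^ m * m`! ^ 2))%N.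
  rewrite expnS factS !expnMn; lia.
have -> : (2 * m.+1).+1 = (2 * m).+3 by lia.
rewrite factS [(2 * m).+2`!]factS [X in (_ <= X)%N]mulnA.
by apply: leq_mul => //; rewrite -mulnn; apply: leq_mul; lia.
Qed.

Lemma ln_central_binomial m :
  2 * ln m`!%:R + 2 * m%:R * ln 2 - ln (2 * m)`!%:R <= ln (2 * m).+1%:R :> R.
Proof.
have f0 k : 0 < k`!%:R :> R by rewrite ltr0n fact_gt0.
have E : ln ((2 * m).+1`!)%:R = ln (2 * m).+1%:R + ln (2 * m)`!%:R :> R.
  by rewrite factS natrM lnM ?posrE ?f0 ?ltr0n.
rewrite lerBlDr -E.
have -> : 2 * ln m`!%:R + 2 * m%:R * ln 2 = ln (4 ^ m * m`! ^ 2)%N%:R :> R.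
  have e4 : ln (4 ^ m)%N%:R = m%:R * (2 * ln 2) :> R.
    have -> : (4 ^ m)%N%:R = (2 : R) ^+ (2 * m) by rewrite natrX exprM; congr (_ ^+ m); ring.
    by rewrite lnXn // -[LHS]mulr_natl natrM; ring.
  have ef : ln (m`! ^ 2)%N%:R = 2 * ln m`!%:R :> R.
    by rewrite natrX lnXn ?f0 // mulr_natl.
  have p4 : 0 < (4 ^ m)%N%:R :> R by rewrite ltr0n expn_gt0.
  have pf : 0 < (m`! ^ 2)%N%:R :> R by rewrite ltr0n expn_gt0 fact_gt0.
  by rewrite natrM lnM // e4 ef; ring.
have p1 : 0 < (4 ^ m * m`! ^ 2)%N%:R :> R by rewrite ltr0n muln_gt0 !expn_gt0 fact_gt0.
by rewrite ler_ln ?posrE // ler_nat central_binomial_fact.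
Qed.

Definition harmonic_sum (B : nat) : R := \sum_(k < B) k.+1%:R^-1.

Lemma sum_inv_dist_le (B x : nat) : (x < B)%N ->
  \sum_(y < B | (y < x)%N) ((x - y)%:R^-1 : R) <= harmonic_sum B.
Proof.
move=> xB; rewrite /harmonic_sum.
rewrite -(big_ord_widen B (fun y => ((x - y)%:R^-1 : R)) (ltnW xB)).
rewrite (reindex_inj rev_ord_inj) /=.
apply: (@le_trans _ _ (\sum_(k < x) k.+1%:R^-1)).
  by apply: ler_sum => k _; rewrite subnBA ?ltn_ord // addKn.
rewrite (big_ord_widen B (fun k => (k.+1%:R^-1 : R)) (ltnW xB)).
rewrite big_mkcond; by apply: ler_sum => k _; case: ifP.
Qed.
End LogRatio.

Section LogRatioBound.
Variable R : realType.
Local Notation lndist := (@lndist R).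
Local Notation lnP := (lnP R).
Local Notation lnQ := (lnQ R).

Lemma lndist_double x y : lndist x.*2 y.*2 = (x != y)%:R * ln 2 + lndist x y.
Proof.
have [->|xy] := eqVneq x y; first by rewrite !lndist_diag mul0r addr0.
rewrite mul1r /lndist -!muln2 !natrM -mulrBl normrM lnM ?posrE ?normr_gt0 ?subr_eq0 ?eqr_nat //.
by rewrite normr_nat addrC.
Qed.

Lemma lndist_doubleS x y : lndist x.*2.+1 y.*2.+1 = (x != y)%:R * ln 2 + lndist x y.
Proof.
rewrite -lndist_double /lndist -[x.*2.+1%:R]natr1 -[y.*2.+1%:R]natr1.
by congr (ln `| _ |); ring.
Qed.

Lemma lndist_even_odd x y :
  lndist x.*2 y.*2.+1 = (x != y)%:R * ln 2 + lndist x y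
    + ((y < x)%N%:R * lnP (x - y) + (x < y)%N%:R * lnQ (y - x)).
Proof.
have dbl (k : nat) : k.*2%:R = 2 * k%:R :> R by rewrite -mul2n natrM.
rewrite /lndist -[y.*2.+1%:R]natr1 !dbl.
case: (ltngtP x y) => [lt|lt|->]; rewrite /= ?mulr0n ?mulr1n ?mul0r ?mul1r ?addr0 ?add0r; last first.
- have -> : 2 * y%:R - (2 * y%:R + 1) = - 1 :> R by ring.
  by rewrite normrN1 ln1 subrr normr0 ln0.
- have pos : 1 <= x%:R - y%:R :> R by rewrite -natrB ?(ltnW lt) // ler1n subn_gt0.
  rewrite /lnP natrB ?(ltnW lt) //.
  set t := x%:R - y%:R in pos *.
  have -> : 2 * x%:R - (2 * y%:R + 1) = (2 * t) * (1 - (2 * t)^-1) :> R.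
    by rewrite /t; field; apply: lt0r_neq0; move: pos; rewrite /t; lra.
  have h : (2 * t)^-1 <= 2^-1 by rewrite lef_pV2 ?posrE; lra.
  rewrite ger0_norm; last by apply: mulr_ge0; lra.
  by rewrite [`|t|]ger0_norm ?lnM ?posrE //; lra.
have pos : 1 <= y%:R - x%:R :> R by rewrite -natrB ?(ltnW lt) // ler1n subn_gt0.
rewrite /lnQ natrB ?(ltnW lt) //.
rewrite distrC [`|x%:R - _|]distrC.
set t := y%:R - x%:R in pos *.
have -> : 2 * y%:R + 1 - 2 * x%:R = (2 * t) * (1 + (2 * t)^-1) :> R.
  by rewrite /t; field; apply: lt0r_neq0; move: pos; rewrite /t; lra.
have h : 0 < (2 * t)^-1 by rewrite invr_gt0; lra.
rewrite ger0_norm; last by apply: mulr_ge0; lra.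
by rewrite [`|t|]ger0_norm ?lnM ?posrE //; lra.
Qed.

Lemma sum_ind2 M (a b : 'I_M -> nat) B (g : nat -> nat -> R) :
  injective a -> injective b -> (forall i, a i < B)%N -> (forall i, b i < B)%N ->
  \sum_i \sum_j g (a i) (b j) = \sum_(x < B) \sum_(y < B) ind R a x * ind R b y * g x y.
Proof.
move=> a_inj b_inj aB bB; rewrite (sum_ind (fun x => \sum_j g x (b j)) a_inj aB).
apply: eq_bigr => x _; rewrite (sum_ind (g x) b_inj bB) mulr_sumr.
by apply: eq_bigr => y _; rewrite mulrA.
Qed.

Lemma sum_neq_inj M (a : 'I_M -> nat) : injective a ->
  \sum_i \sum_j (a i != a j)%:R = M%:R * (M%:R - 1) :> R.
Proof.
move=> a_inj; have row i : \sum_j (a i != a j)%:R = M%:R - 1 :> R.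
  rewrite (bigD1 i) //= eqxx add0r (eq_bigr (fun=> 1)) => [|j ji].
    rewrite sumr_const (cardC1 i) card_ord -subn1 natrB //.
    exact: leq_ltn_trans (ltn_ord i).
  by rewrite (inj_eq a_inj) eq_sym ji.
by rewrite (eq_bigr (fun=> M%:R - 1)) // sumr_const card_ord mulr_natl.
Qed.

Lemma sum_neq_ge M (a b : 'I_M -> nat) : injective b ->
  M%:R * (M%:R - 1) <= \sum_i \sum_j (a i != b j)%:R :> R.
Proof.
move=> b_inj; have row i : M%:R - 1 <= \sum_j (a i != b j)%:R :> R.
  have : (\sum_j (a i == b j) <= 1)%N.
    case: (pickP [pred j | a i == b j]) => [j0 /= /eqP j0P|none].
      rewrite (bigD1 j0) //= j0P eqxx big1 // => j jj.
      by rewrite (inj_eq b_inj) eq_sym (negbTE jj).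
    by rewrite big1 // => j _; have := none j => /= ->.
  rewrite -(ler_nat R) natr_sum => le1.
  have -> : \sum_j (a i != b j)%:R = M%:R - \sum_j (a i == b j)%:R :> R.
    rewrite -[X in X%:R - _](card_ord M) -sum1_card natr_sum -sumrB.
    by apply: eq_bigr => j _; case: (a i == b j); rewrite ?subrr ?subr0.
  by rewrite lerB.
apply: (@le_trans _ _ (\sum_(i < M) (M%:R - 1))); last exact: ler_sum.
by rewrite sumr_const card_ord mulr_natl.
Qed.

Definition ind_diff M (a b : 'I_M -> nat) (x : nat) : R := ind R a x - ind R b x.

(** If both charges vanish, [lnP] and [lnQ] occur together or not at all, and their sum is
    nonpositive. Otherwise a lone [lnQ] costs at most [1 / (2 (x - y))], charged to a position where
    the indicators differ. *)
Lemma correction_term_le M (a b : 'I_M -> nat) (x y : nat) : (y < x)%N ->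
  ind R a x * (1 - ind R b y) * lnP (x - y) + ind R b x * (1 - ind R a y) * lnQ (x - y)
  <= (`|ind_diff a b x| + `|ind_diff a b y|) * (2^-1 * (x - y)%:R^-1).
Proof.
move=> yx; have k0 : (0 < x - y)%N by rewrite subn_gt0.
have := lnP_le R k0; have := lnQ_le R k0; rewrite invfM.
have t0 : 0 <= (2^-1 * (x - y)%:R^-1 : R) by rewrite mulr_ge0 ?invr_ge0 ?ler0n.
set t := 2^-1 * _ in t0 *; rewrite /ind_diff.
have n1 : `|0 - 1| = 1 :> R by rewrite sub0r normrN1.
have n2 : `|1 - 0| = 1 :> R by rewrite subr0 normr1.
move=> q p.
by case: (ind_range R a x) => ->; case: (ind_range R b x) => ->;
  case: (ind_range R a y) => ->; case: (ind_range R b y) => ->;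
  rewrite ?n1 ?n2 ?subrr ?normr0; lra.
Qed.

(** A charged position has at most one neighbour on each side at every distance; the two sides use
    up the factor [2^-1]. *)
Lemma sum_correction_le M (a b : 'I_M -> nat) (B : nat) :
  \sum_(x < B) \sum_(y < B | (y < x)%N)
    (ind R a x * (1 - ind R b y) * lnP (x - y) + ind R b x * (1 - ind R a y) * lnQ (x - y))
  <= (\sum_(x < B) `|ind_diff a b x|) * harmonic_sum R B.
Proof.
set f := ind_diff a b.
apply: (@le_trans _ _ (\sum_(x < B) \sum_(y < B | (y < x)%N)
   (`|f x| + `|f y|) * (2^-1 * (x - y)%:R^-1))).
  by apply: ler_sum => x _; apply: ler_sum => y yx; apply: correction_term_le.
have H0 : 0 <= harmonic_sum R B by apply: sumr_ge0 => k _; rewrite invr_ge0 ler0n.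
have -> : \sum_(x < B) \sum_(y < B | (y < x)%N) (`|f x| + `|f y|) * (2^-1 * (x - y)%:R^-1)
  = \sum_(x < B) `|f x| * (2^-1 * \sum_(y < B | (y < x)%N) (x - y)%:R^-1)
  + \sum_(y < B) `|f y| * (2^-1 * \sum_(x < B | (y < x)%N) (x - y)%:R^-1).
  transitivity (\sum_(x < B) \sum_(y < B | (y < x)%N) `|f x| * (2^-1 * (x - y)%:R^-1)
    + \sum_(x < B) \sum_(y < B | (y < x)%N) `|f y| * (2^-1 * (x - y)%:R^-1)).
    by rewrite -big_split; apply: eq_bigr => x _; rewrite -big_split; apply: eq_bigr => y _ /=; rewrite mulrDl.
  congr (_ + _); first by apply: eq_bigr => x _; rewrite !mulr_sumr.
  rewrite (exchange_big_dep predT) //=; apply: eq_bigr => y _; by rewrite !mulr_sumr.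
have up y : \sum_(x < B | (y < x)%N) (x - y)%:R^-1 <= harmonic_sum R B.
  have -> : \sum_(x < B | (y < x)%N) (x - y)%:R^-1
      = \sum_(x < B | (B - x.+1 < B - y.+1)%N) ((B - y.+1) - (B - x.+1))%:R^-1 :> R.
    apply: eq_big => [x|x yx]; first by have := ltn_ord x; lia.
    by congr (_%:R^-1); have := ltn_ord x; lia.
  rewrite (reindex_inj rev_ord_inj) /=.
  have rr (x : 'I_B) : (B - (B - x.+1).+1 = x)%N by have := ltn_ord x; lia.
  under eq_bigl => x do rewrite rr.
  under eq_bigr => x _ do rewrite rr.
  have [B0|B0] := posnP B.
    by rewrite big1 // => x; have := ltn_ord x; rewrite [X in (_ < X)%N]B0.
  by apply: sum_inv_dist_le; lia.
rewrite mulr_suml -big_split; apply: ler_sum => x _ /=; rewrite -mulrDr.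
apply: ler_wpM2l; first exact: normr_ge0.
have := sum_inv_dist_le R (ltn_ord x); have := up x; lra.
Qed.

(** The left side is [ln (chi^2 / dim)] for the even beads [2a] and odd beads [2b + 1]. The
    condition on the sums makes the powers of 2 cancel, up to the factor [2m + 1] of the central
    binomial and coincidences between [a] and [b], which have the favourable sign. The quadratic
    terms leave half the sum over [ind_diff]. *)
Lemma ln_ratio_le (M m B : nat) (a b : 'I_M -> nat) :
  injective a -> injective b -> (forall i, a i < B)%N -> (forall i, b i < B)%N ->
  (\sum_i a i + \sum_i b i + M = m + M * M)%N ->
  2 * ln m`!%:R - ln (2 * m)`!%:R + 2 * ln (vandermonde R a) + 2 * ln (vandermonde R b)
  - 2 * (\sum_i ln (a i)`!%:R) - 2 * (\sum_i ln (b i)`!%:R)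
  + (\sum_i ln ((a i).*2)`!%:R) + (\sum_i ln ((b i).*2.+1)`!%:R)
  - 2^-1 * ((\sum_i \sum_j lndist (a i).*2 (a j).*2)
     + (\sum_i \sum_j lndist (b i).*2.+1 (b j).*2.+1)
     + 2 * \sum_i \sum_j lndist (a i).*2 (b j).*2.+1)
  <= ln (2 * m).+1%:R + 2^-1 * (\sum_(x < B) \sum_(y < B) ind_diff a b x * ind_diff a b y * lndist x y)
     + (\sum_(x < B) `|ind_diff a b x|) * harmonic_sum R B.
Proof.
move=> a_inj b_inj aB bB sumab; set f := ind_diff a b.
rewrite !ln_vandermonde //.
set SA := \sum_i \sum_j lndist (a i) (a j); set SB := \sum_i \sum_j lndist (b i) (b j).
pose D := \sum_i \sum_j lndist (a i) (b j).
pose n2 := \sum_i \sum_j (a i != b j)%:R : R.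
have -> : \sum_i \sum_j lndist (a i).*2 (a j).*2 = M%:R * (M%:R - 1) * ln 2 + SA.
  rewrite -(sum_neq_inj a_inj) mulr_suml -big_split; apply: eq_bigr => i _ /=.
  by rewrite mulr_suml -big_split; apply: eq_bigr => j _; rewrite lndist_double.
have -> : \sum_i \sum_j lndist (b i).*2.+1 (b j).*2.+1 = M%:R * (M%:R - 1) * ln 2 + SB.
  rewrite -(sum_neq_inj b_inj) mulr_suml -big_split; apply: eq_bigr => i _ /=.
  by rewrite mulr_suml -big_split; apply: eq_bigr => j _; rewrite lndist_doubleS.
pose PP := \sum_i \sum_j (b j < a i)%N%:R * lnP (a i - b j).
pose QQ := \sum_i \sum_j (a i < b j)%N%:R * lnQ (b j - a i).
have -> : \sum_i \sum_j lndist (a i).*2 (b j).*2.+1 = n2 * ln 2 + D + (PP + QQ).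
  rewrite /n2 mulr_suml /D /PP /QQ -!big_split; apply: eq_bigr => i _ /=.
  by rewrite mulr_suml -!big_split; apply: eq_bigr => j _; rewrite lndist_even_odd.
have fa : \sum_i ln ((a i).*2)`!%:R = 2 * (\sum_i ln (a i)`!%:R)
    + 2 * (\sum_i a i)%:R * ln 2 + \sum_i \sum_(y < a i) lnP (a i - y).
  rewrite natr_sum !mulr_sumr mulr_suml -!big_split; apply: eq_bigr => i _ /=.
  by rewrite -addrA -ln_fact_even addrC subrK.
have fb : \sum_i ln ((b i).*2.+1)`!%:R = 2 * (\sum_i ln (b i)`!%:R)
    + 2 * (\sum_i b i)%:R * ln 2 + \sum_i \sum_(y < b i) lnQ (b i - y).
  rewrite natr_sum !mulr_sumr mulr_suml -!big_split; apply: eq_bigr => i _ /=.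
  by rewrite -addrA -ln_fact_odd addrC subrK.
have energy : \sum_(x < B) \sum_(y < B) f x * f y * lndist x y = SA + SB - 2 * D.
  have D' : D = \sum_(x < B) \sum_(y < B) ind R b x * ind R a y * lndist x y.
    rewrite /D (sum_ind2 lndist a_inj b_inj aB bB) exchange_big; apply: eq_bigr => x _.
    by apply: eq_bigr => y _; rewrite lndist_sym [ind R a _ * _]mulrC.
  rewrite mulr_natl mulr2n {1}D' /D /SA /SB (sum_ind2 lndist a_inj b_inj aB bB)
    (sum_ind2 lndist a_inj a_inj aB aB) (sum_ind2 lndist b_inj b_inj bB bB) -!big_split -sumrB.
  apply: eq_bigr => x _ /=; rewrite -!big_split -sumrB; apply: eq_bigr => y _ /=.
  rewrite /f /ind_diff; ring.
(* The factorials correct for every position below a bead, the distances only for positions holding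
   a bead of the other parity; the difference is supported on the positions without one. *)
have corr : (\sum_i \sum_(y < a i) lnP (a i - y) - PP) + (\sum_i \sum_(y < b i) lnQ (b i - y) - QQ)
  = \sum_(x < B) \sum_(y < B | (y < x)%N)
    (ind R a x * (1 - ind R b y) * lnP (x - y) + ind R b x * (1 - ind R a y) * lnQ (x - y)).
  have tri (u v : 'I_M -> nat) (k : nat -> R) : injective u -> injective v ->
      (forall i, u i < B)%N -> (forall i, v i < B)%N ->
      \sum_i \sum_(y < u i) k (u i - y)%N - \sum_i \sum_j (v j < u i)%N%:R * k (u i - v j)%N
      = \sum_(x < B) \sum_(y < B | (y < x)%N) ind R u x * (1 - ind R v y) * k (x - y)%N.
    move=> u_inj v_inj uB vB.
    rewrite (sum_ind (fun x => \sum_(y < x) k (x - y)%N) u_inj uB).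
    rewrite (sum_ind2 (fun x y => (y < x)%N%:R * k (x - y)%N) u_inj v_inj uB vB) -sumrB.
    apply: eq_bigr => x _; rewrite (big_ord_widen B (fun y => k (x - y)%N)) ?(ltnW (ltn_ord x)) //.
    rewrite mulr_sumr [X in X - _]big_mkcond -sumrB [RHS]big_mkcond; apply: eq_bigr => y _ /=.
    by case: (y < x)%N; rewrite /=; ring.
  have QQ' : QQ = \sum_i \sum_j (a j < b i)%N%:R * lnQ (b i - a j) by rewrite /QQ exchange_big.
  rewrite QQ' !tri // -big_split; apply: eq_bigr => x _ /=.
  by rewrite -big_split.
have := sum_correction_le a b B; rewrite -corr -/f energy fa fb.
have := sum_neq_ge a b_inj; rewrite -/n2.
have := ln_central_binomial R m.
have ln2 : 0 <= ln 2 :> R by rewrite ln_ge0 // ler1n.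
have sumR : (\sum_i a i)%:R + (\sum_i b i)%:R + M%:R = m%:R + M%:R * M%:R :> R.
  by rewrite -natrM -!natrD sumab.
set H := harmonic_sum R B; set S := \sum_(x < B) _; set n2' := n2.
set TP := \sum_i \sum_(y < a i) _; set TQ := \sum_i \sum_(y < b i) _.
set FA := \sum_i ln _; set FB := \sum_i ln _.
move=> cb nge cor.
have nge2 : M%:R * (M%:R - 1) * ln 2 <= n2' * ln 2 by apply: ler_wpM2r.
have e1 : 2 * (\sum_i a i)%:R * ln 2 + 2 * (\sum_i b i)%:R * ln 2
   = 2 * m%:R * ln 2 + 2 * (M%:R * (M%:R - 1) * ln 2) :> R.
  have -> : (\sum_i a i)%:R = m%:R + M%:R * M%:R - M%:R - (\sum_i b i)%:R :> R.
    by move: sumR; lra.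
  ring.
move: cor cb nge2 e1; set c1 := 2 * (\sum_i a i)%:R * ln 2; set c2 := 2 * (\sum_i b i)%:R * ln 2.
set c3 := 2 * m%:R * ln 2; set c4 := M%:R * (M%:R - 1) * ln 2; set c5 := n2' * ln 2.
set c6 := S * H; lra.
Qed.
End LogRatioBound.

(** * Energy on enlarged windows, and the Durfee square *)

Section ShiftedEnergy.
Variable R : realType.

Definition log_energy (f : nat -> R) (B : nat) : R :=
  - 2^-1 * (\sum_(x < B) \sum_(y < B) f x * f y * ln `|x%:R - y%:R|)
  + \sum_(x < B) f x ^+ 2.

Lemma sum_shift (g : nat -> R) (B K : nat) :
  (forall x, (x < K)%N || (K + B <= x)%N -> g x = 0) ->
  \sum_(x < B + K.*2) g x = \sum_(x < B) g (x + K)%N.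
Proof.
move=> g0; have -> : (B + K.*2 = K + B + K)%N by lia.
rewrite !big_split_ord /= [X in X + _ + _]big1 => [|x _]; last by rewrite g0 // ltn_ord.
rewrite [X in _ + X]big1 => [|x _]; last by rewrite g0 // leq_addr orbT.
by rewrite add0r addr0; apply: eq_bigr => x _; rewrite addnC.
Qed.

(** Padding [f] with [K] zeros on both sides does not change its energy, so one bound holds for all
    windows and survives their growth to the whole line. *)
Lemma shifted_energy_le (f : nat -> R) (B K : nat) :
  (forall x, (B <= x)%N -> f x = 0) -> partial_sum f B = 0 ->
  4^-1 * \sum_(x < (B + K.*2).+1) \sum_(y < (B + K.*2).+1)
      ((partial_sum f (x - K) - partial_sum f (y - K)) / (x%:R - y%:R)) ^+ 2
  <= log_energy f B.
Proof.
move=> fB FB; pose fK x := if (K <= x)%N then f (x - K)%N else 0.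
have fK0 x : (x < K)%N || (K + B <= x)%N -> fK x = 0.
  by rewrite /fK; case: leqP => //= Kx H; rewrite fB //; lia.
have fKE x : fK (x + K)%N = f x by rewrite /fK leq_addl addnK.
have FK x : partial_sum fK x = partial_sum f (x - K).
  elim: x => [|x IH]; first by rewrite /partial_sum sub0n !big_ord0.
  rewrite {1}/partial_sum big_ord_recr /= -/(partial_sum fK x) IH /fK.
  case: leqP => Kx; last first.
    by rewrite addr0 (_ : (x.+1 - K = x - K)%N) //; lia.
  by rewrite subSn // [RHS]/partial_sum big_ord_recr.
have Fbig x : (B <= x)%N -> partial_sum f x = 0.
  move=> Bx; rewrite -(subnKC Bx) /partial_sum big_split_ord /= -/(partial_sum f B) FB add0r.
  by rewrite big1 // => y _; rewrite fB // leq_addr.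
have le := @discrete_energy_le R fK (B + K.*2).
have {le} := le (etrans (FK _) (Fbig _ _)).
move=> /(_ ltac:(lia)) le.
have -> : log_energy f B = - 2^-1 * (\sum_(x < B + K.*2) \sum_(y < B + K.*2)
      fK x * fK y * ln `|x%:R - y%:R|) + \sum_(x < B + K.*2) fK x ^+ 2.
  rewrite /log_energy; congr (_ * _ + _).
    rewrite (sum_shift (g := fun x => \sum_(y < B + K.*2) fK x * fK y * ln `|x%:R - y%:R|)).
      apply: eq_bigr => x _.
      rewrite (sum_shift (g := fun y => fK (x + K)%N * fK y * ln `|(x + K)%:R - y%:R|)).
        apply: eq_bigr => y _; rewrite !fKE; congr (_ * ln `| _ |).
        by rewrite !natrD; ring.
      by move=> y /fK0 ->; rewrite mulr0 mul0r.
    by move=> x /fK0 x0; rewrite big1 // => y _; rewrite x0 !mul0r.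
  rewrite (sum_shift (g := fun x => fK x ^+ 2)); first by apply: eq_bigr => x _; rewrite fKE.
  by move=> x /fK0 ->; rewrite expr0n.
apply: le_trans le; rewrite le_eqVlt; apply/orP; left; apply/eqP; congr (_ * _).
by apply: eq_bigr => x _; apply: eq_bigr => y _; rewrite !FK.
Qed.
End ShiftedEnergy.

(** The side of the Durfee square. Its rows are those whose bead, [part la i + (N - i.+1)], is at
    least [N]. *)
Definition durfee (la : seq nat) (N : nat) : nat := #|[pred i : 'I_N | (i < part la i)%N]|.

Lemma durfee_sqr_le (la : seq nat) (N : nat) : is_part la -> (size la <= N)%N ->
  (durfee la N ^ 2 <= sumn la)%N.
Proof.
move=> la_part laN; rewrite /durfee; set D := [pred i : 'I_N | _].
have [->//|d0] := posnP #|D|.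
have [i0 i0D] : exists i, i \in D by apply/existsP; rewrite -[X in is_true X]negbK negb_exists;
  apply/negP => /forallP H; move: d0; rewrite eq_card0 // => i; apply/negbTE; apply: H.
have [j jD jmax] := @arg_maxnP _ i0 (mem D) (fun i => i : nat) i0D.
have dj : (#|D| <= j.+1)%N.
  apply: (card_le_injective_bound (f := fun i : 'I_N => i : nat)) => [x y _ _ /val_inj//|x xD].
  by rewrite ltnS; apply: jmax.
have big i : i \in D -> (#|D| <= part la i)%N.
  move=> iD; apply: leq_trans (part_decr la_part (jmax i iD)).
  exact: leq_trans dj jD.
have -> : sumn la = (\sum_(i < N) part la i)%N.
  rewrite sumnE (big_nth 0%N) big_mkord (big_ord_widen N (fun i => nth 0%N la i) laN).
  rewrite big_mkcond; apply: eq_bigr => i _; case: ltnP => // sz.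
  by rewrite /part nth_default.
rewrite (bigID (mem D)) /= -mulnn -sum_nat_const; apply: leq_trans (leq_addr _ _).
by apply: leq_sum => i; apply: big.
Qed.

(** * The 2-abacus *)

Lemma sum_ord_double M : (\sum_(i < M + M) i + M = 2 * (M * M))%N.
Proof.
elim: M => [|M IH]; first by rewrite big_ord0.
have -> : (M.+1 + M.+1 = (M + M).+2)%N by lia.
by rewrite !big_ord_recr /=; move: IH; set X := (\sum_(i < M + M) i)%N; lia.
Qed.

Section Abacus.
Variables (R : realType) (la : seq nat) (m M B : nat).
Hypotheses (la_part : is_part la) (la_size : (size la <= M + M)%N) (la_sum : sumn la = (2 * m)%N).
Hypothesis (B_big : forall i : 'I_(M + M), (beads la (M + M) i < B.*2)%N).
Let l (i : 'I_(M + M)) : nat := beads la (M + M) i.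

Definition bead_ind (c x : nat) : R := [exists i : 'I_(M + M), beads la (M + M) i == (x.*2 + c)%N]%:R.
Definition bead_charge (x : nat) : R := bead_ind 0 x - bead_ind 1 x.

Let l_inj : injective l.
Proof.
move=> i j E; apply/val_inj; case: (ltngtP i j) => // lt.
  by have := beads_decr la_part lt (ltn_ord j); rewrite -/(l i) -/(l j) E ltnn.
by have := beads_decr la_part lt (ltn_ord i); rewrite -/(l i) -/(l j) E ltnn.
Qed.

Lemma sum_bead_ind c : (c < 2)%N ->
  \sum_(x < B) bead_ind c x = #|[pred i | odd (l i) == (c == 1)%N]|%:R.
Proof.
move=> c2; have lc i : odd (l i) == (c == 1)%N -> l i = (((l i)./2).*2 + c)%N.
  by move/eqP => o; rewrite -{1}(odd_double_half (l i)) o addnC; case: c c2 o => [|[]].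
have lB i : ((l i)./2 < B)%N by have := B_big i; rewrite -/(l i); lia.
rewrite -sum1_card natr_sum (partition_big (fun i => Ordinal (lB i)) predT) //=.
apply: eq_bigr => x _; rewrite /bead_ind; case: existsP => [[i /eqP ix]|H].
  have lix : l i = (x.*2 + c)%N := ix.
  rewrite (bigD1 i) /=; last first.
    apply/andP; split; last by apply/eqP/val_inj; rewrite /= lix; lia.
    by rewrite inE lix oddD odd_double addFb; case: c c2 {lc lix ix} => [|[]].
  rewrite big1 ?addr0 // => j /andP[/andP[jc /eqP /(congr1 val) /= jx] ji].
  by case/eqP: ji; apply: l_inj; rewrite (lc j jc) jx /l ix.
rewrite big1 // => i /andP[ic /eqP /(congr1 val) /= ix].
by case: H; exists i; rewrite -/(l i) (lc i ic) ix.
Qed.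

(** Zero total charge means as many even as odd beads, hence [M] of each; [s] lists the even ones
    first. *)
Lemma abacus_split : \sum_(x < B) bead_charge x = 0 ->
  exists (s : 'S_(M + M)) (a b : 'I_M -> nat),
  [/\ forall i, l (s (lshift M i)) = (a i).*2, forall i, l (s (rshift M i)) = (b i).*2.+1,
      forall x, ind R a x = bead_ind 0 x & forall x, ind R b x = bead_ind 1 x].
Proof.
rewrite sumrB !sum_bead_ind // => /eqP; rewrite subr_eq0 eqr_nat => /eqP E01.
set E := [pred i | odd (l i) == _] in E01; set O := [pred i | odd (l i) == _] in E01.
have EO : (#|E| + #|O| = M + M)%N.
  rewrite -[RHS]card_ord -[RHS](cardID E); congr (_ + _)%N; apply: eq_card => i;
  rewrite !inE ?andbT //; by case: (odd (l i)).
have cE : #|E| = M by lia.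
have cO : #|O| = M by lia.
pose s0 (i : 'I_(M + M)) : 'I_(M + M) := match fintype.split i with
  | inl j => enum_val (cast_ord (esym cE) j) | inr j => enum_val (cast_ord (esym cO) j) end.
have s0l j : s0 (lshift M j) = enum_val (cast_ord (esym cE) j) by rewrite /s0 (unsplitK (inl j)).
have s0r j : s0 (rshift M j) = enum_val (cast_ord (esym cO) j) by rewrite /s0 (unsplitK (inr j)).
have oE j : odd (l (s0 (lshift M j))) = false.
  by rewrite s0l; have := enum_valP (cast_ord (esym cE) j); rewrite !inE => /eqP.
have oO j : odd (l (s0 (rshift M j))) = true.
  by rewrite s0r; have := enum_valP (cast_ord (esym cO) j); rewrite !inE => /eqP.
have s0_inj : injective s0.
  move=> i j; case: (split_ordP i) => i' ->; case: (split_ordP j) => j' -> e.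
  - by move: e; rewrite !s0l => /enum_val_inj/cast_ord_inj ->.
  - by have := oE i'; rewrite e oO.
  - by have := oO i'; rewrite e oE.
  - by move: e; rewrite !s0r => /enum_val_inj/cast_ord_inj ->.
pose s := perm s0_inj.
pose a j := (l (s0 (lshift M j)))./2; pose b j := (l (s0 (rshift M j)))./2.
have la' j : l (s0 (lshift M j)) = (a j).*2.
  by rewrite -[LHS]odd_double_half oE add0n.
have lb' j : l (s0 (rshift M j)) = (b j).*2.+1.
  by rewrite -[LHS]odd_double_half oO add1n.
have surj i : exists k, i = s0 k by exists ((s^-1)%g i); rewrite -[s0 _](permE s0_inj) permKV.
exists s, a, b; split=> [i|i|x|x]; rewrite ?permE //.
  rewrite /ind /bead_ind addn0; congr (nat_of_bool _)%:R; apply/existsP/existsP => [[j /eqP <-]|[i /eqP]].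
    by exists (s0 (lshift M j)); rewrite -/(l _) la'.
  rewrite -/(l i); have [k ->] := surj i; case: (split_ordP k) => j ->.
    by rewrite la' => /double_inj ajx; exists j; rewrite ajx.
  by move=> e; have := oO j; rewrite e odd_double.
rewrite /ind /bead_ind addn1; congr (nat_of_bool _)%:R; apply/existsP/existsP => [[j /eqP <-]|[i /eqP]].
  by exists (s0 (rshift M j)); rewrite -/(l _) lb'.
rewrite -/(l i); have [k ->] := surj i; case: (split_ordP k) => j ->.
  by move=> e; have := oE j; rewrite e oddS odd_double.
by rewrite lb' => -[/double_inj bjx]; exists j; rewrite bjx.
Qed.

Hypothesis charge0 : \sum_(x < B) bead_charge x = 0.
Hypothesis M_le_B : (M <= B)%N.

(** Each runner is compared with the vacuum, where positions below [M] are filled; its distance to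
    it is twice the number of its beads at [M] or beyond. On both runners together these are the
    beads at least [M + M], one for each row counted by [durfee]. *)
Lemma sum_abs_charge_le : \sum_(x < B) `|bead_charge x| <= 2 * (durfee la (M + M))%:R.
Proof.
have [s [a [b [la_s lb_s aE bE]]]] := abacus_split charge0.
pose vac (x : nat) : R := (x < M)%N%:R.
have inj_a : injective a.
  by move=> i j e; have := la_s i; rewrite e -la_s => /l_inj/perm_inj/lshift_inj.
have inj_b : injective b.
  by move=> i j e; have := lb_s i; rewrite e -lb_s => /l_inj/perm_inj/rshift_inj.
have aB i : (a i < B)%N by rewrite -ltn_double -la_s; apply: B_big.
have bB i : (b i < B)%N by rewrite -ltn_double; apply: leq_trans (B_big (s (rshift M i))); rewrite -/(l _) lb_s.
have sum_vac : \sum_(x < B) vac x = M%:R.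
  rewrite -[in RHS](card_ord M) -sum1_card natr_sum (big_ord_widen B (fun=> 1) M_le_B).
  by rewrite [RHS]big_mkcond; apply: eq_bigr => x _; rewrite /vac; case: (x < M)%N.
have dist_vac (u : 'I_M -> nat) : injective u -> (forall i, u i < B)%N ->
    \sum_(x < B) `|ind R u x - vac x| = 2 * M%:R - 2 * \sum_i (u i < M)%N%:R.
  move=> u_inj uB; rewrite (sum_ind vac u_inj uB).
  have sum_u : \sum_(x < B) ind R u x = M%:R.
    transitivity (\sum_(i < M) (1 : R)); last by rewrite sumr_const card_ord.
    by rewrite (sum_ind (fun=> 1) u_inj uB); apply: eq_bigr => x _; rewrite mulr1.
  have -> : 2 * M%:R = \sum_(x < B) (ind R u x + vac x) by rewrite big_split /= sum_u sum_vac; ring.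
  rewrite mulr_sumr -sumrB; apply: eq_bigr => x _.
  have n1 : `|0 - 1| = 1 :> R by rewrite sub0r normrN1.
  by rewrite /vac; case: (ind_range R u x) => ->; case: (x < M)%N; rewrite /= ?mulr1n ?mulr0n
    ?n1 ?subrr ?normr0 ?subr0 ?normr1; ring.
apply: (@le_trans _ _ (\sum_(x < B) (`|ind R a x - vac x| + `|ind R b x - vac x|))).
  apply: ler_sum => x _; rewrite /bead_charge -aE -bE.
  have -> : ind R a x - ind R b x = (ind R a x - vac x) - (ind R b x - vac x) by ring.
  exact: ler_normB.
rewrite big_split /= !dist_vac //.
have tot : \sum_i (a i < M)%N%:R + \sum_i (b i < M)%N%:R
    = (M + M)%:R - (durfee la (M + M))%:R :> R.
  transitivity (\sum_i (l i < M + M)%N%:R : R).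
    rewrite (reindex_inj (@perm_inj _ s)) big_split_ord /=.
    by congr (_ + _); apply: eq_bigr => i _; rewrite ?la_s ?lb_s; congr (nat_of_bool _)%:R; lia.
  have -> : (M + M)%:R = \sum_(i < M + M) (1 : R) by rewrite sumr_const card_ord.
  have -> : (durfee la (M + M))%:R = \sum_(i < M + M) (i < part la i)%N%:R :> R.
    rewrite /durfee -sum1_card natr_sum big_mkcond; apply: eq_bigr => i _; rewrite inE.
    by case: (i < part la i)%N.
  rewrite -sumrB; apply: eq_bigr => i _.
  have -> : (l i < M + M)%N = ~~ (i < part la i)%N by rewrite /l /beads; have := ltn_ord i; lia.
  by case: (i < part la i)%N; rewrite /= ?subrr ?subr0.
by move: tot; rewrite natrD; lra.
Qed.

Lemma ln_specht_ratio_le (g : 'S_(sumn la)) : g \in cycle_class (sumn la) (nseq m 2) ->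
  ln (specht_char R g ^+ 2 / (specht_dim R la)%:R) <=
  ln (2 * m).+1%:R - log_energy bead_charge B
  + (\sum_(x < B) `|bead_charge x|) * (harmonic_sum R B + 1).
Proof.
move=> gC; have [s [a [b [la_s lb_s aE bE]]]] := abacus_split charge0.
have inj_a : injective a.
  by move=> i j e; have := la_s i; rewrite e -la_s => /l_inj/perm_inj/lshift_inj.
have inj_b : injective b.
  by move=> i j e; have := lb_s i; rewrite e -lb_s => /l_inj/perm_inj/rshift_inj.
have aB i : (a i < B)%N by rewrite -ltn_double -la_s; apply: B_big.
have bB i : (b i < B)%N by rewrite -ltn_double; apply: leq_trans (B_big (s (rshift M i))); rewrite -/(l _) lb_s.
have fE x : bead_charge x = ind_diff R a b x by rewrite /ind_diff aE bE.
have f0 k : 0 < k`!%:R :> R by rewrite ltr0n fact_gt0.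
have pf (N : nat) (u : 'I_N -> nat) : 0 < \prod_i (u i)`!%:R :> R by apply: prodr_gt0.
have lnf (N : nat) (u : 'I_N -> nat) : ln (\prod_i (u i)`!%:R) = \sum_i ln (u i)`!%:R :> R.
  by apply: ln_prod.
have sum_ab : (\sum_i a i + \sum_i b i + M = m + M * M)%N.
  have := sum_beads_part la_part la_size; rewrite -/l la_sum.
  rewrite (reindex_inj (@perm_inj _ s)) big_split_ord /=.
  have -> : (\sum_(i < M) l (s (lshift M i)) = 2 * \sum_i a i)%N.
    by rewrite big_distrr; apply: eq_bigr => i _; rewrite la_s; apply/esym/mul2n.
  have -> : (\sum_(i < M) l (s (rshift M i)) = M + 2 * \sum_i b i)%N.
    transitivity (\sum_(i < M) (1 + 2 * b i))%N.
      by apply: eq_bigr => i _; rewrite lb_s -mul2n.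
    rewrite big_split; congr (_ + _)%N; first by rewrite sum1_card card_ord.
    by rewrite big_distrr.
  have := sum_ord_double M; set X := (\sum_(i < M + M) i)%N; set SA := (\sum_i a i)%N.
  by set SB := (\sum_i b i)%N; rewrite /=; lia.
have chiE := norm_specht_char_involution R la_part la_size la_sum gC la_s lb_s.
have dimE := specht_dim_vandermonde R la_part la_size.
have Va := vandermonde_gt0 R inj_a; have Vb := vandermonde_gt0 R inj_b.
have Vl := vandermonde_gt0 R l_inj.
have chi0 : 0 < `|specht_char R g| by rewrite chiE !mulr_gt0 ?invr_gt0.
have dim0 : 0 < (specht_dim R la)%:R :> R by rewrite ltr0n (specht_dim_gt0 R).
have -> : ln (specht_char R g ^+ 2 / (specht_dim R la)%:R)
   = 2 * ln `|specht_char R g| - ln (specht_dim R la)%:R.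
  rewrite -real_normK ?num_real // lnM ?posrE ?invr_gt0 ?exprn_gt0 // lnV ?posrE //.
  by rewrite lnXn // mulr_natl.
have -> : ln `|specht_char R g| = ln m`!%:R + (ln (vandermonde R a) - \sum_i ln (a i)`!%:R)
    + (ln (vandermonde R b) - \sum_i ln (b i)`!%:R).
  rewrite chiE !lnM ?posrE ?mulr_gt0 ?invr_gt0 // !lnV ?posrE // !lnf; ring.
have -> : ln (specht_dim R la)%:R = ln (2 * m)`!%:R + (ln (vandermonde R l) - \sum_i ln (l i)`!%:R).
  by rewrite dimE la_sum !lnM ?posrE ?mulr_gt0 ?invr_gt0 // lnV ?posrE // lnf.
have -> : ln (vandermonde R l) = 2^-1 * ((\sum_i \sum_j lndist R (a i).*2 (a j).*2)
     + (\sum_i \sum_j lndist R (b i).*2.+1 (b j).*2.+1)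
     + 2 * \sum_i \sum_j lndist R (a i).*2 (b j).*2.+1).
  rewrite ln_vandermonde //; congr (_ * _); rewrite (reindex_inj (@perm_inj _ s)) big_split_ord /=.
  have split_row x : \sum_j lndist R x (l j)
      = \sum_j lndist R x (a j).*2 + \sum_j lndist R x (b j).*2.+1.
    rewrite (reindex_inj (@perm_inj _ s)) big_split_ord /=.
    by congr (_ + _); apply: eq_bigr => j _; rewrite ?la_s ?lb_s.
  under eq_bigr do rewrite la_s split_row.
  under [X in _ + X = _]eq_bigr do rewrite lb_s split_row.
  rewrite !big_split /= [X in _ + (X + _)]exchange_big /=.
  under [X in _ + (X + _) = _]eq_bigr do under eq_bigr do rewrite lndist_sym.
  ring.
have -> : \sum_i ln (l i)`!%:R = \sum_i ln ((a i).*2)`!%:R + \sum_i ln ((b i).*2.+1)`!%:R :> R.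
  rewrite (reindex_inj (@perm_inj _ s)) big_split_ord /=.
  by congr (_ + _); apply: eq_bigr => j _; rewrite ?la_s ?lb_s.
have := @ln_ratio_le R M m B a b inj_a inj_b aB bB sum_ab.
(* The charge takes values in [-1, 0, 1], so its square is its absolute value; this accounts for the
   1 added to the harmonic sum. *)
have -> : log_energy bead_charge B = - 2^-1 * (\sum_(x < B) \sum_(y < B) ind_diff R a b x * ind_diff R a b y
    * lndist R x y) + \sum_(x < B) `|ind_diff R a b x|.
  rewrite /log_energy; congr (_ * _ + _).
    by apply: eq_bigr => x _; apply: eq_bigr => y _; rewrite !fE.
  apply: eq_bigr => x _; rewrite fE /ind_diff.
  have n1 : `|0 - 1| = 1 :> R by rewrite sub0r normrN1.
  by case: (ind_range R a x) => ->; case: (ind_range R b x) => ->;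
    rewrite ?n1 ?subrr ?normr0 ?subr0 ?normr1 ?sub0r ?sqrrN ?expr0n ?expr1n.
have -> : \sum_(x < B) `|bead_charge x| = \sum_(x < B) `|ind_diff R a b x|.
  by apply: eq_bigr => x _; rewrite fE.
set EE := \sum_(x < B) \sum_(y < B) _; set S := \sum_(x < B) `|_|.
set H := harmonic_sum R B; rewrite [S * (H + 1)]mulrDr mulr1; set SH := S * H.
set W := 2^-1 * (_ + _ + _); lra.
Qed.
End Abacus.

(** * The Sobolev norm of a piecewise linear function *)

Section CellIntegral.
Variable R : realType.
Local Open Scope classical_set_scope.
Local Notation leb := (@lebesgue_measure R).

(** The preimage under scaling by [c] of a unit interval; the offset [o] lets naturals index cells
    left of the origin. *)
Definition grid_cell (c : R) (o x : nat) : set R :=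
  [set s | (x%:R <= c * s + o%:R) && (c * s + o%:R < x.+1%:R)].

Lemma grid_cellE c o x : 0 < c ->
  grid_cell c o x = [set` `[(x%:R - o%:R) / c, (x.+1%:R - o%:R) / c[%R].
Proof.
move=> c0; apply/seteqP; split => s /=; rewrite in_itv /= ler_pdivrMr // ltr_pdivlMr //
  [s * c]mulrC lerBlDr ltrBrDr //.
Qed.

Lemma measurable_grid_cell c o x : 0 < c -> measurable (grid_cell c o x).
Proof. by move=> c0; rewrite grid_cellE //; apply: measurable_itv. Qed.

Lemma lebesgue_grid_cell c o x : 0 < c -> leb (grid_cell c o x) = (c^-1)%:E.
Proof.
move=> c0; rewrite grid_cellE // lebesgue_measure_itv /= lte_fin ltr_pM2r ?invr_gt0 //.
rewrite ltrD2r ltr_nat ltnSn -EFinB -mulrBl; congr (_%:E).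
by rewrite opprB addrA subrK -natr1 [_ + 1]addrC addrK mul1r.
Qed.

(** The boxes of cells exhaust the plane as [K] grows, so monotone convergence passes the uniform
    bound to the integral. A pair of cells has area [c ^- 2]. *)
Lemma integral_le_grid (h : measurableTypeR R * measurableTypeR R -> R) (c C : R) (M B : nat) (Phi : nat -> nat -> nat -> R) :
  0 < c -> measurable_fun setT h -> (forall z, 0 <= h z) -> (forall K x y, 0 <= Phi K x y) ->
  (forall K x y (z : R * R), grid_cell c (M + K) x z.1 -> grid_cell c (M + K) y z.2 ->
     h z <= Phi K x y) ->
  (forall K, \sum_(x < B + K.*2) \sum_(y < B + K.*2) Phi K x y <= C) ->
  (\int[(leb \x leb)%E]_z (h z)%:E <= (C / c ^+ 2)%:E)%E.
Proof.
move=> c0 mh h0 Phi0 hPhi PhiC.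
pose cells K := [seq (x, y) | x <- iota 0 (B + K.*2), y <- iota 0 (B + K.*2)].
pose F K (p : nat * nat) := grid_cell c (M + K) p.1 `*` grid_cell c (M + K) p.2.
pose box K : set (measurableTypeR R * measurableTypeR R) := \big[setU/set0]_(p <- cells K) F K p.
have mF K p : measurable (F K p) by apply: measurableX; apply: measurable_grid_cell.
have mbox K : measurable (box K) by apply: bigsetU_measurable => p _; apply: mF.
have mh' (A : set (measurableTypeR R * measurableTypeR R)) : measurable_fun A (EFin \o h).
  apply: measurable_funTS; apply/measurable_EFinP. exact: mh.
have boxE K z : box K z <->
   [/\ 0 <= c * z.1 + (M + K)%:R, c * z.1 + (M + K)%:R < (B + K.*2)%:R,
       0 <= c * z.2 + (M + K)%:R & c * z.2 + (M + K)%:R < (B + K.*2)%:R].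
  split.
    rewrite /box -bigcup_seq => -[[x y] /= /allpairsP[[x' y'] /= []]].
    rewrite !mem_iota /= !add0n => xB yB [-> ->] [/= /andP[a1 a2] /andP[b1 b2]].
    split; [exact: le_trans a1|apply: lt_le_trans a2 _|exact: le_trans b1|apply: lt_le_trans b2 _].
      by rewrite ler_nat.
    by rewrite ler_nat.
  move=> [a1 a2 b1 b2]; rewrite /box -bigcup_seq.
  exists (Num.truncn (c * z.1 + (M + K)%:R), Num.truncn (c * z.2 + (M + K)%:R)) => /=.
    apply/allpairsP; exists (Num.truncn (c * z.1 + (M + K)%:R), Num.truncn (c * z.2 + (M + K)%:R)).
    by rewrite /= !mem_iota /= !add0n !truncn_lt_nat ?a2 ?b2.
  by split; rewrite /grid_cell /=; apply: truncn_itv.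
have box_mono : {homo box : n m / (n <= m)%N >-> (n <= m)%O}.
  move=> K K' KK; apply/subsetPset => z /boxE[a1 a2 b1 b2]; apply/boxE.
  have e : (K'%:R = K%:R + (K' - K)%N%:R :> R) by rewrite -natrD subnKC.
  have p : 0 <= (K' - K)%N%:R :> R by rewrite ler0n.
  move: a1 a2 b1 b2; rewrite -!muln2 !natrD !natrM e => a1 a2 b1 b2.
  by split; lra.
have box_cover : \bigcup_K box K = setT.
  apply/seteqP; split => // z _.
  pose w := `|c * z.1| + `|c * z.2|.
  have [k kw] : exists k : nat, w < k%:R by exists (Num.truncn w).+1; rewrite truncnS_gt.
  (* In scaled coordinates box [K] extends from [- (M + K)] to [B + K - M], so the extra [M]
     compensates the offset on the right. *)
  exists (k + M)%N => //; apply/boxE.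
  have := ler_norm (c * z.1); have := ler_norm (- (c * z.1)).
  have := ler_norm (c * z.2); have := ler_norm (- (c * z.2)).
  have n1 := normr_ge0 (c * z.1); have n2 := normr_ge0 (c * z.2).
  have M0 : 0 <= M%:R :> R by []; have B0 : 0 <= B%:R :> R by [].
  rewrite !normrN -!muln2 !natrD !natrM !natrD; move: kw; rewrite /w => kw h1 h2 h3 h4.
  by split; lra.
have box_le K : (\int[(leb \x leb)%E]_(z in box K) (h z)%:E <= (C / c ^+ 2)%:E)%E.
  rewrite ge0_integral_bigsetU //=; last 4 first.
  - exact: mF.
  - by apply: allpairs_uniq; rewrite ?iota_uniq // => -[? ?] [? ?].
  - apply/trivIsetP => -[x y] [x' y'] /= _ _ ne; apply/seteqP; split => // z.
    rewrite /F /grid_cell /= => -[[/andP[a1 a2] /andP[b1 b2]] [/andP[a1' a2'] /andP[b1' b2']]].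
    have cmp (u v : nat) (t : R) : u%:R <= t -> t < v.+1%:R -> (u <= v)%N.
      by move=> ut tv; rewrite -ltnS -(ltr_nat R); apply: le_lt_trans tv.
    move/eqP: ne; apply; congr (_, _); apply/eqP; rewrite eqn_leq.
      by rewrite (cmp _ _ _ a1 a2') (cmp _ _ _ a1' a2).
    by rewrite (cmp _ _ _ b1 b2') (cmp _ _ _ b1' b2).
  - by move=> z _; rewrite lee_fin.
  apply: (@le_trans _ _ (\sum_(p <- cells K) (Phi K p.1 p.2 / c ^+ 2)%:E)%E).
    apply: lee_sum => -[x y] _ /=.
    apply: (@le_trans _ _ (\int[(leb \x leb)%E]_(z in F K (x, y)) (Phi K x y)%:E)%E).
      apply: ge0_le_integral => //.
      - exact: mF.
      - by move=> z _; rewrite lee_fin.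
      - by move=> z [Fx Fy]; rewrite lee_fin; apply: hPhi.
    rewrite integral_cst; last exact: mF.
    rewrite /F /= product_measure1E; try exact: measurable_grid_cell.
    by rewrite [X in (_ * (X * _))%E](lebesgue_grid_cell (M + K) x c0)
      [X in (_ * (_ * X))%E](lebesgue_grid_cell (M + K) y c0) -!EFinM lee_fin expr2 invfM.
  rewrite sumEFin lee_fin -mulr_suml ler_wpM2r //; first by rewrite invr_ge0 exprn_ge0 // ltW.
  apply: le_trans (PhiC K).
  rewrite /cells big_allpairs_dep /=.
  have idx n : iota 0 n = index_iota 0 n by rewrite /index_iota subn0.
  rewrite idx big_mkord; apply: ler_sum => x _.
  by rewrite big_mkord.
have cv := @ge0_nondecreasing_set_cvg_integral _ _ R box (EFin \o h) (leb \x leb)%E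
  box_mono mbox (fun i => mh' (box i)).
rewrite -box_cover -(cvg_lim _ (cv _)) //; last by move=> i z _; rewrite lee_fin.
apply: lime_le; last by apply: nearW => K; apply: box_le.
by apply: cvgP (cv _) => i z _; rewrite lee_fin.
Qed.
End CellIntegral.

(** * Difference quotients on pairs of cells *)

Section SobolevUpperBound.
Variable R : realType.
Local Open Scope classical_set_scope.

Lemma measurable_inv : measurable_fun [set: R] (fun x : R => x^-1).
Proof.
rewrite -(setvU [set (0 : R)]); apply/measurable_funU => //.
  by apply: measurableC; apply: measurable_set1.
split; last exact: measurable_fun_set1.
apply: open_continuous_measurable_fun; first exact: (closed_openC (@closed_eq R 0)).
move=> x; rewrite inE /= => /eqP x0; exact: inv_continuous.
Qed.

(** [48 = 4 * 3 * 4]: the square of the factor 2, Cauchy-Schwarz for three terms, and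
    [d ^+ 2 <= 4 * (d + a - b) ^+ 2], which follows from [|d| >= 2] and [|a - b| <= 1]. *)
Lemma far_quotient_le (F1 F2 f1 f2 a b d : R) : 2 <= `|d| ->
  0 <= a -> a <= 1 -> 0 <= b -> b <= 1 ->
  ((- 2 * (F1 + f1 * a) + 2 * (F2 + f2 * b)) / (d + a - b)) ^+ 2
  <= 48 * (((F1 - F2) / d) ^+ 2 + (f1 ^+ 2 + f2 ^+ 2) * d ^- 2).
Proof.
move=> d2 a0 a1 b0 b1; rewrite !expr_div_n -mulrDl.
have dd : 4 <= d ^+ 2 by rewrite -real_normK ?num_real //; nra.
have dpos : 0 < d ^+ 2 by lra.
have q : d ^+ 2 <= 4 * (d + a - b) ^+ 2.
  have ab : `|a - b| <= 1 by rewrite ler_norml; apply/andP; split; lra.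
  have : `|d| <= 2 * `|d + a - b|.
    have := ler_normB (d + a - b) (a - b); have -> : d + a - b - (a - b) = d by ring.
    lra.
  move=> le; rewrite -[d ^+ 2]real_normK ?num_real // -[(d + a - b) ^+ 2]real_normK ?num_real //.
  have := normr_ge0 d; nra.
have e0 : 0 < (d + a - b) ^+ 2 by lra.
rewrite ler_pdivrMr // mulrA mulrAC ler_pdivlMr //.
have num : (- 2 * (F1 + f1 * a) + 2 * (F2 + f2 * b)) ^+ 2
    <= 12 * ((F1 - F2) ^+ 2 + (f1 ^+ 2 + f2 ^+ 2)).
  have t1 : (f1 * a) ^+ 2 <= f1 ^+ 2.
    by rewrite exprMn ler_piMr ?sqr_ge0 // expr_le1.
  have t2 : (f2 * b) ^+ 2 <= f2 ^+ 2.
    by rewrite exprMn ler_piMr ?sqr_ge0 // expr_le1.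
  set p := f1 * a in t1 *; set q2 := f2 * b in t2 *.
  have := sqr_ge0 (F1 - F2 - p); have := sqr_ge0 (F1 - F2 + q2); have := sqr_ge0 (p + q2).
  nra.
have n0 : 0 <= (F1 - F2) ^+ 2 + (f1 ^+ 2 + f2 ^+ 2) by rewrite !addr_ge0 ?sqr_ge0.
apply: (@le_trans _ _ (12 * ((F1 - F2) ^+ 2 + (f1 ^+ 2 + f2 ^+ 2)) * (4 * (d + a - b) ^+ 2))).
  by apply: ler_pM => //; [apply: sqr_ge0 | lra].
by rewrite [X in _ <= X](_ : _ = 12 * ((F1 - F2) ^+ 2 + (f1 ^+ 2 + f2 ^+ 2)) * (4 * (d + a - b) ^+ 2)) //; ring.
Qed.

(** For points on either side of a common grid point the quotient is twice a weighted mean of the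
    two slopes. *)
Lemma near_quotient_le (f1 f2 a b : R) : 0 <= a -> 0 <= b ->
  ((2 * (f1 * a + f2 * b)) / (a + b)) ^+ 2 <= 4 * (f1 ^+ 2 + f2 ^+ 2).
Proof.
move=> a0 b0; have [->|ab] := eqVneq (a + b) 0.
  by rewrite invr0 mulr0 expr0n mulr_ge0 ?addr_ge0 ?sqr_ge0.
have ab0 : 0 < (a + b) ^+ 2 by rewrite exprn_even_gt0 //= ab.
rewrite expr_div_n ler_pdivrMr //.
have -> : (2 * (f1 * a + f2 * b)) ^+ 2 = 4 * (f1 * a + f2 * b) ^+ 2 by ring.
rewrite -mulrA ler_pM2l // sqrrD (sqrrD a).
have h : 0 <= a * b by apply: mulr_ge0.
have k1 := sqr_ge0 (f1 * b); have k2 := sqr_ge0 (f2 * a).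
have k3 : 0 <= (f1 - f2) ^+ 2 * (a * b) by rewrite mulr_ge0 ?sqr_ge0.
have k4 : 0 <= (f1 ^+ 2 + f2 ^+ 2) * (a * b) by rewrite mulr_ge0 ?addr_ge0 ?sqr_ge0.
rewrite !exprMn in k1 k2 *; nra.
Qed.

(** The value 1 on the diagonal covers two points of one cell, where the quotient is the slope
    itself. *)
Definition inv_sqr_dist (x y : nat) : R := if x == y then 1 else (x%:R - y%:R) ^- 2.

Lemma sum_inv_sqr_le (n : nat) : \sum_(k < n) k.+1%:R ^- 2 <= 2 :> R.
Proof.
case: n => [|n]; first by rewrite big_ord0.
suff : \sum_(k < n.+1) k.+1%:R ^- 2 <= 2 - n.+1%:R^-1 :> R.
  by move=> h; apply: le_trans h _; rewrite lerBlDr lerDl invr_ge0.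
elim: n => [|n IH]; first by rewrite big_ord1 expr1n invr1; lra.
rewrite big_ord_recr /=; apply: le_trans (lerD IH (lexx _)) _.
have p : 0 < n.+1%:R :> R by rewrite ltr0n.
rewrite -[n.+2%:R]natr1; set t : R := n.+1%:R in p *.
suff : (t + 1) ^- 2 + (t + 1)^-1 <= t^-1.
  by set v := (t + 1) ^- 2; set u := (t + 1)^-1; set w := t^-1; clearbody u v w; lra.
have -> : (t + 1) ^- 2 + (t + 1)^-1 = (t + 2) / (t + 1) ^+ 2.
  by field; apply: lt0r_neq0; lra.
rewrite ler_pdivrMr; last by rewrite exprn_gt0 //; lra.
by rewrite ler_pdivlMl //; nra.
Qed.

Lemma sum_inv_sqr_dist_le (B x : nat) : (x < B)%N -> \sum_(y < B) inv_sqr_dist x y <= 5.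
Proof.
move=> xB; rewrite (bigID (fun y : 'I_B => (y < x)%N)) /=.
rewrite [X in _ + X](bigD1 (Ordinal xB)) /=; last by rewrite ltnn.
rewrite {2}/inv_sqr_dist eqxx.
have lo : \sum_(y < B | (y < x)%N) inv_sqr_dist x y <= 2.
  apply: le_trans (sum_inv_sqr_le x).
  rewrite -(big_ord_widen B (fun y => inv_sqr_dist x y) (ltnW xB)) (reindex_inj rev_ord_inj) /=.
  apply: ler_sum => k _; have kx := ltn_ord k.
  rewrite /inv_sqr_dist gtn_eqF; last by lia.
  by rewrite -natrB; [rewrite (_ : (x - (x - k.+1) = k.+1)%N) //; lia | lia].
have hi : \sum_(y < B | ~~ (y < x)%N && (y != Ordinal xB)) inv_sqr_dist x y <= 2.
  apply: le_trans (sum_inv_sqr_le (B - x.+1)).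
  have e : B = (x.+1 + (B - x.+1))%N by lia.
  rewrite -(big_mkord (fun y => ~~ (y < x)%N && (y != x)) (fun y => inv_sqr_dist x y)).
  rewrite (big_cat_nat _ (n := x.+1)) //= big_nat_cond big1 ?add0r => [|y /andP[yx /andP[h1 h2]]];
    last by exfalso; lia.
  rewrite -{1}[x.+1]add0n big_addn big_mkord big_mkcond; apply: ler_sum => k _.
  case: ifP => _; last by rewrite invr_ge0 exprn_ge0.
  rewrite /inv_sqr_dist ltn_eqF; last by lia.
  rewrite -sqrrN opprB natrD -[x.+1%:R]natr1 -[k.+1%:R]natr1.
  by rewrite (_ : k%:R + (x%:R + 1) - x%:R = k%:R + 1 :> R) //; ring.
move: lo hi; set X := \sum_(y < B | _) _; set Y := \sum_(y < B | _) _; lra.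
Qed.

Lemma cell_quotient_le (f : nat -> R) (x y : nat) (u v : R) :
  x%:R <= u -> u < x.+1%:R -> y%:R <= v -> v < y.+1%:R ->
  ((- 2 * (partial_sum f x + f x * (u - x%:R)) - - 2 * (partial_sum f y + f y * (v - y%:R)))
     / (u - v)) ^+ 2
  <= 48 * (((partial_sum f x - partial_sum f y) / (x%:R - y%:R)) ^+ 2
           + (f x ^+ 2 + f y ^+ 2) * inv_sqr_dist x y).
Proof.
have FS z : partial_sum f z.+1 = partial_sum f z + f z by rewrite /partial_sum big_ord_recr.
rewrite -[x.+1%:R]natr1 -[y.+1%:R]natr1; move=> xu ux yv vy.
have near (g1 g2 e : R) : 0 <= e -> 4 * (g1 ^+ 2 + g2 ^+ 2) <= 48 * (e + (g1 ^+ 2 + g2 ^+ 2)).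
  by move=> e0; have := sqr_ge0 g1; have := sqr_ge0 g2; lra.
(* In equal or adjacent cells [u - v] can be arbitrarily small, so the slopes alone must control the
   quotient; the partial sums at the left ends are compared only for cells further apart. *)
have [xy|[yx|[exy|far]]] : x.+1 = y \/ y.+1 = x \/ x = y \/ (x.+2 <= y)%N || (y.+2 <= x)%N by lia.
- rewrite -xy in yv vy *; rewrite -[x.+1%:R]natr1 in yv vy *.
  have -> : inv_sqr_dist x x.+1 = 1.
    rewrite /inv_sqr_dist ltn_eqF // -[x.+1%:R]natr1 (_ : x%:R - (x%:R + 1) = -1 :> R); last by ring.
    by rewrite sqrrN expr1n invr1.
  rewrite mulr1 FS.
  have := @near_quotient_le (f x) (f x.+1) (x%:R + 1 - u) (v - (x%:R + 1)).
  rewrite !subr_ge0 => /(_ (ltW ux) yv) le.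
  apply: le_trans (near _ _ _ (sqr_ge0 _)); apply: le_trans le.
  rewrite le_eqVlt; apply/orP; left; apply/eqP.
  have -> : x%:R + 1 - u + (v - (x%:R + 1)) = - (u - v) by ring.
  by rewrite invrN !exprMn sqrrN; congr (_ * _); ring.
- rewrite -yx in xu ux *; rewrite -[y.+1%:R]natr1 in xu ux *.
  have -> : inv_sqr_dist y.+1 y = 1.
    rewrite /inv_sqr_dist gtn_eqF // -[y.+1%:R]natr1 (_ : y%:R + 1 - y%:R = 1 :> R); last by ring.
    by rewrite expr1n invr1.
  rewrite mulr1 FS.
  have := @near_quotient_le (f y.+1) (f y) (u - (y%:R + 1)) (y%:R + 1 - v).
  rewrite !subr_ge0 => /(_ xu (ltW vy)) le.
  apply: le_trans (near _ _ _ (sqr_ge0 _)); apply: le_trans le.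
  rewrite le_eqVlt; apply/orP; left; apply/eqP.
  have -> : u - (y%:R + 1) + (y%:R + 1 - v) = u - v by ring.
  by rewrite !exprMn; congr (_ * _); ring.
- rewrite -exy in yv vy *; rewrite /inv_sqr_dist eqxx mulr1.
  apply: le_trans (near _ _ _ (sqr_ge0 _)).
  have -> : - 2 * (partial_sum f x + f x * (u - x%:R)) - - 2 * (partial_sum f x + f x * (v - x%:R))
     = - 2 * f x * (u - v) by ring.
  have [->|uv] := eqVneq (u - v) 0.
    by rewrite mulr0 mul0r expr0n mulr_ge0 // addr_ge0 ?sqr_ge0.
  by rewrite mulfK // exprMn; have := sqr_ge0 (f x); lra.
have d2 : 2 <= `|x%:R - y%:R : R|.
  case/orP: far => h.
    by rewrite distrC -natrB ?normr_nat ?ler_nat; lia.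
  by rewrite -natrB ?normr_nat ?ler_nat; lia.
have le := @far_quotient_le (partial_sum f x) (partial_sum f y) (f x) (f y) (u - x%:R) (v - y%:R) _ d2.
have -> : inv_sqr_dist x y = (x%:R - y%:R) ^- 2.
  by rewrite /inv_sqr_dist; case: eqP => // exy; move: far; rewrite exy; lia.
apply: le_trans (le _ _ _ _); try by lra.
rewrite le_eqVlt; apply/orP; left; apply/eqP.
by congr ((_ / _) ^+ 2); ring.
Qed.

Definition shift_fun (f : nat -> R) (K x : nat) : R := if (K <= x)%N then f (x - K)%N else 0.

Lemma partial_sum_shift f K x : partial_sum (shift_fun f K) x = partial_sum f (x - K).
Proof.
elim: x => [|x IH]; first by rewrite /partial_sum sub0n !big_ord0.
rewrite {1}/partial_sum big_ord_recr /= -/(partial_sum _ x) IH /shift_fun.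
case: leqP => Kx; last by rewrite addr0 (_ : (x.+1 - K = x - K)%N) //; lia.
by rewrite subSn // [RHS]/partial_sum big_ord_recr.
Qed.

(** The factor 4 undoes the [4^-1] of the energy bound; 10 is twice the bound 5 for a row sum of
    [inv_sqr_dist], once for each of the two slopes. *)
Lemma integral_difference_quotient_le (D : R -> R) (f : nat -> R) (M B : nat) (c : R) (L : R -> R) :
  0 < c -> (forall s, L s = D (c * s) / c) -> continuous D -> (forall x, (B <= x)%N -> f x = 0) -> partial_sum f B = 0 ->
  (forall K x u, x%:R <= u + (M + K)%:R -> u + (M + K)%:R < x.+1%:R ->
     D u = - 2 * (partial_sum f (x - K) + shift_fun f K x * (u + (M + K)%:R - x%:R))) ->
  (\int[(@lebesgue_measure R \x @lebesgue_measure R)%E]_z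
      ((((L z.1 - L z.2) / (z.1 - z.2)) ^+ 2)%:E)
   <= (48 * (4 * log_energy f B + 10 * \sum_(x < B) f x ^+ 2) / c ^+ 2)%:E)%E.
Proof.
move=> c0 LE Dcont fB FB Dcell.
pose fK := shift_fun f; pose FK K := partial_sum (shift_fun f K).
pose Phi K x y := 48 * (((FK K x - FK K y) / (x%:R - y%:R)) ^+ 2
           + (fK K x ^+ 2 + fK K y ^+ 2) * inv_sqr_dist x y).
have r0 x y : 0 <= inv_sqr_dist x y.
  by rewrite /inv_sqr_dist; case: eqP => // _; rewrite invr_ge0 sqr_ge0.
have mL : measurable_fun [set: R] L.
  rewrite (funext LE); apply: measurable_funM; last exact: measurable_cst.
  apply: continuous_measurable_fun => s.
  by apply: continuous_comp; [exact: mulrl_continuous | exact: Dcont].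
apply: (@integral_le_grid R (fun z => ((L z.1 - L z.2) / (z.1 - z.2)) ^+ 2) c _ M B.+1 Phi) => //.
- apply: measurable_funX; apply: measurable_funM.
    by apply: measurable_funB; apply: measurableT_comp.
  apply: (measurableT_comp measurable_inv).
  exact: measurable_funB.
- by move=> z; apply: sqr_ge0.
- move=> K x y; rewrite mulr_ge0 // addr_ge0 ?sqr_ge0 // mulr_ge0 //.
  by rewrite addr_ge0 ?sqr_ge0.
- move=> K x y [s t] /= /andP[xs sx] /andP[yt ty].
  have := cell_quotient_le (shift_fun f K) xs sx yt ty; rewrite !partial_sum_shift.
  rewrite -(Dcell K x _ xs sx) -(Dcell K y _ yt ty) /Phi /FK !partial_sum_shift.
  congr (_ <= _); congr (_ ^+ 2); rewrite !LE.
  have -> : c * s + (M + K)%:R - (c * t + (M + K)%:R) = c * (s - t) by ring.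
  by rewrite invfM -mulrBl -!mulrA; congr (_ * _).
- move=> K; rewrite addSn /Phi.
  under eq_bigr do rewrite -mulr_sumr big_split /=.
  rewrite -mulr_sumr big_split /=; apply: ler_wpM2l => //; apply: lerD.
    rewrite -ler_pdivrMl //; apply: le_trans (shifted_energy_le K fB FB).
    rewrite le_eqVlt; apply/orP; left; apply/eqP; congr (_ * _).
    by apply: eq_bigr => x _; apply: eq_bigr => y _; rewrite /FK !partial_sum_shift.
  set N := (B + K.*2).+1.
  have sumf : \sum_(x < N) fK K x ^+ 2 = \sum_(x < B) f x ^+ 2.
    rewrite /N big_ord_recr /= {2}/fK /shift_fun (_ : (K <= B + K.*2)%N = true) ?fB; try lia.
    rewrite expr0n addr0 (sum_shift (g := fun x => fK K x ^+ 2)).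
      by apply: eq_bigr => x _; rewrite /fK /shift_fun leq_addl addnK.
    move=> x h; rewrite /fK /shift_fun; case: leqP => Kx; last by rewrite expr0n.
    by rewrite fB ?expr0n //; lia.
  have half : \sum_(x < N) \sum_(y < N) fK K x ^+ 2 * inv_sqr_dist x y
      <= 5 * \sum_(x < B) f x ^+ 2.
    rewrite -sumf mulr_sumr; apply: ler_sum => x _; rewrite -mulr_sumr mulrC.
    by apply: ler_wpM2r; [apply: sqr_ge0 | apply: sum_inv_sqr_dist_le].
  have -> : \sum_(x < N) \sum_(y < N) (fK K x ^+ 2 + fK K y ^+ 2) * inv_sqr_dist x y
     = 2 * \sum_(x < N) \sum_(y < N) fK K x ^+ 2 * inv_sqr_dist x y.
    rewrite mulr_natl mulr2n [X in _ = _ + X]exchange_big -big_split; apply: eq_bigr => x _ /=.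
    rewrite -big_split; apply: eq_bigr => y _ /=; rewrite mulrDl; congr (_ + _ * _).
    by rewrite /inv_sqr_dist eq_sym -sqrrN opprB.
  by move: half; set X := \sum_(x < N) _; lra.
Qed.
End SobolevUpperBound.

(** * Rims of 2-quotients *)

Section RimProperties.
Variable R : realType.
Local Open Scope classical_set_scope.

Lemma norm_sub_int_slope (m q : int) (u v : R) :
  m%:~R < u -> u < m%:~R + 1 -> m%:~R < v -> v < m%:~R + 1 ->
  `|v - q%:~R| - `|u - q%:~R| = (if q <= m then 1 else -1) * (v - u).
Proof.
move=> mu um mv vm; case: ifP => [qm|/negbT]; last rewrite -ltNge => mq.
  have qm' : q%:~R <= m%:~R :> R by rewrite ler_int.
  by rewrite !ger0_norm; lra.
have qm' : m%:~R + 1 <= q%:~R :> R by rewrite -intrD1 ler_int; lia.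
by rewrite !ler0_norm; lra.
Qed.

(** The left end of the unit interval centred at the corresponding point of [maya]. *)
Definition maya_pos (al : seq nat) (i : nat) : int := (part al i)%:Z - i.+1%:Z.

Lemma maya_pos_inj al : is_part al -> injective (maya_pos al).
Proof.
move=> al_part i j; rewrite /maya_pos => E.
by case: (ltngtP i j) => // lt; have := part_decr al_part (ltnW lt); lia.
Qed.

Lemma mem_maya (al : seq nat) (m : int) :
  (m%:~R + 2^-1 \in @maya R al) <-> exists i, maya_pos al i = m.
Proof.
have E i : (maya_pos al i)%:~R = (part al i)%:R - i.+1%:R :> R by rewrite /maya_pos rmorphB.
rewrite inE /maya /=; split=> [[i _ /addIr e]|[i <-]]; exists i => //; last by rewrite E.
by apply/eqP; rewrite -(eqr_int R) E e.
Qed.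

(** A witness for [is_rim], so that the choice in [rim] returns a genuine rim. The first part is the
    rim with all cells left of [- size al] occupied; each summand goes from 2 to 0 across the unit
    interval of a point of [maya] and turns the slope there from 1 to -1. *)
Definition rim_formula (al : seq nat) (u : R) : R :=
  `|u + (size al)%:R| - (size al)%:R +
  \sum_(i < size al) (1 - `|u - (maya_pos al i)%:~R| + `|u - (maya_pos al i + 1)%:~R|).

Lemma rim_formula_is_rim al : is_part al -> is_rim al (rim_formula al).
Proof.
move=> al_part; set N := size al.
have posN (i : 'I_N) : (- N%:Z <= maya_pos al i)%R by have := ltn_ord i; rewrite /maya_pos; lia.
split.
- move=> u; apply: cvgD.
    apply: cvgB; last exact: cvg_cst.
    by apply: cvg_norm; apply: cvgD; [exact: cvg_id | exact: cvg_cst].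
  apply: cvg_big => [|i _]; [exact: add_continuous|]; apply: cvgD; first apply: cvgB; first exact: cvg_cst.
    by apply: cvg_norm; apply: cvgB; [exact: cvg_id | exact: cvg_cst].
  by apply: cvg_norm; apply: cvgB; [exact: cvg_id | exact: cvg_cst].
- exists ((sumn al + N)%:R + 1) => u Au; rewrite /rim_formula -/N.
  have le_sum i : (part al i <= sumn al)%N.
    rewrite /part; case: (ltnP i (size al)) => [lt|]; last by move/(nth_default 0%N) => ->.
    by rewrite sumnE (big_nth 0%N) big_mkord (bigD1 (Ordinal lt)) //= leq_addr.
  have up (i : 'I_N) : (maya_pos al i + 1)%:~R <= (sumn al)%:R :> R.
    by rewrite [X in _ <= X]pmulrn ler_int /maya_pos; have := le_sum i; lia.
  have lo (i : 'I_N) : - N%:R <= (maya_pos al i)%:~R :> R.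
    by rewrite [N%:R]pmulrn -intrN ler_int; apply: posN.
  have s0 : 0 <= (sumn al)%:R :> R by [].
  have N0 : 0 <= N%:R :> R by [].
  move: Au; rewrite natrD => Au.
  have [u0|u0] := lerP 0 u.
    rewrite ger0_norm // in Au.
    rewrite big1 => [|i _]; first by rewrite !ger0_norm; lra.
    have := up i; rewrite intrD1 => up'.
    by rewrite !ger0_norm; lra.
  rewrite ltr0_norm // in Au.
  rewrite (eq_bigr (fun=> 2)) => [|i _].
    rewrite sumr_const card_ord -mulr_natr ler0_norm; last by lra.
    by rewrite ltr0_norm //; lra.
  by rewrite intrD1; have := lo i; move=> lo'; rewrite !ler0_norm; lra.
move=> m u v x; rewrite {}/x addrK => /andP[mu um] /andP[mv vm].
have half : m%:~R + 2^-1 + 2^-1 = m%:~R + 1 :> R by lra.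
rewrite half in um vm.
have slope := fun q => @norm_sub_int_slope m q u v mu um mv vm.
have -> : rim_formula al v - rim_formula al u
    = ((if (- N%:Z <= m)%R then 1 else -1) - 2 * \sum_(i < N) (maya_pos al i == m)%:R) * (v - u).
  rewrite /rim_formula -/N mulrBl -slope mulr_sumr mulr_suml.
  rewrite intrN opprK pmulrn.
  have -> : \sum_(i < N) 2 * (maya_pos al i == m)%:R * (v - u)
     = \sum_(i < N) (1 - `|u - (maya_pos al i)%:~R| + `|u - (maya_pos al i + 1)%:~R|)
     - \sum_(i < N) (1 - `|v - (maya_pos al i)%:~R| + `|v - (maya_pos al i + 1)%:~R|).
    rewrite -sumrB; apply: eq_bigr => i _; set p := maya_pos al i.
    have s1 := slope p; have s2 := slope (p + 1).
    transitivity ((if p <= m then 1 else -1) * (v - u) - (if p + 1 <= m then 1 else -1) * (v - u)).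
      by case: (ltgtP p m) => [lt|lt|->]; rewrite /= ?mulr1n ?mulr0n;
        [rewrite (_ : (p + 1 <= m) = true) ?subrr ?mulr0 ?mul0r //; lia
        |rewrite (_ : (p + 1 <= m) = false) ?subrr ?mulr0 ?mul0r //; lia
        |rewrite (_ : (m + 1 <= m) = false); [ring | lia]].
    by rewrite -s1 -s2; ring.
  ring.
congr (_ * _); case: (boolP (m%:~R + 2^-1 \in @maya R al)) => [inm|/negP nm].
  have [i im] := (mem_maya al m).1 inm.
  have [iN|Ni] := ltnP i N.
    have -> : (- N%:Z <= m)%R by rewrite -im; apply: (posN (Ordinal iN)).
    rewrite (bigD1 (Ordinal iN)) //= im eqxx big1 ?addr0 => [|j ji]; first by rewrite mulr1n; ring.
    case: eqP => // jm; case/eqP: ji; apply/val_inj/(maya_pos_inj al_part).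
    by rewrite /= im jm.
  have pi0 : part al i = 0%N by rewrite /part nth_default.
  rewrite big1 => [|j _].
    by rewrite mulr0 subr0 (_ : (- N%:Z <= m)%R = false) //; move: im; rewrite /maya_pos pi0; lia.
  case: eqP => // jm; have := maya_pos_inj al_part (etrans jm (esym im)) => ji.
  by have := ltn_ord j; rewrite ji ltnNge Ni.
rewrite big1 => [|j _]; last first.
  by case: eqP => // jm; case: nm; apply: (mem_maya al m).2; exists j.
rewrite mulr0 subr0; case: ifP => // /negbT mN; case: nm; apply: (mem_maya al m).2.
exists (`|m|%N.-1); rewrite /maya_pos /part nth_default; lia.
Qed.

(** [is_rim] prescribes slopes on open intervals only; continuity extends them to the end points,
    where neighbouring cells are glued. *)
Lemma affine_on_closure (g : R -> R) (a b s : R) : continuous g -> a < b ->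
  (forall u v, a < u < b -> a < v < b -> g v - g u = s * (v - u)) ->
  forall u v, a <= u <= b -> a <= v <= b -> g v - g u = s * (v - u).
Proof.
move=> gc ab aff; pose w := (a + b) / 2; pose h t := g t - s * t.
have wab : a < w < b by rewrite /w; apply/andP; split; lra.
have hc : continuous h.
  move=> t; apply: cvgB; first exact: gc.
  by apply: cvgM; [exact: cvg_cst | exact: cvg_id].
have h_in t : a < t < b -> h t = h w.
  by move=> tab; have := aff _ _ wab tab; rewrite /h; lra.
have ha : h a = h w.
  apply: (@norm_cvg_unique _ _ (h @ a^'+)); first exact: cvg_at_right_filter (hc a).
  apply: cvg_near_cst; near=> t; apply: h_in; apply/andP; split; near: t.
    exact: nbhs_right_gt.
  exact: nbhs_right_lt.
have hb : h b = h w.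
  apply: (@norm_cvg_unique _ _ (h @ b^'-)); first exact: cvg_at_left_filter (hc b).
  apply: cvg_near_cst; near=> t; apply: h_in; apply/andP; split; near: t.
    exact: nbhs_left_gt.
  exact: nbhs_left_lt.
have all_h t : a <= t <= b -> h t = h w.
  rewrite !le_eqVlt => /andP[/orP[/eqP <-|ta] /orP[/eqP ->|tb]] //.
  by apply: h_in; rewrite ta.
by move=> u v /all_h hu /all_h hv; move: hu hv; rewrite /h; lra.
Unshelve. all: by end_near.
Qed.

Lemma is_rim_cell al (G : R -> R) (m : int) (u v : R) : is_rim al G ->
  m%:~R <= u <= m%:~R + 1 -> m%:~R <= v <= m%:~R + 1 ->
  G v - G u = (if m%:~R + 2^-1 \in @maya R al then -1 else 1) * (v - u).
Proof.
case=> Gc _ cell; apply: affine_on_closure => //; first by rewrite ltrDl.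
move=> u' v' hu hv; have := cell m u' v'; rewrite /= addrK -addrA.
have -> : 2^-1 + 2^-1 = 1 :> R by lra.
by move=> H; apply: H.
Qed.

(** * The difference of the rims of the two quotients *)

Section TwoQuotientRims.
Variables (la al be : seq nat) (M B : nat) (Ga Gb : R -> R).
Hypotheses (la_part : is_part la) (la_size : (size la <= M + M)%N).
Hypothesis (quot : two_quotient R la al be).
Hypotheses (rim_a : is_rim al Ga) (rim_b : is_rim be Gb).
Hypothesis (B_big : forall i : 'I_(M + M), (beads la (M + M) i < B.*2)%N).

Let D u := Ga u - Gb u.
Let f := bead_charge R la M.

Lemma maya_alpha (m : int) : (m%:~R + 2^-1 \in @maya R al) <-> exists i, maya_pos la i = 2 * m.
Proof.
case: quot => _ _ -> _; rewrite inE /=; split.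
  move=> [x [xla [j xj]] xm].
  have jm : j = m by apply/eqP; rewrite -(eqr_int R); apply/eqP; move: xm; rewrite xj; lra.
  apply: (mem_maya la (2 * m)).1; rewrite inE; move: xla; rewrite xj jm.
  by rewrite rmorphM.
move=> H; exists (2 * m%:~R + 2^-1); last by lra.
split; last by exists m.
by have := (mem_maya la (2 * m)).2 H; rewrite inE rmorphM.
Qed.

Lemma maya_beta (m : int) : (m%:~R + 2^-1 \in @maya R be) <-> exists i, maya_pos la i = 2 * m + 1.
Proof.
case: quot => _ _ _ ->; rewrite inE /=; split.
  move=> [x [xla [j xj]] xm].
  (* The odd class is written [2j - 1/2], so a point [m + 1/2] of beta comes from [j = m + 1], that
     is, from position [2m + 1] of [la]. *)
  have jm : j = m + 1.
    by apply/eqP; rewrite -(eqr_int R) intrD1; apply/eqP; move: xm; rewrite xj; lra.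
  apply: (mem_maya la (2 * m + 1)).1; rewrite inE; move: xla; rewrite xj jm.
  rewrite !intrD1 rmorphM /=; congr (maya la _); lra.
move=> H; exists (2 * (m + 1)%:~R - 2^-1); last by rewrite intrD1; lra.
split; last by exists (m + 1).
have := (mem_maya la (2 * m + 1)).2 H; rewrite inE !intrD1 rmorphM /=.
by congr (maya la _); lra.
Qed.

(** A bead is its [maya_pos] shifted by [M + M], an even number, so parity is preserved and each
    runner is shifted by [M]. *)
Lemma maya_pos_bead (k c : nat) : (c < 2)%N ->
  (exists i, maya_pos la i = 2 * (k%:Z - M%:Z) + c%:Z) <->
  [exists i : 'I_(M + M), beads la (M + M) i == (k.*2 + c)%N].
Proof.
move=> c2; split.
  move=> [i]; rewrite /maya_pos => e.
  have iN : (i < M + M)%N.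
    rewrite ltnNge; apply/negP => Ni; move: e.
    by rewrite /part nth_default; lia.
  by apply/existsP; exists (Ordinal iN); rewrite /beads /=; lia.
move=> /existsP[i /eqP]; rewrite /beads => e; exists i; rewrite /maya_pos.
by have := ltn_ord i; lia.
Qed.

Lemma maya_pos_low (m : int) (c : nat) : (c < 2)%N -> m < - M%:Z ->
  exists i, maya_pos la i = 2 * m + c%:Z.
Proof.
move=> c2 mM; exists (`|(2 * m + c%:Z)%R|%N.-1); rewrite /maya_pos /part nth_default; lia.
Qed.

Lemma quotient_rim_cell (m : int) (u v : R) : m%:~R <= u <= m%:~R + 1 -> m%:~R <= v <= m%:~R + 1 ->
  D v - D u = - 2 * (if (m < - M%:Z)%R then 0 else f `|(m + M%:Z)%R|%N) * (v - u).
Proof.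
move=> hu hv; have ea := is_rim_cell rim_a hu hv; have eb := is_rim_cell rim_b hu hv.
have -> : D v - D u = (Ga v - Ga u) - (Gb v - Gb u) by rewrite /D; ring.
rewrite ea eb -mulrBl; congr (_ * _); case: (boolP (m < - M%:Z)%R) => mM.
  have -> : m%:~R + 2^-1 \in @maya R al.
    apply: (maya_alpha m).2; have [|i e] := @maya_pos_low m 0 _ mM; first by [].
    by exists i; rewrite e addr0.
  have -> : m%:~R + 2^-1 \in @maya R be by apply: (maya_beta m).2; apply: (@maya_pos_low m 1).
  by rewrite subrr mulr0.
pose k := `|(m + M%:Z)%R|%N; have mk : m = k%:Z - M%:Z by rewrite /k; lia.
have -> : (m%:~R + 2^-1 \in @maya R al) = [exists i : 'I_(M + M), beads la (M + M) i == (k.*2 + 0)%N].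
  apply/idP/idP => h.
    apply: (maya_pos_bead k (c := 0) _).1 => //; have [i e] := (maya_alpha m).1 h.
    by exists i; rewrite e mk addr0.
  apply: (maya_alpha m).2; have [|i e] := (maya_pos_bead k (c := 0) _).2 h; first by [].
  by exists i; rewrite e mk addr0.
have -> : (m%:~R + 2^-1 \in @maya R be) = [exists i : 'I_(M + M), beads la (M + M) i == (k.*2 + 1)%N].
  apply/idP/idP => h.
    apply: (maya_pos_bead k (c := 1) _).1 => //; have [i e] := (maya_beta m).1 h.
    by exists i; rewrite e mk.
  apply: (maya_beta m).2; have [|i e] := (maya_pos_bead k (c := 1) _).2 h; first by [].
  by exists i; rewrite e mk.
rewrite /f /bead_charge /bead_ind -/k; case: existsP => _; case: existsP => _; rewrite /= ?mulr1n ?mulr0n; ring.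
Qed.

Lemma charge_big x : (B <= x)%N -> f x = 0.
Proof.
move=> Bx; rewrite /f /bead_charge /bead_ind; case: existsP => [[i /eqP e]|_].
  by have := B_big i; rewrite e; lia.
case: existsP => [[i /eqP e]|_]; last by rewrite subrr.
by have := B_big i; rewrite e; lia.
Qed.

Lemma quotient_rim_far : exists A : R, forall u, A <= `|u| -> D u = 0.
Proof.
case: rim_a => _ [A HA] _; case: rim_b => _ [A' HA'] _.
exists (Num.max A A') => u; rewrite ge_max => /andP[h h'].
by rewrite /D HA // HA' // subrr.
Qed.

(** Left of [- M] both quotients have every position occupied, so [D] is constant there, and it
    vanishes far out. *)
Lemma quotient_rim_low j u : u = - (M + j)%:R -> D u = 0.
Proof.
have [A HA] := quotient_rim_far.
have step i : D (- (M + i.+1)%:R) = D (- (M + i)%:R).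
  pose m : int := - (M + i.+1)%:Z.
  have mE : m%:~R = - (M + i.+1)%:R :> R by rewrite /m intrN.
  have mE1 : m%:~R + 1 = - (M + i)%:R :> R by rewrite mE addnS -natr1; ring.
  have /= := @quotient_rim_cell m (- (M + i.+1)%:R) (- (M + i)%:R).
  rewrite -mE1 -mE lexx lerDl ler01 lexx => /(_ isT isT).
  rewrite (_ : (m < - M%:Z)%R = true); last by rewrite /m; lia.
  by rewrite mulr0 mul0r => /subr0_eq ->.
have const i k : D (- (M + (i + k))%:R) = D (- (M + i)%:R).
  by elim: k => [|k IH]; rewrite ?addn0 // addnS step.
move=> ->; pose J := (Num.truncn A).+1.
rewrite -(const j J); apply: HA; rewrite normrN normr_nat.
apply: (@le_trans _ _ J%:R); first by rewrite ltW // truncnS_gt.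
by rewrite ler_nat; lia.
Qed.

Lemma quotient_rim_int k : D (k%:R - M%:R) = - 2 * partial_sum f k.
Proof.
elim: k => [|k IH].
  rewrite /partial_sum big_ord0 mulr0; apply: (@quotient_rim_low 0).
  by rewrite sub0r addn0.
pose m : int := k%:Z - M%:Z.
have mE : m%:~R = k%:R - M%:R :> R by rewrite /m rmorphB.
have := @quotient_rim_cell m (k%:R - M%:R) (k.+1%:R - M%:R).
have e : k.+1%:R - M%:R = m%:~R + 1 :> R by rewrite mE -natr1; ring.
rewrite e -mE lexx lerDl ler01 lexx => /(_ isT isT).
rewrite (_ : (m < - M%:Z)%R = false); last by rewrite /m; lia.
rewrite (_ : `|(m + M%:Z)%R|%N = k); last by rewrite /m; lia.
rewrite mE IH /partial_sum big_ord_recr /= -/(partial_sum f k) => h; lra.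
Qed.

(** Between the two ends [D] changes by [- 2] times the total charge, and it vanishes at both. *)
Lemma partial_sum_charge : partial_sum f B = 0.
Proof.
have [A HA] := quotient_rim_far; pose J := (B + M + (Num.truncn A).+1)%N.
have : - 2 * partial_sum f J = 0.
  rewrite -quotient_rim_int; apply: HA.
  have AJ : A < (Num.truncn A).+1%:R by rewrite truncnS_gt.
  have B0 : 0 <= B%:R :> R by []; have T0 : 0 <= (Num.truncn A).+1%:R :> R by [].
  rewrite /J !natrD ger0_norm; lra.
have -> : partial_sum f J = partial_sum f B.
  rewrite /J -addnA /partial_sum big_split_ord /= [X in _ + X]big1 ?addr0 // => x _.
  by rewrite charge_big // leq_addr.
lra.
Qed.

Lemma quotient_rim_grid K x (u : R) : x%:R <= u + (M + K)%:R -> u + (M + K)%:R < x.+1%:R ->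
  D u = - 2 * (partial_sum f (x - K) + shift_fun f K x * (u + (M + K)%:R - x%:R)).
Proof.
rewrite -[x.+1%:R]natr1 natrD => xu ux; pose m : int := x%:Z - (M + K)%:Z.
have mE : m%:~R = x%:R - M%:R - K%:R :> R by rewrite /m rmorphB /= -[(M + K)%:Z%:~R]/((M + K)%:R) natrD; ring.
have := @quotient_rim_cell m m%:~R u; rewrite lexx lerDl ler01 mE => /(_ isT).
have -> : x%:R - M%:R - K%:R <= u <= x%:R - M%:R - K%:R + 1 by apply/andP; split; lra.
move=> /(_ isT); rewrite /shift_fun; case: leqP => Kx.
  rewrite (_ : (m < - M%:Z)%R = false); last by rewrite /m; lia.
  rewrite (_ : `|(m + M%:Z)%R|%N = (x - K)%N); last by rewrite /m; lia.
  have -> : x%:R - M%:R - K%:R = (x - K)%:R - M%:R :> R by rewrite natrB //; ring.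
  by rewrite quotient_rim_int natrB //; lra.
rewrite (_ : (m < - M%:Z)%R = true); last by rewrite /m; lia.
have -> : D (x%:R - M%:R - K%:R) = 0.
  by apply: (@quotient_rim_low (K - x)); rewrite natrD natrB ?(ltnW Kx) //; ring.
rewrite (_ : (x - K = 0)%N); last by lia.
by rewrite /partial_sum big_ord0 mulr0 !mul0r addr0 mulr0 subr0.
Qed.

Lemma quotient_rim_continuous : continuous D.
Proof. by case: rim_a => ca _ _; case: rim_b => cb _ _ u; apply: cvgB; [apply: ca | apply: cb]. Qed.
End TwoQuotientRims.
End RimProperties.

(** * Counting partitions and the final estimate *)

Local Open Scope classical_set_scope.

Lemma size_le_sumn la : 0%N \notin la -> (size la <= sumn la)%N.
Proof.
elim: la => //= x la IH; rewrite inE negb_or => /andP[x0 /IH].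
by rewrite eq_sym -lt0n in x0; lia.
Qed.

Lemma part_le_sumn la i : (part la i <= sumn la)%N.
Proof.
rewrite /part; case: (ltnP i (size la)) => [lt|]; last by move/(nth_default 0%N) => ->.
by rewrite sumnE (big_nth 0%N) big_mkord (bigD1 (Ordinal lt)) //= leq_addr.
Qed.

Lemma part_mul_le_sumn la i : is_part la -> (i.+1 * part la i <= sumn la)%N.
Proof.
move=> la_part; case: (ltnP i (size la)) => [lt|]; last first.
  by move/(nth_default 0%N); rewrite /part => ->; rewrite muln0.
rewrite sumnE (big_nth 0%N) big_mkord -[X in (X * _)%N]card_ord -sum_nat_const.
rewrite (big_ord_widen (size la) (fun=> part la i) lt) big_mkcond; apply: leq_sum => j _.
by case: ifP => // ji; apply: part_decr.
Qed.

Lemma count_mem_part la k N : (0 < k)%N -> (size la <= N)%N ->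
  count_mem k la = (\sum_(i < N) (part la i == k))%N.
Proof.
move=> k0 laN; rewrite -sum1_count (big_nth 0%N) big_mkord.
rewrite (big_ord_widen_cond N (fun i => nth 0%N la i == k) (fun=> 1%N) laN) big_mkcond.
apply: eq_bigr => i _; rewrite /part; case: (ltnP i (size la)) => [lt|ge].
  by rewrite andbT; case: eqP.
by rewrite andbF nth_default //; case: eqP k0 => // <-.
Qed.

(** The first [r] parts together with the multiplicities of the values below [r]. There are
    [n.+1 ^ (r + r)] codes, which is [exp (O(sqrt n * ln n))] for [r] close to [sqrt n]. *)
Definition part_code (n r : nat) (la : seq nat) : {ffun 'I_r -> 'I_n.+1} * {ffun 'I_r -> 'I_n.+1} :=
  ([ffun i : 'I_r => inord (part la i)], [ffun k : 'I_r => inord (count_mem (k : nat) la)]).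

(* At most r parts are at least r. *)
Lemma part_code_inj n r la mu : (n < r * r)%N -> partitions n la -> partitions n mu ->
  part_code n r la = part_code n r mu -> la = mu.
Proof.
move=> nr [la_part la_n] [mu_part mu_n] [/ffunP e1 /ffunP e2].
have E1 (i : nat) : (i < r)%N -> part la i = part mu i.
  move=> ir; have := e1 (Ordinal ir); rewrite !ffunE => /(congr1 val).
  by rewrite /= !inordK ?ltnS // -?[X in (_ <= X)%N]la_n ?part_le_sumn // la_n -mu_n part_le_sumn.
have szle nu : is_part nu -> (size nu <= sumn nu)%N by case/andP => _; apply: size_le_sumn.
have E2 (k : nat) : (k < r)%N -> count_mem k la = count_mem k mu.
  move=> kr; have := e2 (Ordinal kr); rewrite !ffunE => /(congr1 val).
  rewrite /= !inordK // ltnS; apply: leq_trans (count_size _ _) _.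
    by rewrite -mu_n szle.
  by rewrite -la_n szle.
have big nu k : partitions n nu -> (r <= k)%N -> count_mem k nu = (\sum_(i < r) (part nu i == k))%N.
  move=> [nu_part nu_n] rk; have k0 : (0 < k)%N by apply: leq_trans rk; rewrite lt0n; apply/eqP => r0; move: nr; rewrite [in X in (_ < X)%N]r0; lia.
  rewrite (@count_mem_part nu k (r + size nu)) ?leq_addl // big_split_ord /= [X in (_ + X)%N]big1 ?addn0 //.
  move=> i _; case: eqP => // e; have := part_mul_le_sumn (r + i) nu_part.
  by rewrite nu_n e; nia.
have perm : perm_eq la mu.
  apply/allP => k _ /=; apply/eqP; case: (ltnP k r) => [/E2 //|rk].
  by rewrite !big //; apply: eq_bigr => i _; rewrite E1.
have geq_tr : transitive geq by move=> a b c; rewrite /geq /= => H1 H2; apply: leq_trans H2 H1.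
have geq_anti : antisymmetric geq by move=> a b; rewrite /geq /= andbC => /anti_leq.
by case/andP: la_part => ls _; case/andP: mu_part => ms _; apply: (sorted_eq geq_tr geq_anti ls ms perm).
Qed.

Lemma finite_partitions n : finite_set (partitions n).
Proof.
pose code := part_code n n.+1.
pose decode t := xget [::] [set la | partitions n la /\ code la = t].
apply: (@sub_finite_set _ _ [set` [seq decode t | t <- enum {: {ffun 'I_n.+1 -> 'I_n.+1} * {ffun 'I_n.+1 -> 'I_n.+1}}]]);
  last exact: finite_seq.
move=> la la_n /=; apply/mapP; exists (code la); first by rewrite mem_enum.
have [dn de] : partitions n (decode (code la)) /\ code (decode (code la)) = code la.
  have ex : exists nu, [set nu | partitions n nu /\ code nu = code la] nu by exists la.
  exact: (xgetPex [::] ex).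
have nr : (n < n.+1 * n.+1)%N by lia.
exact: (part_code_inj nr la_n dn (esym de)).
Qed.

Lemma size_partition_subset n r (S : set (seq nat)) : (n < r * r)%N -> S `<=` partitions n ->
  (size (finmap.enum_fset (fset_set S)) <= n.+1 ^ (r + r))%N.
Proof.
move=> nr Sn; have Sfin : finite_set S by apply: sub_finite_set Sn (finite_partitions n).
rewrite -(size_map (part_code n r)).
have -> : (n.+1 ^ (r + r) = size (enum {: {ffun 'I_r -> 'I_n.+1} * {ffun 'I_r -> 'I_n.+1}}))%N.
  by rewrite -cardE card_prod !card_ffun !card_ord expnD.
apply: uniq_leq_size; last by move=> t _; rewrite mem_enum.
rewrite map_inj_in_uniq ?finmap.fset_uniq // => la mu.
by rewrite !in_fset_set // !inE => /Sn hl /Sn hm; apply: (part_code_inj nr hl hm).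
Qed.

Lemma fsbig_partitions_le (R : realType) n r (S : set (seq nat)) (F : seq nat -> R) (c : R) :
  (n < r * r)%N -> S `<=` partitions n -> 0 <= c -> (forall la, S la -> F la <= c) ->
  \sum_(la \in S) F la <= (n.+1 ^ (r + r))%N%:R * c.
Proof.
move=> nr Sn c0 Fc; have Sfin : finite_set S by apply: sub_finite_set Sn (finite_partitions n).
rewrite fsbig_finite //; apply: (@le_trans _ _ (\sum_(la <- finmap.enum_fset (fset_set S)) c)).
  by rewrite big_seq [X in _ <= X]big_seq; apply: ler_sum => la; rewrite in_fset_set // inE => /Fc.
rewrite big_const_seq count_predT iter_addr_0 -[X in X <= _]mulr_natl; apply: ler_wpM2r => //.
by rewrite ler_nat size_partition_subset.
Qed.

Lemma fsbig_partitions_ge (R : realType) n (F : seq nat -> R) la :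
  partitions n la -> (forall mu, 0 <= F mu) -> F la <= \sum_(mu \in partitions n) F mu.
Proof.
move=> la_n F0; rewrite fsbig_finite; last exact: finite_partitions.
rewrite (bigD1_seq la) ?finmap.fset_uniq //=.
  by rewrite lerDl; apply: sumr_ge0.
by rewrite in_fset_set ?inE //; apply: finite_partitions.
Qed.

(** * Relative weights and the comparison of exponents *)

Section FinalEstimate.
Variable R : realType.
Local Open Scope classical_set_scope.

Lemma harmonic_sum_le n : (0 < n)%N -> harmonic_sum R n <= 1 + ln n%:R.
Proof.
case: n => // n _; rewrite /harmonic_sum; elim: n => [|n IH]; first by rewrite big_ord1 invr1 ln1 addr0.
rewrite big_ord_recr /=; apply: le_trans (lerD IH (lexx _)) _.
have p k : 0 < k.+1%:R :> R by rewrite ltr0n.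
have := @le_ln1Dx R (- n.+2%:R^-1).
have -> : 1 + - n.+2%:R^-1 = n.+1%:R / n.+2%:R :> R.
  have := p n; rewrite -[n.+2%:R]natr1 => h; field; apply: lt0r_neq0; lra.
rewrite lnM ?posrE ?invr_gt0 ?p // lnV ?posrE ?p // ltrN2 invf_lt1 ?p // ltr1n => /(_ isT).
set u := n.+2%:R^-1; lra.
Qed.

Definition involution_class_card (n : nat) : R := #|cycle_class n (nseq n./2 2%N)|%:R.

Lemma class_ratio_ge0 n : 0 <= involution_class_card n ^+ 4 / n`!%:R ^+ 2.
Proof. by apply: divr_ge0; apply: exprn_ge0; rewrite ?/involution_class_card ler0n. Qed.

Lemma pillow_weight_ge0 la : 0 <= pillow_weight R la.
Proof. by rewrite /pillow_weight mulr_ge0 ?sqr_ge0 // (_ : 4 = 2 * 2)%N // exprM sqr_ge0. Qed.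

(** On one row the character equals the dimension everywhere, so the weight is [specht_dim ^+ 2]
    times the left side. Since it only serves to bound the total weight from below,
    [specht_dim >= 1] is enough. *)
Lemma pillow_weight_row n :
  involution_class_card n.+1 ^+ 4 / (n.+1)`!%:R ^+ 2 <= pillow_weight R [:: n.+1].
Proof.
have d0 : (0 < specht_dim R [:: n.+1])%N by apply: specht_dim_gt0.
have dn0 : (specht_dim R [:: n.+1])%:R != 0 :> R by rewrite pnatr_eq0 -lt0n.
rewrite /pillow_weight /central_char specht_char_row mulfK //.
have -> : #|cycle_class (sumn [:: n.+1]) (nseq (sumn [:: n.+1])./2 2%N)|%:R = involution_class_card n.+1.
  by rewrite -[n.+1 in RHS]addn0.
have alg (d h K : R) : (d / h) ^+ 2 * K ^+ 4 = d ^+ 2 * (K ^+ 4 / h ^+ 2).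
  by rewrite expr_div_n; ring.
rewrite alg [sumn _]/= addn0 ler_peMl ?class_ratio_ge0 //.
by apply: exprn_ege1; rewrite ler1n.
Qed.

Lemma pillow_weight_le la n q : 0 <= q -> is_part la -> sumn la = n.+1 ->
  (forall g, g \in cycle_class (sumn la) (nseq n.+1./2 2%N) ->
     (specht_char R g ^+ 2 / (specht_dim R la)%:R) ^+ 2 <= q) ->
  pillow_weight R la <= q * pillow_weight R [:: n.+1].
Proof.
move=> q0 la_part lan Hq; have dn0 : (specht_dim R la)%:R != 0 :> R.
  by rewrite pnatr_eq0 -lt0n (specht_dim_gt0 R).
pose C := cycle_class (sumn la) (nseq (sumn la)./2 2%N).
have cardC : #|C|%:R = involution_class_card n.+1 by rewrite /C /involution_class_card lan.
have wE : pillow_weight R la = involution_class_card n.+1 ^+ 4 / (n.+1)`!%:R ^+ 2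
    * (specht_char R (repr C) ^+ 2 / (specht_dim R la)%:R) ^+ 2.
  have fE : (sumn la)`!%:R = (n.+1)`!%:R :> R by rewrite lan.
  rewrite /pillow_weight /central_char -/C cardC fE.
  have f0 : (n.+1)`!%:R != 0 :> R by rewrite pnatr_eq0 -lt0n fact_gt0.
  by field; rewrite dn0 f0.
(* For an empty class [repr C] is not a member, but the cardinal of the class annihilates the
   weight. *)
rewrite wE; have [C0|[g gC]] := set_0Vmem C.
  by rewrite -cardC C0 cards0 expr0n !mul0r mulr_ge0 ?pillow_weight_ge0.
have rC : repr C \in C by apply: mem_repr gC.
have qle : (specht_char R (repr C) ^+ 2 / (specht_dim R la)%:R) ^+ 2 <= q.
  have hE : nseq (sumn la)./2 2%N = nseq n.+1./2 2%N by rewrite lan.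
  by apply: Hq; rewrite -hE.
have w1 := pillow_weight_row n; rewrite [q * _]mulrC; apply: ler_pM => //; last exact: sqr_ge0.
exact: class_ratio_ge0.
Qed.

(** The integral bound with [c ^+ 2 = 2n] gives [eps^2 < 48 (4 E + 10 S) / (2n)], hence
    [E > n eps^2 / 96 - 5/2 S]. The constant [9/2] adds this [5/2], the diagonal 1, and the 1 from
    the harmonic sum. *)
Lemma distant_ln_ratio_le (eps : R) (n : nat) (la : seq nat) (g : 'S_(sumn la)) :
  0 < eps -> (0 < n)%N -> ~~ odd n -> distant_quotient_set eps n la ->
  g \in cycle_class (sumn la) (nseq n./2 2%N) ->
  ln (specht_char R g ^+ 2 / (specht_dim R la)%:R)
  <= ln n.+1%:R - n%:R * eps ^+ 2 / 96
     + 2 * Num.sqrt n%:R * (ln (n.*2)%:R + 9 / 2).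
Proof.
move=> e0 n0 en [[la_part lan] _ [al [be [quot norm]]]] gC.
have n2 : n = (2 * n./2)%N by rewrite mul2n -[LHS]odd_double_half (negbTE en).
case: (quot) => al_part be_part _ _.
have rim_a : is_rim al (@rim R al) by apply: (getPex (ex_intro _ _ (rim_formula_is_rim R al_part))).
have rim_b : is_rim be (@rim R be) by apply: (getPex (ex_intro _ _ (rim_formula_is_rim R be_part))).
have la_size : (size la <= n + n)%N.
  by rewrite (leq_trans (size_le_sumn _)) ?lan ?leq_addr //; case/andP: la_part.
have B_big (i : 'I_(n + n)) : (beads la (n + n) i < (n.*2).*2)%N.
  by have := part_le_sumn la i; rewrite lan /beads; have := ltn_ord i; lia.
pose f := bead_charge R la n; pose B := n.*2.
have f_big : forall x, (B <= x)%N -> f x = 0 by apply: charge_big.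
have F0 : partial_sum f B = 0 by apply: (partial_sum_charge la_part la_size quot rim_a rim_b B_big).
have nR : 0 < n%:R :> R by rewrite ltr0n.
have c0 : 0 < Num.sqrt (2 * n%:R) :> R by rewrite sqrtr_gt0 mulr_gt0.
have LE s : (rescaled_rim n al \- rescaled_rim n be) s
    = (rim al (Num.sqrt (2 * n%:R) * s) - rim be (Num.sqrt (2 * n%:R) * s)) / Num.sqrt (2 * n%:R) :> R.
  by rewrite /= /rescaled_rim mulrBl.
have I := integral_difference_quotient_le c0 LE (quotient_rim_continuous rim_a rim_b) f_big F0
  (quotient_rim_grid la_part la_size quot rim_a rim_b).
rewrite sqr_sqrtr ?mulr_ge0 // in I.
set E := log_energy f B in I; set S2 := \sum_(x < B) f x ^+ 2 in I.
pose S := \sum_(x < B) `|f x|.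
have S2E : S2 = S.
  apply: eq_bigr => x _; rewrite /f /bead_charge /bead_ind.
  by case: [exists i, _]; case: [exists i, _];
    rewrite /= ?subrr ?subr0 ?sub0r ?normrN ?normr0 ?normr1 ?sqrrN ?expr0n ?expr1n.
have eps_lt : eps ^+ 2 < 48 * (4 * E + 10 * S2) / (2 * n%:R).
  set Q := 48 * _ / _ in I *.
  have [Q0|Q0] := lerP 0 Q.
    have : (eps%:E < (Num.sqrt Q)%:E)%E.
      apply: (lt_le_trans norm); rewrite /sobolev_norm -[(Num.sqrt Q)%:E]/(sqrte Q%:E).
      by rewrite lee_sqrt // lee_fin.
    rewrite lte_fin => lt; rewrite -[Q]sqr_sqrtr //.
    by rewrite ltrXn2r // ?nnegrE ?ltW ?sqrtr_ge0.
  have : (eps%:E < 0)%E.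
    apply: (lt_le_trans norm); rewrite /sobolev_norm.
    have -> : (0 = sqrte (0 : \bar R))%E by rewrite /= sqrtr0.
    by rewrite lee_sqrt // (le_trans I) // lee_fin ltW.
  by rewrite lte_fin ltNge (ltW e0).
have E_gt : n%:R * eps ^+ 2 / 96 - 5 / 2 * S < E.
  move: eps_lt; rewrite S2E ltr_pdivlMr ?mulr_gt0 //; lra.
have la_m : sumn la = (2 * n./2)%N by rewrite lan.
have nB : (n <= B)%N by rewrite /B -addnn leq_addr.
have B0 : (0 < B)%N by rewrite /B double_gt0.
have := @ln_specht_ratio_le R la n./2 n B la_part la_size la_m B_big F0 nB g gC.
rewrite -n2 -/f -/E -/S => le.
have S_le : S <= 2 * Num.sqrt n%:R.
  have h := sum_abs_charge_le la_part la_size la_m B_big F0 nB.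
  apply: (le_trans h); rewrite ler_pM2l //.
  have dur := durfee_sqr_le la_part la_size; rewrite lan in dur.
  rewrite -(@ger0_norm _ (durfee la (n + n))%:R) // -sqrtr_sqr ler_sqrt //.
  by rewrite -natrX ler_nat.
have S0 : 0 <= S by apply: sumr_ge0.
have H_le : harmonic_sum R B <= 1 + ln B%:R.
  exact: harmonic_sum_le.
have ln0' : 0 <= ln B%:R :> R by rewrite ln_ge0 // ler1n.
have prod : S * (harmonic_sum R B + 7 / 2) <= 2 * Num.sqrt n%:R * (ln B%:R + 9 / 2).
  apply: ler_pM => //; last by lra.
  by rewrite addr_ge0 // sumr_ge0 // => k _; rewrite invr_ge0.
rewrite mulrDr in prod; rewrite [S * _]mulrDr in le.
move: le prod E_gt; rewrite -/B mulr1; set SH := S * harmonic_sum R B.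
set T := 2 * Num.sqrt n%:R * _; set U := n%:R * eps ^+ 2 / 96; lra.
Qed.

Lemma pillow_prob_le (n r : nat) (S : set (seq nat)) (q : R) :
  (n.+1 < r * r)%N -> S `<=` partitions n.+1 -> 0 <= q ->
  (forall la, S la -> forall g, g \in cycle_class (sumn la) (nseq n.+1./2 2%N) ->
     (specht_char R g ^+ 2 / (specht_dim R la)%:R) ^+ 2 <= q) ->
  `|pillow_prob R n.+1 S| <= (n.+2 ^ (r + r))%N%:R * q.
Proof.
move=> nr Sn q0 Hq; rewrite /pillow_prob.
set w0 := pillow_weight R [:: n.+1]; have w00 : 0 <= w0 by apply: pillow_weight_ge0.
have num : \sum_(la \in S) pillow_weight R la <= (n.+2 ^ (r + r))%N%:R * (q * w0).
  apply: fsbig_partitions_le => //; first exact: mulr_ge0.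
  by move=> la Sla; have [la_part lan] := Sn _ Sla; apply: pillow_weight_le => // g; apply: Hq.
have den : w0 <= \sum_(la \in partitions n.+1) pillow_weight R la.
  apply: fsbig_partitions_ge; last exact: pillow_weight_ge0.
  by split => //=; rewrite addn0.
have num0 : 0 <= \sum_(la \in S) pillow_weight R la by apply: fsumr_ge0 => la _; apply: pillow_weight_ge0.
set A := \sum_(la \in S) _ in num num0 *; set Z := \sum_(la \in _) _ in den *.
have Z0 : 0 <= Z := le_trans w00 den.
have N0 : 0 <= (n.+2 ^ (r + r))%N%:R * q by rewrite mulr_ge0.
rewrite ger0_norm; last exact: divr_ge0.
have [->|Zn] := eqVneq Z 0; first by rewrite invr0 mulr0.
have Zp : 0 < Z by rewrite lt_def Zn.
rewrite ler_pdivrMr //; apply: le_trans num _; rewrite mulrA.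
exact: ler_wpM2l.
Qed.

(** Put [t = n^(1/4)], so that [ln n <= 4 t]. The errors are then at most [20], [10], [38] and [1]
    times [t^3], in total [69 t^3], while the gain is [t^3 * (t * eps^2) / 48]. *)
Lemma exponent_le (eps : R) (n : nat) : 0 < eps -> (0 < n)%N ->
  (69 * 48 / eps ^+ 2) ^+ 4 <= n%:R ->
  2 * (Num.sqrt n%:R + 1) * ln n.+1%:R
  + 2 * (ln n.+1%:R - n%:R * eps ^+ 2 / 96 + 2 * Num.sqrt n%:R * (ln (n.*2)%:R + 9 / 2))
  <= - Num.sqrt n%:R.
Proof.
move=> e0 n0 big; set s := Num.sqrt n%:R; pose t := Num.sqrt s.
have nR : 1 <= n%:R :> R by rewrite ler1n.
have s1 : 1 <= s by rewrite -sqrtr1 ler_sqrt.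
have t1 : 1 <= t by rewrite -sqrtr1 ler_sqrt //; lra.
have st : s = t ^+ 2 by rewrite sqr_sqrtr //; lra.
have nt : n%:R = t ^+ 4 by rewrite (exprM t 2 2) -st sqr_sqrtr //; lra.
have e2 : 0 < eps ^+ 2 by rewrite exprn_gt0.
have T0 : 0 <= 69 * 48 / eps ^+ 2 by rewrite divr_ge0 // ltW.
have tT : 69 * 48 <= t * eps ^+ 2.
  rewrite -ler_pdivrMr // -(@ler_pXn2r _ 4) ?nnegrE //; [by rewrite -nt | lra].
have ln_double : ln (n.*2)%:R <= 1 + 4 * t.
  rewrite -mul2n natrM lnM ?posrE //; last by lra.
  have lnt : ln t <= t.
    have h : -1 < t - 1 by lra.
    by have := le_ln1Dx h; rewrite [1 + _]addrC subrK; lra.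
  have := ln2_le1 R; rewrite nt lnXn; last by lra.
  by rewrite -mulr_natl; lra.
have ln_succ : ln n.+1%:R <= 1 + 4 * t.
  apply: le_trans ln_double; rewrite ler_ln ?posrE ?ltr0n ?double_gt0 // ler_nat; lia.
rewrite st nt; set l1 := ln n.+1%:R in ln_succ *; set l2 := ln (n.*2)%:R in ln_double *.
have t3 : t ^+ 3 * (69 * 48) <= t ^+ 3 * (t * eps ^+ 2) by apply: ler_wpM2l => //; rewrite exprn_ge0 //; lra.
have b1 : 2 * (t ^+ 2 + 1) * l1 <= 20 * t ^+ 3.
  apply: (@le_trans _ _ (2 * (t ^+ 2 + 1) * (1 + 4 * t))).
    by apply: ler_wpM2l => //; nra.
  nra.
have b2 : 2 * l1 <= 10 * t ^+ 3 by nra.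
have b3 : 4 * t ^+ 2 * (l2 + 9 / 2) <= 38 * t ^+ 3.
  apply: (@le_trans _ _ (4 * t ^+ 2 * (1 + 4 * t + 9 / 2))).
    by apply: ler_wpM2l; [nra | lra].
  nra.
have b4 : t ^+ 2 <= t ^+ 3 by nra.
have e4 : t ^+ 4 * eps ^+ 2 = t ^+ 3 * (t * eps ^+ 2) by ring.
rewrite e4; set X := t ^+ 3 * (t * eps ^+ 2) in t3 *.
have -> : 2 * (l1 - X / 96 + 2 * t ^+ 2 * (l2 + 9 / 2)) = 2 * l1 - X / 48 + 4 * t ^+ 2 * (l2 + 9 / 2).
  by field.
lra.
Qed.
End FinalEstimate.

Local Open Scope classical_set_scope.

Theorem proposition3p13 (R : realType) (eps : R) (heps : 0 < eps) :
  exists2 K : R, 0 < K &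
    exists C : R, \forall n \near \oo, ~~ odd n ->
      `|pillow_prob R n (distant_quotient_set eps n)|
        <= C * expR (- K * Num.sqrt n%:R).
Proof.
(* The gain is linear in [n], so rate 1 and constant 1 serve every [eps]; only the threshold depends
   on it. *)
exists 1 => //; exists 1.
exists (Num.truncn ((69 * 48 / eps ^+ 2) ^+ 4)).+1 => //= n nbig even_n.
have n0 : (0 < n)%N by apply: leq_trans nbig.
have big : (69 * 48 / eps ^+ 2) ^+ 4 <= n%:R.
  by apply: ltW; apply: (lt_le_trans (truncnS_gt _)); rewrite ler_nat.
(* The choice of [r] just above [sqrt n] gives [n < r * r], so partitions are determined by their
   [part_code]. *)
pose s : R := Num.sqrt n%:R; pose r := (Num.truncn s).+1.
have s0 : 0 <= s by apply: sqrtr_ge0.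
have nr : (n < r * r)%N.
  rewrite -(ltr_nat R) natrM -[n%:R]sqr_sqrtr // expr2.
  by apply: ltr_pM => //; apply: truncnS_gt.
pose beta : R := ln n.+1%:R - n%:R * eps ^+ 2 / 96 + 2 * s * (ln (n.*2)%:R + 9 / 2).
have prob : `|pillow_prob R n (distant_quotient_set eps n)| <= (n.+1 ^ (r + r))%N%:R * expR (2 * beta).
  have P := @pillow_prob_le R n.-1 r (distant_quotient_set eps n) (expR (2 * beta)).
  rewrite prednK // in P; apply: P => //; first by move=> la [].
  move=> la la_S g gC; have [->|chi0] := eqVneq (specht_char R g) 0.
    by rewrite expr0n mul0r expr0n expR_ge0.
  have [[la_part _] _ _] := la_S.
  have pos : 0 < specht_char R g ^+ 2 / (specht_dim R la)%:R.
    by rewrite divr_gt0 ?exprn_even_gt0 //= ltr0n (specht_dim_gt0 R).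
  have le := distant_ln_ratio_le heps n0 even_n la_S gC.
  have {}le : specht_char R g ^+ 2 / (specht_dim R la)%:R <= expR beta.
    by rewrite -[X in X <= _]lnK ?posrE // ler_expR.
  by rewrite mulr_natl mulr2n expRD -expr2 lerXn2r ?nnegrE ?expR_ge0 // ltW.
rewrite mul1r mulN1r; apply: le_trans prob _.
have r_le : r%:R <= s + 1 by rewrite /r -natr1 lerD2r truncn_le.
have ln1 : 0 <= ln n.+1%:R :> R by rewrite ln_ge0 // ler1n.
have -> : (n.+1 ^ (r + r))%N%:R = expR (2 * r%:R * ln n.+1%:R) :> R.
  have -> : 2 * r%:R * ln n.+1%:R = ln (n.+1%:R ^+ (r + r)) :> R.
    by rewrite lnXn // -[RHS]mulr_natl natrD; ring.
  by rewrite lnK ?posrE ?exprn_gt0 // natrX.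
rewrite -expRD ler_expR; apply: le_trans (exponent_le heps n0 big).
by rewrite -/s lerD2r ler_wpM2r // ler_pM2l.
Qed.
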